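(* Let $k$ be a positive integer, let $\alpha,\beta$ be two nonconstant inner functions and let $U:K_\alpha\to K_\beta$ be a bounded linear operator. Then $U\in\mathcal{S}_k(\alpha,\beta)$ if and only if $$\langle US^kf,Sg\rangle=\langle Uf,g\rangle$$ for all $f\in K_\alpha$, $g\in K_\beta$ such that $S^kf\in K_\alpha$ and $Sg\in K_\beta$.
   Context: $L^2=L^2(\mathbb{T},m)$ with $m$ normalized Lebesgue measure on the unit circle $\mathbb{T}$; $H^2\subset L^2$ is the Hardy space of the unit disk and $H^\infty=H^2\cap L^\infty$. $S$ is the shift $Sf(z)=zf(z)$ on $H^2$. An inner function is $\alpha\in H^\infty$ with $|\alpha|=1$ a.e. on $\mathbb{T}$; $K_\alpha=H^2\ominus\alpha H^2$ is the model space, $P_\alpha$ is the orthogonal projection of $L^2$ onto $K_\alpha$, and $K_\alpha^\infty=K_\alpha\cap H^\infty$, a dense subset of $K_\alpha$. $W_k:L^2\to L^2$ is the bounded linear operator with $W_k(z^n)=z^{n/k}$ if $k\mid n$ and $W_k(z^n)=0$ otherwise ($n\in\mathbb{Z}$). For $\varphi\in L^2$ put $U_\varphi^{\alpha,\beta}f=P_\beta W_k(\varphi f)$, $f\in K_\alpha^\infty$. $\mathcal{S}_k(\alpha,\beta)$ is the set of all operators $U_\varphi^{\alpha,\beta}$, $\varphi\in L^2$, that extend boundedly to $K_\alpha$ (each identified with its bounded extension $K_\alpha\to K_\beta$). *)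

(* Defs.v *)
From HB Require Import structures.
From mathcomp Require Import all_boot all_order all_algebra.
From mathcomp Require Import complex.
From mathcomp Require Import all_classical all_reals all_analysis.
From mathcomp Require Import measurable_realfun ring lra.

Set Implicit Arguments.
Unset Strict Implicit.
Unset Printing Implicit Defensive.

Import Order.TTheory GRing.Theory Num.Theory.
Import numFieldNormedType.Exports.
Import Normc.

Local Open Scope classical_set_scope.
Local Open Scope ring_scope.
Local Open Scope complex_scope.

Section CircleSpaces.
Variable R : realType.
Local Notation C := R[i].
Local Notation mu := (@lebesgue_measure R).
Implicit Types (f g h a phi : C -> C) (E F : set (C -> C)).

(* Elements of L^2 are represented by functions C -> C, of which only the
   restriction to the unit circle matters, equality being equality almost
   everywhere on the circle.  The normalized Lebesgue measure of the circle is
   the image of the Lebesgue measure on [0, 1] by t |-> e^(2 i pi t); values,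
   measurability and integrals are pulled back to [0, 1] along this map. *)
Definition circ (t : R) : C := cos (2 * pi * t) +i* sin (2 * pi * t).

Definition ae_circle (P : C -> Prop) : Prop :=
  {ae mu, forall t, t \in `[0, 1] -> P (circ t)}.

Definition eq_circle f g : Prop := ae_circle (fun z => f z = g z).

Definition measurable_circle f : Prop :=
  measurable_fun (`[0, 1] : set R) (fun t : R => complex.Re (f (circ t))) /\
  measurable_fun (`[0, 1] : set R) (fun t : R => complex.Im (f (circ t))).

Definition integral_circle f : C :=
  (\int[mu]_(t in `[0, 1]) complex.Re (f (circ t))) +i*
  (\int[mu]_(t in `[0, 1]) complex.Im (f (circ t))).

Definition L2 : set (C -> C) := [set f | measurable_circle f /\
  (\int[mu]_(t in `[0%R, 1%R]) (normc (f (circ t)) ^+ 2)%:E < +oo)%E].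

Definition Linfty : set (C -> C) := [set f | measurable_circle f /\
  exists M : R, ae_circle (fun z => normc (f z) <= M)].

Definition dotL2 f g : C := integral_circle (fun z => f z * (g z)^*).

Definition normL2 f : R :=
  Num.sqrt (\int[mu]_(t in `[0, 1]) (normc (f (circ t)) ^+ 2)).

Definition fourier f (n : int) : C := dotL2 f (fun z => z ^ n).

(* The Hardy space of the disk, seen inside L^2 through boundary values. *)
Definition H2 : set (C -> C) :=
  [set f | L2 f /\ forall n : int, n < 0 -> fourier f n = 0].

Definition Hinfty : set (C -> C) := H2 `&` Linfty.

Definition inner_function a : Prop :=
  Hinfty a /\ ae_circle (fun z => normc (a z) = 1).

Definition nonconstant a : Prop := ~ exists c : C, eq_circle a (cst c).

Definition shiftH f : C -> C := fun z => z * f z.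

Definition model_space a : set (C -> C) :=
  [set f | H2 f /\ forall h, H2 h -> dotL2 f (fun z => a z * h z) = 0].

Definition model_space_bounded a : set (C -> C) := model_space a `&` Hinfty.

(* h is (a representative of) the orthogonal projection of f onto E. *)
Definition is_orthproj E f h : Prop :=
  E h /\ forall g, E g -> dotL2 (fun z => f z - h z) g = 0.

(* Bounded linear operators from E to F.  Together, linearity and boundedness
   force T to be compatible with almost everywhere equality. *)
Definition bounded_linear_op E F (T : (C -> C) -> (C -> C)) : Prop :=
  [/\ forall f, E f -> F (T f),
      forall (c : C) f g, E f -> E g ->
        eq_circle (T (fun z => c * f z + g z)) (fun z => c * T f z + T g z) &
      exists M : R, forall f, E f -> normL2 (T f) <= M * normL2 f].

(* The operator W_k, which these conditions determine (up to almost everywhere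
   equality) because the z^n span a dense subspace of L^2.  One
   exists: see is_W_exists. *)
Definition is_W (k : nat) (W : (C -> C) -> (C -> C)) : Prop :=
  bounded_linear_op L2 L2 W /\
  forall n : int, eq_circle (W (fun z => z ^ n))
    (if (k %| n)%Z then fun z => z ^ (n %/ k)%Z else cst 0).

(* U belongs to S_k(a, b): U : K_a -> K_b is the bounded extension of
   f |-> P_b (W_k (phi f)), f in K_a^oo, for some phi in L^2. *)
Definition slant_class (W : (C -> C) -> (C -> C)) a b
    (U : (C -> C) -> (C -> C)) : Prop :=
  bounded_linear_op (model_space a) (model_space b) U /\
  exists2 phi, L2 phi &
    forall f, model_space_bounded a f ->
      is_orthproj (model_space b) (W (fun z => phi z * f z)) (U f).

End CircleSpaces.

Section ExistenceOfW.
Variable R : realType.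
Local Notation C := R[i].
Local Notation mu := (@lebesgue_measure R).
Local Notation circ := (@circ R).

Lemma circD s t : circ (s + t) = circ s * circ t.
Proof.
rewrite /circ mulrDr cosD sinD; apply/eqP; rewrite eq_complex /=.
by rewrite eqxx addrC eqxx.
Qed.

Lemma circ0 : circ 0 = 1.
Proof. by rewrite /circ mulr0 cos0 sin0. Qed.

Lemma circ1 : circ 1 = 1.
Proof. by rewrite /circ mulr1 mulrC mulr_natr cos2pi sin2pi. Qed.

Lemma circN t : circ (- t) = (circ t)^-1.
Proof.
have h : circ t * circ (- t) = 1 by rewrite -circD subrr circ0.
have n0 : circ t != 0 by apply/eqP => e; move: h; rewrite e mul0r => /eqP; rewrite eq_sym oner_eq0.
by apply: (mulfI n0); rewrite h divff.
Qed.

Lemma circ_nat (n : nat) t : circ (t * n%:R) = circ t ^+ n.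
Proof.
elim: n => [|n ih]; first by rewrite mulr0 circ0 expr0.
by rewrite -natr1 mulrDr mulr1 circD ih exprSr.
Qed.

Lemma circ_int (n : int) t : circ (t * n%:~R) = circ t ^ n.
Proof.
case: n => n; first by rewrite -pmulrn circ_nat.
by rewrite [in LHS]NegzE mulrNz mulrN circN -pmulrn circ_nat.
Qed.

Lemma circ_eq1 u : 0 <= u < 1 -> circ u = 1 -> u = 0.
Proof.
move=> /andP[u0 u1] [] h _; apply/eqP; rewrite eq_le u0 andbT leNgt.
apply/negP => up.
have sp : 0 < sin (pi * u).
  by rewrite sin_gt0_pi// mulr_gt0 ?pi_gt0//= gtr_pMr// pi_gt0.
have e : 2 * pi * u = (pi * u) *+ 2 by rewrite mulr2n; ring.
move: h; rewrite e cos_mulr2n cos2sin2 => h.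
have : 0 < sin (pi * u) ^+ 2 by rewrite exprn_gt0.
lra.
Qed.

Lemma circ_inj s t : 0 <= s < 1 -> 0 <= t < 1 -> circ s = circ t -> s = t.
Proof.
wlog st : s t / s <= t => [H hs ht e|].
  by case: (leP s t) => [st|/ltW st]; [exact: H | apply/esym/H].
move=> /andP[s0 s1] /andP[t0 t1] e.
suff: t - s = 0 by move/eqP; rewrite subr_eq0 => /eqP ->.
apply: circ_eq1; first by apply/andP; split; lra.
by rewrite circD circN -e mulfV//; apply/eqP => z; have := circD s (- s);
  rewrite subrr circ0 z mul0r => /eqP; rewrite oner_eq0.
Qed.

Lemma sum_shift (F : nat -> C) n : F n = F 0%N ->
  \sum_(j < n) F j = \sum_(j < n) F j.+1.
Proof.
case: n => [|n] e; first by rewrite !big_ord0.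
by rewrite big_ord_recl [RHS]big_ord_recr /= e addrC.
Qed.

Variable k : nat.
Hypothesis k0 : (0 < k)%N.
Let kR0 : 0 < k%:R :> R. Proof. by rewrite ltr0n. Qed.

(* The witness for W_k averages f over the k-th roots of z. *)
Definition targ (z : C) : R := xget 0 [set t | 0 <= t < 1 /\ circ t = z].

Definition Wf (f : C -> C) (z : C) : C :=
  k%:R^-1 * \sum_(j < k) f (circ ((targ z + j%:R) / k%:R)).

Lemma targ_circ t : 0 <= t < 1 -> targ (circ t) = t.
Proof.
move=> ht; rewrite /targ; case: xgetP => [x _ /= [hx e]|/(_ t)]; first exact: circ_inj.
by case.
Qed.

Lemma Wf_circ f t : 0 <= t <= 1 ->
  Wf f (circ t) = k%:R^-1 * \sum_(j < k) f (circ ((t + j%:R) / k%:R)).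
Proof.
move=> /andP[t0]; rewrite le_eqVlt => /orP[/eqP->|t1]; last first.
  by rewrite /Wf targ_circ// t0 t1.
have -> : circ 1 = circ 0 by rewrite circ0 circ1.
rewrite /Wf targ_circ ?lexx ?ltr01//; congr (_ * _).
pose F (j : nat) := f (circ (j%:R / k%:R)).
have -> : \sum_(j < k) f (circ ((0 + j%:R) / k%:R)) = \sum_(j < k) F j.
  by apply: eq_bigr => i _; rewrite add0r.
have -> : \sum_(j < k) f (circ ((1 + j%:R) / k%:R)) = \sum_(j < k) F j.+1.
  by apply: eq_bigr => i _; rewrite /F -[i.+1%:R]natr1 addrC.
apply: sum_shift; rewrite /F mul0r divff ?circ1 ?circ0// gt_eqF//.
Qed.

Lemma Wf_lin c f g z : Wf (fun z => c * f z + g z) z = c * Wf f z + Wf g z.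
Proof. rewrite /Wf big_split/= -mulr_sumr; ring. Qed.

Lemma Wf_expz (n : int) t : 0 <= t <= 1 ->
  Wf (fun z => z ^ n) (circ t) = if (k %| n)%Z then circ t ^ (n %/ k)%Z else 0.
Proof.
move=> ht; rewrite Wf_circ//.
have kZ : k%:Z != 0 by rewrite eqz_nat -lt0n.
pose w := circ (n%:~R / k%:R).
have E (j : nat) : circ ((t + j%:R) / k%:R) ^ n = circ (t * n%:~R / k%:R) * w ^+ j.
  by rewrite -circ_int -circ_nat -circD; congr circ; ring.
under eq_bigr => j _ do rewrite E.
rewrite -mulr_sumr; case: ifPn => [/dvdzP[q nE]|ndv].
  have w1 : w = 1.
    by rewrite /w nE rmorphM /= mulfK ?gt_eqF// -[q%:~R]mul1r circ_int circ1 exp1rz.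
  have -> : (n %/ k)%Z = q by rewrite nE mulzK.
  rewrite w1; under eq_bigr => j _ do rewrite expr1n.
  have -> : t * n%:~R / k%:R = t * q%:~R.
    by rewrite nE rmorphM /= -mulrA mulfK ?gt_eqF.
  rewrite sumr_const card_ord circ_int -[1 *+ k]/(k%:R).
  by rewrite mulrCA mulVf ?mulr1// pnatr_eq0 -lt0n.
suff -> : \sum_(i < k) w ^+ i = 0 by rewrite !mulr0.
have wk : w ^+ k = 1.
  by rewrite -circ_nat divfK ?gt_eqF// -[n%:~R]mul1r circ_int circ1 exp1rz.
have w1 : w - 1 != 0.
  rewrite subr_eq0; apply: contra ndv => /eqP w1.
  pose r := (n %% k)%Z.
  have wE : w = circ (r%:~R / k%:R).
    rewrite /w {1}(divz_eq n k) rmorphD rmorphM /= mulrDl mulfK ?gt_eqF//.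
    by rewrite circD -[X in circ X]mul1r circ_int circ1 exp1rz mul1r.
  have r0 : (0 <= r)%R by rewrite modz_ge0.
  have rk : (r < k)%R by rewrite ltz_pmod.
  rewrite w1 in wE; move/esym/circ_eq1: wE => /=.
  rewrite divr_ge0 ?ler0z ?ler0n//= ltr_pdivrMr// mul1r -[k%:R]/(k%:~R) ltr_int rk.
  move=> /(_ isT)/eqP; rewrite mulf_eq0 invr_eq0 (gt_eqF kR0) orbF intr_eq0 => /eqP rr.
  by apply/dvdz_mod0P.
by apply: (mulfI w1); rewrite -subrX1 wk subrr mulr0.
Qed.

Lemma normc_sqr (z : C) : normc z ^+ 2 = complex.Re z ^+ 2 + complex.Im z ^+ 2.
Proof. by case: z => a b /=; rewrite sqr_sqrtr// addr_ge0// sqr_ge0. Qed.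

Lemma measurable_normc_sqr (f : C -> C) : measurable_circle f ->
  measurable_fun (`[0, 1] : set R) (fun t : R => (normc (f (circ t)) ^+ 2)).
Proof.
move=> [mr mi].
rewrite [X in measurable_fun _ X](_ : _ =
    (fun t => complex.Re (f (circ t)) ^+ 2 + complex.Im (f (circ t)) ^+ 2)); last first.
  by apply/funext => t; exact: normc_sqr.
by apply: measurable_funD; apply: measurable_funX.
Qed.

Definition aff (j : nat) (t : R) : R := (t + j%:R) / k%:R.

Lemma in01_aff (j : nat) t : (j < k)%N -> 0 <= t <= 1 -> 0 <= aff j t <= 1.
Proof.
move=> jk /andP[t0 t1]; rewrite /aff divr_ge0 ?addr_ge0//= ?(ltW kR0)// ler_pdivrMr// mul1r.
have : j%:R + 1 <= k%:R :> R by rewrite natr1 ler_nat.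
lra.
Qed.

Lemma integral_affine (G : R -> \bar R) (j : nat) :
  (j < k)%N -> measurable_fun (`[0, 1] : set (measurableTypeR R)) G -> (forall t, 0 <= G t)%E ->
  (\int[mu]_(t in `[0%R, 1%R]) (G \o aff j) t
     <= k%:R%:E * \int[mu]_(t in `[0%R, 1%R]) G t)%E.
Proof.
move=> jk mG G0.
have mphi : measurable_fun setT (aff j : measurableTypeR R -> measurableTypeR R).
  by apply: measurable_funM => //; apply: measurable_funD.
pose phi : {mfun measurableTypeR R >-> measurableTypeR R} :=
  HB.pack (aff j : measurableTypeR R -> measurableTypeR R) (isMeasurableFun.Build _ _ _ _ _ mphi).
pose ki : {nonneg R} := NngNum (ltW kR0).
have mI : measurable (`[0%R, 1%R]%classic : set R) by exact: measurable_itv.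
have mphiA (A : set R) : measurable A ->
    pushforward mu phi A = mscale ki mu A.
  move=> mA.
  have ki0 : 0 <= k%:R^-1 :> R by rewrite invr_ge0 ltW.
  pose ki' : {nonneg R} := NngNum ki0.
  have muE : mu A = mscale ki' (pushforward mu phi) A.
    have := (@lebesgue_measure_unique R (mscale ki' (pushforward mu phi))).
    move=> H m; apply: (H m) => //= _ [[a b]] _ <-.
    rewrite /mscale /pushforward /=.
    rewrite [X in (_ * lebesgue_measure X)%E](_ : _ =
      `]a * k%:R - j%:R, b * k%:R - j%:R]%classic); last first.
      apply/seteqP; split => x /=; rewrite !in_itv/= /aff ltr_pdivlMr// ler_pdivrMr//;
      by rewrite ltrBlDr lerBrDr.
    rewrite !lebesgue_measure_itv/= !lte_fin ltrD2r ltr_pM2r//.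
    case: ifPn => ab; last by rewrite mule0.
    by rewrite -EFinM; congr EFin; field; rewrite gt_eqF.
  move: (muE mphi); rewrite /mscale/= => ->; rewrite muleA -EFinM divff ?gt_eqF// mul1e//.
have mG' : measurable_fun ((aff j : measurableTypeR R -> measurableTypeR R) @^-1` `[0, 1])
    (G \o aff j).
  apply: (measurable_comp _ _ mG) => //.
    by move=> _ [x hx <-].
  by apply: (measurable_funS _ _ (mphi)).
have <- : (\int[mscale ki mu]_(t in `[0%R, 1%R]) G t
   = k%:R%:E * \int[mu]_(t in `[0%R, 1%R]) G t)%E by rewrite ge0_integral_mscale.
rewrite (@eq_measure_integral _ _ _ _ (pushforward mu phi) (mscale ki mu)); last first.
  by move=> A mA _; exact/esym/mphiA.
rewrite ge0_integral_pushforward//.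
have mpre : measurable ((aff j : measurableTypeR R -> measurableTypeR R) @^-1` `[0, 1]).
  by rewrite -[X in measurable X]setTI; apply: (mphi) => //.
apply: ge0_subset_integral => // t /=; first by move=> _; exact: G0.
by rewrite !in_itv/=; exact: in01_aff.
Qed.

Lemma sqr_sum_le (x : nat -> R) n :
  (\sum_(j < n) x j) ^+ 2 <= 2 ^+ n * \sum_(j < n) x j ^+ 2.
Proof.
elim: n => [|n ih]; first by rewrite !big_ord0 mulr0 expr0n.
rewrite !big_ord_recr/= [2 ^+ n.+1]exprS; set S := \sum_(i < n) x i in ih *.
set Q := \sum_(i < n) _ in ih *.
have Q0 : 0 <= Q by apply: sumr_ge0 => i _; exact: sqr_ge0.
have h1 : 1 <= 2 ^+ n :> R by rewrite exprn_ege1// ler1n.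
have s0 := sqr_ge0 (S - x n). have s1 := sqr_ge0 (x n).
have : x n ^+ 2 <= 2 ^+ n * x n ^+ 2 by rewrite ler_peMl.
have -> : (S + x n) ^+ 2 = 2 * S ^+ 2 + 2 * x n ^+ 2 - (S - x n) ^+ 2 by ring.
nra.
Qed.

Lemma ReD (x y : C) : complex.Re (x + y) = complex.Re x + complex.Re y.
Proof. by case: x y => a b []. Qed.
Lemma ImD (x y : C) : complex.Im (x + y) = complex.Im x + complex.Im y.
Proof. by case: x y => a b []. Qed.
Lemma Re_sum (F : 'I_k -> C) : complex.Re (\sum_j F j) = \sum_j complex.Re (F j).
Proof. by apply: (big_morph _ ReD). Qed.
Lemma Im_sum (F : 'I_k -> C) : complex.Im (\sum_j F j) = \sum_j complex.Im (F j).
Proof. by apply: (big_morph _ ImD). Qed.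
Lemma kinv : k%:R^-1 = (k%:R^-1 : R)%:C :> C.
Proof. by rewrite fmorphV rmorph_nat. Qed.
Lemma ReZ (a : R) (x : C) : complex.Re (a%:C * x) = a * complex.Re x.
Proof. by case: x => u v /=; rewrite mul0r subr0. Qed.
Lemma ImZ (a : R) (x : C) : complex.Im (a%:C * x) = a * complex.Im x.
Proof. by case: x => u v /=; rewrite mul0r addr0. Qed.

Lemma normc_ge0 (z : C) : 0 <= normc z.
Proof. by case: z => a b; exact: sqrtr_ge0. Qed.

Lemma measurable_aff (g : C -> R) (j : 'I_k) :
  measurable_fun (`[0, 1] : set R) (fun t : R => g (circ t)) ->
  measurable_fun (`[0, 1] : set R) (fun t : R => g (circ (aff j t))).
Proof.
move=> mg; apply: (measurable_comp _ _ mg) => //.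
  by move=> _ [x hx <-] /=; rewrite in_itv; apply: in01_aff => //; rewrite /= in_itv in hx.
by apply: measurable_funM => //; apply: measurable_funD.
Qed.

Lemma measurable_Wf f : measurable_circle f -> measurable_circle (Wf f).
Proof.
move=> [mr mi]; split.
- apply: (eq_measurable_fun (fun t : R => k%:R^-1 * \sum_(j < k) complex.Re (f (circ (aff j t))))).
    by move=> t; rewrite inE/= in_itv => ht; rewrite Wf_circ// kinv ReZ Re_sum.
  apply: measurable_funM => //; apply: measurable_sum => j.
  exact: (@measurable_aff (fun z => complex.Re (f z))).
- apply: (eq_measurable_fun (fun t : R => k%:R^-1 * \sum_(j < k) complex.Im (f (circ (aff j t))))).
    by move=> t; rewrite inE/= in_itv => ht; rewrite Wf_circ// kinv ImZ Im_sum.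
  apply: measurable_funM => //; apply: measurable_sum => j.
  exact: (@measurable_aff (fun z => complex.Im (f z))).
Qed.

Lemma normc_sum (F : nat -> C) n :
  normc (\sum_(j < n) F j) <= \sum_(j < n) normc (F j).
Proof.
elim: n => [|n ih]; first by rewrite !big_ord0 normc0.
rewrite !big_ord_recr/=; apply: le_trans (le_normcD _ _) _.
by rewrite lerD2r.
Qed.

Let M : R := k%:R^-1 ^+ 2 * 2 ^+ k * k%:R * k%:R.

Lemma Wf_integral f : measurable_circle f ->
  (\int[mu]_(t in `[0%R, 1%R]) (normc (Wf f (circ t)) ^+ 2)%:E <=
   M%:E * \int[mu]_(t in `[0%R, 1%R]) (normc (f (circ t)) ^+ 2)%:E)%E.
Proof.
move=> mf.
have mI : measurable (`[0%R, 1%R]%classic : set R) by exact: measurable_itv.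
set J := (X in (_ <= _ * X)%E).
pose c : R := k%:R^-1 ^+ 2 * 2 ^+ k.
have c0 : 0 <= c by rewrite mulr_ge0 ?sqr_ge0// exprn_ge0.
have mj (j : 'I_k) : measurable_fun (`[0, 1] : set R)
    (fun t : R => normc (f (circ (aff j t))) ^+ 2).
  exact: (@measurable_aff (fun z => normc (f z) ^+ 2) _ (measurable_normc_sqr mf)).
apply: (@le_trans _ _ (\int[mu]_(t in `[0%R, 1%R])
   (c%:E * \sum_(j < k) (normc (f (circ (aff j t))) ^+ 2)%:E)))%E.
  apply: ge0_le_integral => //.
  - by move=> t _; rewrite lee_fin sqr_ge0.
  - by apply/measurable_EFinP; apply: measurable_normc_sqr; exact: measurable_Wf.
  - apply: emeasurable_funM => //; apply: emeasurable_sum => j.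
    by apply/measurable_EFinP; exact: mj.
  - move=> t /=; rewrite in_itv/= => ht; rewrite sumEFin -EFinM lee_fin Wf_circ//.
    rewrite normcM exprMn kinv.
    have -> : normc (k%:R^-1 : R)%:C = k%:R^-1.
      by rewrite /= expr0n addr0 sqrtr_sqr ger0_norm// invr_ge0 ltW.
    rewrite /c -[leRHS]mulrA. apply: ler_wpM2l; first exact: sqr_ge0.
    apply: le_trans (sqr_sum_le (fun j => normc (f (circ (aff j t)))) k).
    rewrite ler_sqr ?nnegrE ?normc_ge0//; last first.
      by apply: sumr_ge0 => i _; exact: normc_ge0.
    exact: (normc_sum (fun j => f (circ (aff j t)))).
rewrite ge0_integralZl//; last 2 first.
- by apply: emeasurable_sum => j; apply/measurable_EFinP; exact: mj.
- by move=> t _; apply: sume_ge0 => j _; rewrite lee_fin sqr_ge0.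
rewrite ge0_integral_sum//; last 2 first.
- by move=> j; apply/measurable_EFinP; exact: mj.
- by move=> j t _; rewrite lee_fin sqr_ge0.
have J0 : (0 <= J)%E by apply: integral_ge0 => t _; rewrite lee_fin sqr_ge0.
have -> : (M%:E * J = c%:E * ((k%:R * k%:R)%:E * J))%E.
  by rewrite /M -/c muleA -EFinM !mulrA.
apply: lee_wpmul2l; first by rewrite lee_fin.
apply: (@le_trans _ _ (\sum_(j < k) (k%:R%:E * J)))%E.
  apply: lee_sum => j _.
  apply: (@integral_affine (fun t : R => (normc (f (circ t)) ^+ 2)%:E) j) => //.
  - by apply/measurable_EFinP; exact: measurable_normc_sqr.
  - by move=> t; rewrite lee_fin sqr_ge0.
have sumc n : (\sum_(j < n) (k%:R%:E * J) = n%:R%:E * (k%:R%:E * J))%E.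
  elim: n => [|n ih]; first by rewrite big_ord0 mul0e.
  rewrite big_ord_recr/= ih -[n.+1%:R]natr1 EFinD ge0_muleDl ?lee_fin// mul1e//.
by rewrite sumc EFinM muleA.
Qed.

Lemma is_W_exists : exists W, @is_W R k W.
Proof.
exists Wf; split; last first.
  move=> n; rewrite /eq_circle /ae_circle; apply: aeW => t; rewrite in_itv => ht.
  by rewrite Wf_expz//; case: ifP.
have M0 : 0 <= M by rewrite /M !mulr_ge0 ?sqr_ge0 ?exprn_ge0.
split.
- move=> f [mf ff]; split; first exact: measurable_Wf.
  apply: le_lt_trans (Wf_integral mf) _.
  by rewrite lte_mul_pinfty// lee_fin.
- move=> c f g _ _; apply: aeW => t _; exact: Wf_lin.
- exists (Num.sqrt M) => f [mf ff].
  rewrite /normL2 -sqrtrM// ler_wsqrtr//.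
  have J0 : (0 <= \int[mu]_(t in `[0%R, 1%R]) (normc (f (circ t)) ^+ 2)%:E)%E.
    by apply: integral_ge0 => t _; rewrite lee_fin sqr_ge0.
  have fin : (\int[mu]_(t in `[0%R, 1%R]) (normc (f (circ t)) ^+ 2)%:E)%E \is a fin_num.
    by rewrite ge0_fin_numE.
  rewrite /Rintegral -[M]/(fine M%:E) -fineM//; apply: fine_le; last exact: Wf_integral.
  - rewrite ge0_fin_numE; last by apply: integral_ge0 => t _; rewrite lee_fin sqr_ge0.
    apply: le_lt_trans (Wf_integral mf) _; by rewrite lte_mul_pinfty// lee_fin.
  - by rewrite fin_numM.
Qed.
End ExistenceOfW.

(* Main.v *)
(* Write S for the shift, T for the backward shift f |-> (f - f^(0)) / z and
   B(u, v) = <U u, v> - <U T^k u, T v>.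

   If U has symbol phi, then W_k (z^k h) = z W_k h gives the identity for bounded f.  Bounded
   functions are dense in K_alpha (they include the projections of the z^m), and S^k f belongs
   to K_alpha exactly when f is killed by k continuous functionals, so bounded f remain dense
   among those f; the identity extends by continuity.

   Conversely the identity says that B(u, v) = 0 as soon as u^(0) = ... = u^(k-1) = 0 and
   v^(0) = 0, whence B(u, v) = sum_(j<k) u^(j) <chi_j, v> + conj(v^(0)) <u, psi> with chi_j and
   psi in H^2.  Summing B(T^(kn) u, T^n v) over n recovers <U u, v>, and the two sums are
   <W_k (phi_1 u), v> and <W_k (conj(psi) u), v>, where phi_1 = sum_j z^-j chi_j(z^k).
   Thus phi = phi_1 + conj(psi) is a symbol of U.

   Completeness of the trigonometric system is proved by testing an orthogonal function against
   trigonometric polynomials converging boundedly to indicators of arcs. *)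
From HB Require Import structures.
Require Import Defs.
From mathcomp Require Import all_boot all_order all_algebra.
From mathcomp Require Import complex.
From mathcomp Require Import all_classical all_reals all_analysis.
From mathcomp Require Import measurable_realfun ring lra.

Set Implicit Arguments.
Unset Strict Implicit.
Unset Printing Implicit Defensive.

Import Order.TTheory GRing.Theory Num.Theory.
Import numFieldNormedType.Exports.
Import Normc.

Local Open Scope classical_set_scope.
Local Open Scope complex_scope.
Local Open Scope ring_scope.

(** * Modulus, conjugation and integer powers on the unit circle *)

Section ComplexModulus.
Variable R : realType.
Local Notation C := R[i].
Implicit Types z w : C.

(** With phi only in L^2, the product phi f is in general square integrable only for bounded f, and
    this shapes both directions. For necessity, approximants must be bounded and satisfy the k
    constraints at once. The constraints are restored by a finite-rank correction taken among the
    bounded functions; it is small because its coefficients are the values of functionals that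
    vanish at the limit. For sufficiency, the Fourier sums p_N of u converge in L^2 but not
    uniformly, so phi_1 p_N tends to phi_1 u only in L^1. Passing to the limit takes an L^1 bound on
    W_k and bounded test functions v. The specification of W_k speaks of L^2 only, so W_k is first
    identified with averaging over k-th roots, for which the L^1 bound is direct; the projections of
    the z^m supply the bounded v. The remainder <U T^(kN) u, T^N v> of the telescoping sum tends to
    0 because T is a contraction and the norm of T^N v is the tail of the Fourier series of v. *)

Lemma normc_real (a : R) : normc (a%:C) = `|a|.
Proof. by rewrite /= expr0n addr0 sqrtr_sqr. Qed.

Lemma normc_conj z : normc (z^*) = normc z.
Proof. by case: z => a b /=; rewrite sqrrN. Qed.

Lemma mul_conj z : z * z^* = (normc z ^+ 2)%:C.
Proof.
by rewrite normc_sqr; case: z => a b; congr Complex => /=; ring.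
Qed.

Lemma conjcM z w : (z * w)^* = z^* * w^*.
Proof. by case: z w => a b [c d]; congr Complex => /=; ring. Qed.

Lemma conjcD z w : (z + w)^* = z^* + w^*.
Proof. by case: z w => a b [c d]; congr Complex => /=; ring. Qed.

Lemma conjcN z : (- z)^* = - z^*.
Proof. by case: z. Qed.

Lemma ReB z w : complex.Re (z - w) = complex.Re z - complex.Re w.
Proof. by case: z w => a b []. Qed.

Lemma ImB z w : complex.Im (z - w) = complex.Im z - complex.Im w.
Proof. by case: z w => a b []. Qed.

Lemma normcB_sym z w : normc (z - w) = normc (w - z).
Proof. by rewrite -normcN opprB. Qed.

Lemma normc_expr z n : normc (z ^+ n) = normc z ^+ n.
Proof. by elim: n => [|n ih]; rewrite ?expr0 ?normc1// !exprS normcM ih. Qed.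

Lemma normc_expz1 z (n : int) : normc z = 1 -> normc (z ^ n) = 1.
Proof.
by move=> z1; case: n => n; rewrite ?NegzE /exprz ?normcV normc_expr z1 expr1n ?invr1.
Qed.

Lemma Re_le_normc z : `|complex.Re z| <= normc z.
Proof.
by case: z => a b /=; rewrite -sqrtr_sqr ler_wsqrtr// lerDl sqr_ge0.
Qed.

Lemma Im_le_normc z : `|complex.Im z| <= normc z.
Proof.
by case: z => a b /=; rewrite -sqrtr_sqr ler_wsqrtr// lerDr sqr_ge0.
Qed.

Lemma normc_le_ReIm z : normc z <= `|complex.Re z| + `|complex.Im z|.
Proof.
rewrite {1}[z]complexE; apply: le_trans (le_normcD _ _) _.
by rewrite normc_real lerD2l normcM normc_real /= expr0n expr1n add0r sqrtr1 mul1r.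
Qed.

Lemma circ_norm (t : R) : normc (circ t) = 1.
Proof. by rewrite /= cos2Dsin2 sqrtr1. Qed.

Lemma norm1_neq0 z : normc z = 1 -> z != 0.
Proof. by move=> z1; apply/eqP => z0; move: z1; rewrite z0 normc0 => /esym/eqP; rewrite oner_eq0. Qed.

Lemma conj_expz z (n : int) : normc z = 1 -> (z ^ n)^* = z ^ (- n).
Proof.
move=> z1; have zn := normc_expz1 n z1.
apply: (mulfI (norm1_neq0 zn)).
by rewrite mul_conj zn expr1n -expfzDr ?norm1_neq0// subrr expr0z.
Qed.

End ComplexModulus.

(** * Integration and L2 on the circle *)

Section CircleIntegral.
Variable R : realType.
Local Notation C := R[i].
Local Notation mu := (@lebesgue_measure R).
Local Notation I01 := (`[0%R, 1%R]%classic : set R).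
Implicit Types (f g h : C -> C) (c : C).

Lemma measurable_I01 : (R.-ocitv.-measurable).-sigma.-measurable I01.
Proof. exact: measurable_itv. Qed.
Hint Resolve measurable_I01 : core.

Lemma mu_I01 : mu I01 = 1%E.
Proof. by rewrite lebesgue_measure_itv /= lte_fin ltr01 oppr0 adde0. Qed.

Lemma ae_circleS (P Q : C -> Prop) :
  (forall z, normc z = 1 -> P z -> Q z) -> ae_circle P -> ae_circle Q.
Proof.
move=> PQ; rewrite /ae_circle; apply: (@filterS _ _ (ae_filter_ringOfSetsType mu)) => t h tI.
by apply: PQ; [exact: circ_norm | exact: h].
Qed.

Lemma ae_circleW (Q : C -> Prop) : (forall z, normc z = 1 -> Q z) -> ae_circle Q.
Proof. by move=> h; apply: aeW => t _; apply: h; exact: circ_norm. Qed.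

Lemma ae_circleS2 (P1 P2 Q : C -> Prop) :
  (forall z, normc z = 1 -> P1 z -> P2 z -> Q z) -> ae_circle P1 -> ae_circle P2 -> ae_circle Q.
Proof.
move=> PQ; rewrite /ae_circle; apply: (@filterS2 _ _ (ae_filter_ringOfSetsType mu)) => t h1 h2 tI.
by apply: PQ; [exact: circ_norm | exact: h1 | exact: h2].
Qed.

Lemma eq_circleW f g : (forall z, normc z = 1 -> f z = g z) -> eq_circle f g.
Proof. exact: ae_circleW. Qed.

Lemma eq_circle_refl f : eq_circle f f.
Proof. exact: eq_circleW. Qed.

Lemma eq_circle_sym f g : eq_circle f g -> eq_circle g f.
Proof. exact: ae_circleS. Qed.

Definition integrable_circle f :=
  measurable_circle f /\ mu.-integrable I01 (EFin \o (fun t => normc (f (circ t)))).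

Lemma measurable_circle_cst c : measurable_circle (cst c).
Proof. by split; exact: measurable_cst. Qed.

Lemma measurable_circle_lin c f g : measurable_circle f -> measurable_circle g ->
  measurable_circle (fun z => c * f z + g z).
Proof.
move=> [fr fi] [gr gi]; case: c => a b; split.
- rewrite [X in measurable_fun _ X](_ : _ = (fun t => (a * complex.Re (f (circ t)) - b * complex.Im (f (circ t)) + complex.Re (g (circ t))))).
    by apply: measurable_funD => //; apply: measurable_funB; apply: measurable_funM.
  by apply/funext => t; case: (f _) => u v; case: (g _).
- rewrite [X in measurable_fun _ X](_ : _ = (fun t => (a * complex.Im (f (circ t)) + b * complex.Re (f (circ t)) + complex.Im (g (circ t))))).
    by apply: measurable_funD => //; apply: measurable_funD; apply: measurable_funM.
  by apply/funext => t; case: (f _) => u v; case: (g _).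
Qed.

Lemma measurable_circleM f g : measurable_circle f -> measurable_circle g ->
  measurable_circle (fun z => f z * g z).
Proof.
move=> [fr fi] [gr gi]; split.
- rewrite [X in measurable_fun _ X](_ : _ = (fun t => (complex.Re (f (circ t)) * complex.Re (g (circ t)) - complex.Im (f (circ t)) * complex.Im (g (circ t))))).
    by apply: measurable_funB; apply: measurable_funM.
  by apply/funext => t; case: (f _) => u v; case: (g _).
- rewrite [X in measurable_fun _ X](_ : _ = (fun t => (complex.Re (f (circ t)) * complex.Im (g (circ t)) + complex.Im (f (circ t)) * complex.Re (g (circ t))))).
    by apply: measurable_funD; apply: measurable_funM.
  by apply/funext => t; case: (f _) => u v; case: (g _).
Qed.

Lemma measurable_circle_conj f : measurable_circle f -> measurable_circle (fun z => (f z)^*).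
Proof.
move=> [fr fi]; split.
- rewrite [X in measurable_fun _ X](_ : _ = (fun t => complex.Re (f (circ t))))//.
  by apply/funext => t; case: (f _).
- rewrite [X in measurable_fun _ X](_ : _ = (fun t => - complex.Im (f (circ t)))).
    exact: measurable_funN.
  by apply/funext => t; case: (f _).
Qed.

Lemma measurable_circle_id : measurable_circle (@id C).
Proof.
split => /=.
- apply: measurable_funTS; apply: continuous_measurable_fun => x.
  apply: continuous_comp; last exact: continuous_cos.
  exact: mulrl_continuous.
- apply: measurable_funTS; apply: continuous_measurable_fun => x.
  apply: continuous_comp; last exact: continuous_sin.
  exact: mulrl_continuous.
Qed.

Lemma eq_measurable_circle f g : (forall z, normc z = 1 -> f z = g z) ->
  measurable_circle f -> measurable_circle g.
Proof.
move=> fg [fr fi]; split.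
- rewrite [X in measurable_fun _ X](_ : _ = (fun t => complex.Re (f (circ t))))//.
  by apply/funext => t; rewrite fg//; exact: circ_norm.
- rewrite [X in measurable_fun _ X](_ : _ = (fun t => complex.Im (f (circ t))))//.
  by apply/funext => t; rewrite fg//; exact: circ_norm.
Qed.

Lemma measurable_circle_expz (n : int) : measurable_circle (fun z : C => z ^ n).
Proof.
have H (m : nat) : measurable_circle (fun z : C => z ^+ m).
  elim: m => [|m ih]; first exact: measurable_circle_cst.
  apply: (@eq_measurable_circle (fun z => z * z ^+ m)) => [z _|]; first by rewrite exprS.
  exact: measurable_circleM measurable_circle_id ih.
case: n => n; first exact: H.
apply: (@eq_measurable_circle (fun z => (z ^+ n.+1)^*)); last exact: measurable_circle_conj.
by move=> z z1; rewrite -[z ^+ _]/(z ^ n.+1%:Z) conj_expz// NegzE.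
Qed.

Lemma measurable_normc f : measurable_circle f ->
  measurable_fun I01 (fun t : R => normc (f (circ t))).
Proof.
move=> mf; rewrite [X in measurable_fun _ X](_ : _ = (fun t => Num.sqrt (normc (f (circ t)) ^+ 2))).
  apply: measurableT_comp (measurable_normc_sqr mf).
  apply: continuous_measurable_fun; exact: sqrt_continuous.
by apply/funext => t; rewrite sqrtr_sqr ger0_norm// normc_ge0.
Qed.

Lemma integrable_circle_Re f : integrable_circle f ->
  mu.-integrable I01 (EFin \o (fun t => complex.Re (f (circ t)))).
Proof.
move=> [[fr fi] h]; apply: le_integrable h => //; first exact/measurable_EFinP.
move=> t _; rewrite /= lee_fin; apply: le_trans (Re_le_normc _) _; exact: ler_norm.
Qed.

Lemma integrable_circle_Im f : integrable_circle f ->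
  mu.-integrable I01 (EFin \o (fun t => complex.Im (f (circ t)))).
Proof.
move=> [[fr fi] h]; apply: le_integrable h => //; first exact/measurable_EFinP.
move=> t _; rewrite /= lee_fin; apply: le_trans (Im_le_normc _) _; exact: ler_norm.
Qed.

Lemma integral_circle_lin c f g : integrable_circle f -> integrable_circle g ->
  integral_circle (fun z => c * f z + g z) = c * integral_circle f + integral_circle g.
Proof.
move=> hf hg; rewrite /integral_circle; case: c => a b.
have fr := integrable_circle_Re hf; have fi := integrable_circle_Im hf.
have gr := integrable_circle_Re hg; have gi := integrable_circle_Im hg.
have Zl (x : R) (F : R -> R) : mu.-integrable I01 (EFin \o F) ->
  mu.-integrable I01 (EFin \o (fun t => x * F t)).
  by move=> hF; exact: (integrableZl measurable_I01 x hF).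
apply/eqP; rewrite eq_complex /=; apply/andP; split; apply/eqP.
- rewrite -!RintegralZl// -RintegralB//; [|exact: Zl..].
  rewrite -RintegralD//.
    by apply: eq_Rintegral => t _; case: (f _) => u v; case: (g _).
  exact: (integrableB measurable_I01 (Zl _ _ _) (Zl _ _ _)).
- rewrite -!RintegralZl// -RintegralD//; [|exact: Zl..].
  rewrite -RintegralD//.
    by apply: eq_Rintegral => t _; case: (f _) => u v; case: (g _).
  exact: (integrableD measurable_I01 (Zl _ _ _) (Zl _ _ _)).
Qed.

Lemma integral_circle_conj f : integrable_circle f ->
  integral_circle (fun z => (f z)^*) = (integral_circle f)^*.
Proof.
move=> hf; rewrite /integral_circle /=; congr Complex.
- by apply: eq_Rintegral => t _; case: (f _).
- rewrite -mulN1r -RintegralZl//; last exact: integrable_circle_Im.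
  by apply: eq_Rintegral => t _; rewrite mulN1r; case: (f _).
Qed.

Lemma eq_integral_circle f g : measurable_circle f -> measurable_circle g ->
  eq_circle f g -> integral_circle f = integral_circle g.
Proof.
move=> [fr fi] [gr gi] fg; rewrite /integral_circle; congr Complex; congr fine;
  apply: ae_eq_integral => //; try exact/measurable_EFinP;
  by apply: (@filterS _ _ (ae_filter_ringOfSetsType mu)) fg => t h tI; rewrite h.
Qed.

Lemma eq_integral_circleW f g : (forall z, normc z = 1 -> f z = g z) ->
  integral_circle f = integral_circle g.
Proof.
move=> fg; rewrite /integral_circle; congr Complex; apply: eq_Rintegral => t _;
  by rewrite fg//; exact: circ_norm.
Qed.

(** The constant 2 comes from bounding the real and imaginary parts separately by the modulus. *)
Lemma integral_circle_norm_le f : integrable_circle f ->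
  normc (integral_circle f) <= 2 * \int[mu]_(t in I01) normc (f (circ t)).
Proof.
move=> hf; apply: le_trans (normc_le_ReIm _) _; rewrite mulrDl !mul1r.
have [_ nf] := hf.
apply: lerD => /=.
- apply: le_trans (le_normr_Rintegral _ (integrable_circle_Re hf)) _ => //.
  apply: le_Rintegral => //; last by move=> t _; exact: Re_le_normc.
  exact: integrable_norm (integrable_circle_Re hf).
- apply: le_trans (le_normr_Rintegral _ (integrable_circle_Im hf)) _ => //.
  apply: le_Rintegral => //; last by move=> t _; exact: Im_le_normc.
  exact: integrable_norm (integrable_circle_Im hf).
Qed.

End CircleIntegral.
#[export] Hint Resolve measurable_I01 : core.

(** * The space L^2: closure properties, inner product, Cauchy-Schwarz *)

Section L2Space.
Variable R : realType.
Local Notation C := R[i].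
Local Notation mu := (@lebesgue_measure R).
Local Notation I01 := (`[0%R, 1%R]%classic : set R).
Implicit Types (f g h : C -> C) (c : C).

Lemma L2P f : L2 f <-> measurable_circle f /\
  mu.-integrable I01 (EFin \o (fun t => normc (f (circ t)) ^+ 2)).
Proof.
split=> -[mf hf]; split=> //.
- apply/integrableP; split; first by apply/measurable_EFinP; exact: (measurable_normc_sqr mf).
  apply: le_lt_trans hf; apply: ge0_le_integral => //.
  + by apply/measurable_EFinP; apply: measurableT_comp => //; exact: (measurable_normc_sqr mf).
  + by apply/measurable_EFinP; exact: (measurable_normc_sqr mf).
  + by move=> t _; rewrite /= lee_fin ger0_norm// sqr_ge0.
- case/integrableP : hf => _; apply: le_lt_trans; apply: ge0_le_integral => //.
  + by move=> t _; rewrite lee_fin sqr_ge0.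
  + by apply/measurable_EFinP; exact: (measurable_normc_sqr mf).
  + by apply/measurable_EFinP; apply: measurableT_comp => //; exact: (measurable_normc_sqr mf).
  + by move=> t _; rewrite /= lee_fin ler_norm.
Qed.

Lemma L2_measurable f : L2 f -> measurable_circle f.
Proof. by case. Qed.

Lemma L2_integrable_sqr f : L2 f ->
  mu.-integrable I01 (EFin \o (fun t => normc (f (circ t)) ^+ 2)).
Proof. by case/L2P. Qed.

(** Pointwise, [|f g| <= |f|^2 + |g|^2]. *)
Lemma L2_integrableM f g : L2 f -> L2 g -> integrable_circle (fun z => f z * g z).
Proof.
move=> hf hg; have mfg := measurable_circleM (L2_measurable hf) (L2_measurable hg).
split=> //.
have /= h := integrableD (@measurable_I01 R) (L2_integrable_sqr hf) (L2_integrable_sqr hg).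
apply: le_integrable h => //; first by apply/measurable_EFinP; exact: measurable_normc mfg.
move=> t _; rewrite /= lee_fin ger0_norm ?normc_ge0// ger0_norm ?addr_ge0 ?sqr_ge0//.
rewrite normcM; have := normc_ge0 (f (circ t)); have := normc_ge0 (g (circ t)).
set x := normc (f _); set y := normc (g _) => x0 y0.
have := sqr_ge0 (x - y); nra.
Qed.

Lemma L2_conj f : L2 f -> L2 (fun z => (f z)^*).
Proof.
by move=> [mf hf]; split; [exact: measurable_circle_conj | under eq_integral do rewrite normc_conj].
Qed.

Lemma L2_integrable_dot f g : L2 f -> L2 g -> integrable_circle (fun z => f z * (g z)^*).
Proof. by move=> hf hg; exact: L2_integrableM hf (L2_conj hg). Qed.

Lemma L2_lin c f g : L2 f -> L2 g -> L2 (fun z => c * f z + g z).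
Proof.
move=> hf hg; have mfg := measurable_circle_lin c (L2_measurable hf) (L2_measurable hg).
apply/L2P; split=> //.
have /= h := integrableD (@measurable_I01 R) (integrableZl (@measurable_I01 R) (2 * normc c ^+ 2) (L2_integrable_sqr hf)) (integrableZl (@measurable_I01 R) 2 (L2_integrable_sqr hg)).
apply: le_integrable h => //; first by apply/measurable_EFinP; exact: measurable_normc_sqr mfg.
move=> t _; rewrite /= lee_fin ger0_norm ?sqr_ge0// ger0_norm; last first.
  by rewrite addr_ge0// mulr_ge0 ?sqr_ge0// mulr_ge0 ?sqr_ge0.
have := le_normcD (c * f (circ t)) (g (circ t)); rewrite normcM.
set x := normc (f _); set y := normc (g _); set n := normc (_ + _) => le.
have n0 : 0 <= n by exact: normc_ge0.
have x0 : 0 <= normc c * x by rewrite mulr_ge0 ?normc_ge0.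
have y0 : 0 <= y by exact: normc_ge0.
rewrite -mulrA -exprMn; move: (normc c * x) x0 le => a a0 le.
have := sqr_ge0 (a - y); nra.
Qed.

Lemma L2_cst c : L2 (cst c).
Proof.
split; first exact: measurable_circle_cst.
rewrite -[X in (X < _)%E]/(\int[mu]_(t in I01) cst (normc c ^+ 2)%:E t)%E integral_cst//; apply: lte_mul_pinfty => //; first by rewrite lee_fin sqr_ge0.
by apply: (@le_lt_trans _ _ (mu I01)) => //; rewrite mu_I01 ltry.
Qed.

Lemma eq_L2W f g : (forall z, normc z = 1 -> f z = g z) -> L2 f -> L2 g.
Proof.
move=> fg [mf hf]; split; first exact: eq_measurable_circle mf.
by under eq_integral do rewrite -fg ?circ_norm//.
Qed.

Lemma L2D f g : L2 f -> L2 g -> L2 (fun z => f z + g z).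
Proof. by move=> hf hg; apply: eq_L2W (L2_lin 1 hf hg) => z _; rewrite mul1r. Qed.

Lemma L2B f g : L2 f -> L2 g -> L2 (fun z => f z - g z).
Proof. by move=> hf hg; apply: eq_L2W (L2_lin (-1) hg hf) => z _; rewrite mulN1r addrC. Qed.

Lemma L2Z c f : L2 f -> L2 (fun z => c * f z).
Proof. by move=> hf; apply: eq_L2W (L2_lin c hf (L2_cst 0)) => z _; rewrite addr0. Qed.

Lemma L2_sum (F : nat -> C -> C) n : (forall i, (i < n)%N -> L2 (F i)) ->
  L2 (fun z => \sum_(i < n) F i z).
Proof.
elim: n => [|n ih] h.
  by apply: eq_L2W (L2_cst 0) => z _; rewrite big_ord0.
apply: (@eq_L2W (fun z => \sum_(i < n) F i z + F n z)).
  by move=> z _; rewrite big_ord_recr.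
by apply: L2D; [apply: ih => i ni; apply: h; exact: ltnW | exact: h].
Qed.

Lemma Linfty_mulL2 h f : Linfty h -> L2 f -> L2 (fun z => h z * f z).
Proof.
move=> [mh [M hM]] [mf hf]; have mhf := measurable_circleM mh mf.
split=> //.
apply: (@le_lt_trans _ _ (\int[mu]_(t in I01) ((M ^+ 2)%:E * (normc (f (circ t)) ^+ 2)%:E))%E).
  apply: ae_ge0_le_integral => //.
  - by move=> t _; rewrite lee_fin sqr_ge0.
  - by apply/measurable_EFinP; exact: measurable_normc_sqr mhf.
  - by move=> t _; rewrite mule_ge0// lee_fin sqr_ge0.
  - apply: emeasurable_funM => //; apply/measurable_EFinP; exact: measurable_normc_sqr mf.
  - apply: (@filterS _ _ (ae_filter_ringOfSetsType mu)) hM => t ht tI.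
    rewrite -EFinM lee_fin normcM exprMn ler_wpM2r ?sqr_ge0// ler_sqr ?nnegrE ?normc_ge0//.
      exact: ht.
    by apply: le_trans (ht tI); exact: normc_ge0.
rewrite ge0_integralZl//.
- by rewrite lte_mul_pinfty// lee_fin sqr_ge0.
- by apply/measurable_EFinP; exact: measurable_normc_sqr mf.
- by move=> t _; rewrite lee_fin sqr_ge0.
- by rewrite lee_fin sqr_ge0.
Qed.

Lemma Linfty_L2 f : Linfty f -> L2 f.
Proof.
by move=> hf; apply: eq_L2W (Linfty_mulL2 hf (L2_cst 1)) => z _; rewrite mulr1.
Qed.

Lemma Linfty_lin c f g : Linfty f -> Linfty g -> Linfty (fun z => c * f z + g z).
Proof.
move=> [mf [M hM]] [mg [N hN]]; split; first exact: measurable_circle_lin.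
exists (normc c * M + N); apply: ae_circleS2 hM hN => z _ fM gN.
apply: le_trans (le_normcD _ _) _; rewrite normcM lerD// ler_wpM2l//.
exact: normc_ge0.
Qed.

Lemma LinftyM f g : Linfty f -> Linfty g -> Linfty (fun z => f z * g z).
Proof.
move=> [mf [M hM]] [mg [N hN]]; split; first exact: measurable_circleM.
exists (M * N); apply: ae_circleS2 hM hN => z _ fM gN.
by rewrite normcM ler_pM ?normc_ge0.
Qed.

Lemma Linfty_conj f : Linfty f -> Linfty (fun z => (f z)^*).
Proof.
move=> [mf [M hM]]; split; first exact: measurable_circle_conj.
by exists M; apply: ae_circleS hM => z _; rewrite normc_conj.
Qed.

Lemma Linfty_cst c : Linfty (cst c).
Proof. by split; [exact: measurable_circle_cst | exists (normc c); exact: ae_circleW]. Qed.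

Lemma Linfty_expz (n : int) : Linfty (fun z : C => z ^ n).
Proof.
split; first exact: measurable_circle_expz.
by exists 1; apply: ae_circleW => z z1; rewrite normc_expz1.
Qed.

Lemma eq_LinftyW f g : (forall z, normc z = 1 -> f z = g z) -> Linfty f -> Linfty g.
Proof.
move=> fg [mf [M hM]]; split; first exact: eq_measurable_circle mf.
by exists M; apply: ae_circleS hM => z z1; rewrite fg.
Qed.

Lemma Linfty_sum (F : nat -> C -> C) n : (forall i, (i < n)%N -> Linfty (F i)) ->
  Linfty (fun z => \sum_(i < n) F i z).
Proof.
elim: n => [|n ih] h.
  by apply: eq_LinftyW (Linfty_cst 0) => z _; rewrite big_ord0.
apply: (@eq_LinftyW (fun z => 1 * (\sum_(i < n) F i z) + F n z)).
  by move=> z _; rewrite big_ord_recr mul1r.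
by apply: Linfty_lin; [apply: ih => i ni; apply: h; exact: ltnW | exact: h].
Qed.

Lemma L2_expz (n : int) : L2 (fun z : C => z ^ n).
Proof. exact: Linfty_L2 (Linfty_expz n). Qed.

Lemma L2_expzM (n : int) f : L2 f -> L2 (fun z => z ^ n * f z).
Proof. exact: Linfty_mulL2 (Linfty_expz n). Qed.

Lemma dotL2_linl c f g h : L2 f -> L2 g -> L2 h ->
  dotL2 (fun z => c * f z + g z) h = c * dotL2 f h + dotL2 g h.
Proof.
move=> hf hg hh; rewrite /dotL2 -integral_circle_lin; [|exact: L2_integrable_dot..].
by apply: eq_integral_circleW => z _; ring.
Qed.

Lemma dotL2C f g : L2 f -> L2 g -> dotL2 g f = (dotL2 f g)^*.
Proof.
move=> hf hg; rewrite /dotL2 -integral_circle_conj; last exact: L2_integrable_dot.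
by apply: eq_integral_circleW => z _; rewrite conjcM conjCK mulrC.
Qed.

Lemma dotL2_linr c f g h : L2 f -> L2 g -> L2 h ->
  dotL2 h (fun z => c * f z + g z) = c^* * dotL2 h f + dotL2 h g.
Proof.
move=> hf hg hh; rewrite (dotL2C (L2_lin c hf hg) hh) dotL2_linl// conjcD conjcM.
by rewrite -(dotL2C hf hh) -(dotL2C hg hh).
Qed.

Lemma eq_dotL2W f f' g g' : (forall z, normc z = 1 -> f z * (g z)^* = f' z * (g' z)^*) ->
  dotL2 f g = dotL2 f' g'.
Proof. exact: eq_integral_circleW. Qed.

Lemma eq_dotL2 f f' g g' : L2 f -> L2 f' -> L2 g -> L2 g' ->
  eq_circle f f' -> eq_circle g g' -> dotL2 f g = dotL2 f' g'.
Proof.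
move=> hf hf' hg hg' ff' gg'; apply: eq_integral_circle.
- exact: (L2_integrable_dot hf hg).1.
- exact: (L2_integrable_dot hf' hg').1.
by apply: ae_circleS2 ff' gg' => z _ -> ->.
Qed.

Lemma dotL2Bl f g h : L2 f -> L2 g -> L2 h ->
  dotL2 (fun z => f z - g z) h = dotL2 f h - dotL2 g h.
Proof.
move=> hf hg hh; rewrite -[RHS]addrC -mulN1r -dotL2_linl//.
by apply: eq_dotL2W => z _; rewrite mulN1r [- _ + _]addrC.
Qed.

Lemma dotL2Br f g h : L2 f -> L2 g -> L2 h ->
  dotL2 h (fun z => f z - g z) = dotL2 h f - dotL2 h g.
Proof.
move=> hf hg hh; rewrite (dotL2C (L2B hf hg) hh) dotL2Bl// conjcD conjcN.
by rewrite -(dotL2C hf hh) -(dotL2C hg hh).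
Qed.

Lemma dotL20l h : dotL2 (cst 0) h = 0.
Proof.
rewrite /dotL2 (@eq_integral_circleW _ _ (cst 0)); last by move=> z _; rewrite /= mul0r.
by rewrite /integral_circle/= Rintegral_cst// mul0r.
Qed.

Lemma dotL2Zl c f h : L2 f -> L2 h -> dotL2 (fun z => c * f z) h = c * dotL2 f h.
Proof.
move=> hf hh; have := dotL2_linl c hf (L2_cst 0) hh; rewrite dotL20l addr0 => <-.
by apply: eq_dotL2W => z _; rewrite addr0.
Qed.

Lemma dotL2Zr c f h : L2 f -> L2 h -> dotL2 h (fun z => c * f z) = c^* * dotL2 h f.
Proof.
by move=> hf hh; rewrite (dotL2C (L2Z c hf) hh) dotL2Zl// conjcM -(dotL2C hf hh).
Qed.

Lemma dotL2_suml (F : nat -> C -> C) n h : L2 h -> (forall i, (i < n)%N -> L2 (F i)) ->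
  dotL2 (fun z => \sum_(i < n) F i z) h = \sum_(i < n) dotL2 (F i) h.
Proof.
move=> hh; elim: n => [|n ih] hF.
  by rewrite big_ord0 -[RHS](dotL20l h); apply: eq_dotL2W => z _; rewrite big_ord0.
have hF' i : (i < n)%N -> L2 (F i) by move=> ni; apply: hF; exact: ltnW.
rewrite big_ord_recr /= -ih// -[X in X + _]mul1r -dotL2_linl//; [|exact: L2_sum|exact: hF].
by apply: eq_dotL2W => z _; rewrite big_ord_recr mul1r.
Qed.

Lemma normL2_ge0 f : 0 <= normL2 f.
Proof. exact: sqrtr_ge0. Qed.

Lemma sqr_normL2 f : normL2 f ^+ 2 = \int[mu]_(t in I01) (normc (f (circ t)) ^+ 2).
Proof.
by rewrite sqr_sqrtr//; apply: Rintegral_ge0 => t _; exact: sqr_ge0.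
Qed.

Lemma dotL2_norm f : dotL2 f f = (normL2 f ^+ 2)%:C.
Proof.
rewrite sqr_normL2 /dotL2 (@eq_integral_circleW _ _ (fun z => (normc (f z) ^+ 2)%:C)); last first.
  by move=> z _; exact: mul_conj.
by rewrite /integral_circle/= Rintegral_cst// mul0r.
Qed.

Lemma normL2_sqr_lin c f g : L2 f -> L2 g ->
  normL2 (fun z => c * f z + g z) ^+ 2 =
  normc c ^+ 2 * normL2 f ^+ 2 + 2 * complex.Re (c * dotL2 f g) + normL2 g ^+ 2.
Proof.
move=> hf hg; have h := L2_lin c hf hg.
apply: (@complexI R); rewrite -dotL2_norm dotL2_linl// !dotL2_linr//.
rewrite !dotL2_norm (dotL2C hf hg).
case: c {h} => a b; case: (dotL2 f g) => u v.
rewrite normc_sqr /=; congr Complex => /=; ring.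
Qed.

(** With d = <f, g>, the squared norm of g - t conj(d) f is a quadratic in the real variable t that
    is never negative; t = 1 / |f|^2 minimizes it. *)
Lemma cauchy_schwarz f g : L2 f -> L2 g -> normc (dotL2 f g) <= normL2 f * normL2 g.
Proof.
move=> hf hg; set d := dotL2 f g.
have key t : 0 <= t ^+ 2 * normc d ^+ 2 * normL2 f ^+ 2 - 2 * t * normc d ^+ 2 + normL2 g ^+ 2.
  have := sqr_ge0 (normL2 (fun z => (- t%:C * d^*) * f z + g z)).
  rewrite normL2_sqr_lin// -/d normcM normcN normc_conj normc_real exprMn real_normK ?num_real//.
  by rewrite -[- _ * _ * d]mulrA [_^* * d]mulrC mul_conj -rmorphN -rmorphM /= => h; lra.
have x0 := normL2_ge0 f; have y0 := normL2_ge0 g; have d0 := normc_ge0 d.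
rewrite -ler_sqr ?nnegrE ?mulr_ge0// exprMn.
have [fz|fn0] := eqVneq (normL2 f) 0.
  (* When f has norm 0 the quadratic is affine in t, and this t gives it the value -1 unless d =
     0. *)
  have := key ((normL2 g ^+ 2 + 1) / (2 * normc d ^+ 2)).
  rewrite fz expr0n mulr0 mul0r.
  have [->|dn0] := eqVneq (normc d) 0; first by rewrite expr0n.
  have -> : 2 * ((normL2 g ^+ 2 + 1) / (2 * normc d ^+ 2)) * normc d ^+ 2 = normL2 g ^+ 2 + 1.
    by field.
  lra.
have := key ((normL2 f ^+ 2)^-1).
have F0 : 0 < normL2 f ^+ 2 by rewrite exprn_gt0// lt0r fn0.
have -> : (normL2 f ^+ 2)^-1 ^+ 2 * normc d ^+ 2 * normL2 f ^+ 2 = normc d ^+ 2 / normL2 f ^+ 2.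
  by field.
have -> : 2 * (normL2 f ^+ 2)^-1 * normc d ^+ 2 = 2 * (normc d ^+ 2 / normL2 f ^+ 2).
  by field.
move=> h; have : normc d ^+ 2 / normL2 f ^+ 2 <= normL2 g ^+ 2 by lra.
by rewrite ler_pdivrMr// mulrC.
Qed.

Lemma eq_normL2 f g : L2 f -> L2 g -> eq_circle f g -> normL2 f = normL2 g.
Proof.
move=> hf hg fg; apply/eqP; rewrite -(@eqrXn2 _ 2)// ?normL2_ge0//; apply/eqP.
by apply: (@complexI R); rewrite -!dotL2_norm; exact: eq_dotL2.
Qed.

Lemma eq_normL2W f g : (forall z, normc z = 1 -> normc (f z) = normc (g z)) -> normL2 f = normL2 g.
Proof.
by move=> fg; congr Num.sqrt; apply: eq_Rintegral => t _; rewrite fg// circ_norm.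
Qed.

Lemma normL2Z c f : L2 f -> normL2 (fun z => c * f z) = normc c * normL2 f.
Proof.
move=> hf; apply/eqP; rewrite -(@eqrXn2 _ 2)// ?mulr_ge0 ?normc_ge0 ?normL2_ge0//; apply/eqP.
apply: (@complexI R); rewrite -dotL2_norm dotL2Zl//; last exact: L2Z.
by rewrite dotL2Zr// dotL2_norm mulrA mul_conj -rmorphM /= exprMn.
Qed.

Lemma normL2D f g : L2 f -> L2 g -> normL2 (fun z => f z + g z) <= normL2 f + normL2 g.
Proof.
move=> hf hg; rewrite -ler_sqr ?nnegrE ?addr_ge0 ?normL2_ge0//.
have -> : normL2 (fun z => f z + g z) = normL2 (fun z => 1 * f z + g z).
  by apply: eq_normL2W => z _; rewrite mul1r.
rewrite normL2_sqr_lin// normc1 expr1n !mul1r.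
have := cauchy_schwarz hf hg; have := Re_le_normc (dotL2 f g).
have := ler_norm (complex.Re (dotL2 f g)).
move: (complex.Re _) (normc _) => a b h1 h2 h3; rewrite sqrrD; lra.
Qed.

Lemma normL2_sym f g : normL2 (fun z => f z - g z) = normL2 (fun z => g z - f z).
Proof. by apply: eq_normL2W => z _; rewrite normcB_sym. Qed.

Lemma normL2_triangle f g h : L2 f -> L2 g -> L2 h ->
  normL2 (fun z => f z - h z) <= normL2 (fun z => f z - g z) + normL2 (fun z => g z - h z).
Proof.
move=> hf hg hh; apply: le_trans (normL2D (L2B hf hg) (L2B hg hh)).
by rewrite le_eqVlt (@eq_normL2W _ (fun z => f z - g z + (g z - h z))) ?eqxx// => z _; rewrite subrKA.
Qed.

Lemma normL2_unimod h f : (forall z, normc z = 1 -> normc (h z) = 1) ->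
  normL2 (fun z => h z * f z) = normL2 f.
Proof. by move=> h1; apply: eq_normL2W => z z1; rewrite normcM h1// mul1r. Qed.

End L2Space.

(** * Completeness of the trigonometric system *)

Section TrigonometricCompleteness.
Variable R : realType.
Local Notation C := R[i].
Local Notation mu := (@lebesgue_measure R).
Local Notation I01 := (`[0%R, 1%R]%classic : set R).

Lemma bernoulli_ineq (x : R) n : -1 <= x -> 1 + n%:R * x <= (1 + x) ^+ n.
Proof.
move=> x1; elim: n => [|n ih]; first by rewrite mul0r addr0 expr0.
have h : 0 <= 1 + x by lra.
rewrite exprS; apply: le_trans (ler_wpM2l h ih).
have n0 : 0 <= n%:R :> R by [].
rewrite -natr1; have := mulr_ge0 n0 (sqr_ge0 x); lra.
Qed.

(* Brosowski-Deutsch peaks: a polynomial in [y] converging boundedly to the indicator of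
   [y < 1/2] on [0, 1]. *)
Lemma peak_cvg1 (y : R) : 0 <= y < 1 / 2 ->
  (1 - y ^+ n) ^+ (2 ^ n) @[n --> \oo] --> (1 : R).
Proof.
move=> /andP[y0 y12].
apply: (@squeeze_cvgr _ _ _ _ (fun n => 1 - (2 * y) ^+ n) (cst 1)).
- apply: nearW => n.
  have yn0 : 0 <= y ^+ n by rewrite exprn_ge0.
  have yn1 : y ^+ n <= 1 by rewrite exprn_ile1//; lra.
  apply/andP; split; last by rewrite exprn_ile1//; lra.
  (* Bernoulli bounds the peak below by 1 - 2^n y^n = 1 - (2y)^n, and 2y < 1. *)
  have := @bernoulli_ineq (- y ^+ n) (2 ^ n); rewrite exprMn natrX mulrN.
  by apply; lra.
- rewrite -[X in _ --> X]subr0; apply: cvgB; first exact: cvg_cst.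
  by apply: cvg_expr; rewrite ger0_norm; lra.
- exact: cvg_cst.
Qed.

(** Since (1 - y^n)(1 + y^n) <= 1, the peak is at most the inverse of (1 + y^n)^(2^n), which
    Bernoulli bounds below by (2y)^n. *)
Lemma peak_cvg0 (y : R) : 1 / 2 < y <= 1 ->
  (1 - y ^+ n) ^+ (2 ^ n) @[n --> \oo] --> (0 : R).
Proof.
move=> /andP[y12 y1].
have y0 : 0 < y by lra.
apply: (@squeeze_cvgr _ _ _ _ (cst 0) (fun n => ((2 * y)^-1) ^+ n)).
- apply: nearW => n.
  have yn0 : 0 < y ^+ n by rewrite exprn_gt0.
  have yn1 : y ^+ n <= 1 by rewrite exprn_ile1//; lra.
  apply/andP; split; first by rewrite exprn_ge0//; lra.
  have b := @bernoulli_ineq (y ^+ n) (2 ^ n); rewrite natrX -exprMn in b.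
  have {}b : (2 * y) ^+ n <= (1 + y ^+ n) ^+ (2 ^ n).
    by apply: le_trans (b _); lra.
  rewrite exprVn -[leRHS]mul1r ler_pdivlMr; last by rewrite exprn_gt0//; lra.
  apply: (@le_trans _ _ ((1 - y ^+ n) ^+ (2 ^ n) * (1 + y ^+ n) ^+ (2 ^ n))).
    by apply: ler_wpM2l => //; rewrite exprn_ge0//; lra.
  by rewrite -exprMn exprn_ile1//; nra.
- exact: cvg_cst.
- apply: cvg_expr; rewrite ger0_norm ?invr_ge0; last lra.
  by rewrite invf_lt1; lra.
Qed.

(* [arcY v t < 1/2] exactly when [t] lies in [(v, 1)], for [t] in [(0, 1)] off [v]. *)
Definition arcY (v t : R) : R := 1 / 2 + (cos (2 * pi * (t - v / 2)) - cos (pi * v)) / 4.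

(** The cosine form of [arcY] is a trigonometric polynomial of degree one; the product form shows on
    which side of 1/2 it lies, since sin(pi t) is positive on (0, 1) and sin(pi (t - v)) changes
    sign at v. *)
Lemma arcYE v t : arcY v t = 1 / 2 - sin (pi * t) * sin (pi * (t - v)) / 2.
Proof.
rewrite /arcY.
have -> : 2 * pi * (t - v / 2) = pi * t + pi * (t - v) by field.
have -> : pi * v = pi * t - pi * (t - v) by ring.
rewrite cosD cosB; move: (cos _ * _) (sin _ * _) => a b; lra.
Qed.

Lemma arcY01 v t : 0 <= arcY v t <= 1.
Proof.
have := cos_geN1 (2 * pi * (t - v / 2)); have := cos_le1 (2 * pi * (t - v / 2)).
have := cos_geN1 (pi * v); have := cos_le1 (pi * v).
by rewrite /arcY => ? ? ? ?; apply/andP; split; lra.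
Qed.

Lemma arcY_lt v t : 0 < v -> v < t < 1 -> arcY v t < 1 / 2.
Proof.
move=> v0 /andP[vt t1]; rewrite arcYE.
have p0 := pi_gt0 R.
have h1 : 0 < sin (pi * t) by apply: sin_gt0_pi; apply/andP; split; nra.
have h2 : 0 < sin (pi * (t - v)) by apply: sin_gt0_pi; apply/andP; split; nra.
have := mulr_gt0 h1 h2; lra.
Qed.

Lemma arcY_gt v t : v < 1 -> 0 < t < v -> 1 / 2 < arcY v t.
Proof.
move=> v1 /andP[t0 tv]; rewrite arcYE.
have p0 := pi_gt0 R.
have h1 : 0 < sin (pi * t) by apply: sin_gt0_pi; apply/andP; split; nra.
have h2 : 0 < sin (pi * (v - t)) by apply: sin_gt0_pi; apply/andP; split; nra.
have -> : pi * (t - v) = - (pi * (v - t)) by ring.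
rewrite sinN; have := mulr_gt0 h1 h2; lra.
Qed.

Lemma measurable_arcY v : measurable_fun setT (arcY v).
Proof.
apply: continuous_measurable_fun => t; rewrite /arcY.
apply: cvgD; first exact: cvg_cst.
apply: cvgM; last exact: cvg_cst.
apply: cvgB; last exact: cvg_cst.
apply: (@continuous_comp _ _ _ (fun t => 2 * pi * (t - v / 2)) cos); last exact: continuous_cos.
apply: cvgM; first exact: cvg_cst.
apply: cvgB; [exact: cvg_id | exact: cvg_cst].
Qed.

Lemma peak_integral_cvg (r : R -> R) v : 0 < v < 1 ->
  mu.-integrable I01 (EFin \o r) ->
  (\int[mu]_(t in I01) ((1 - arcY v t ^+ n) ^+ (2 ^ n) * r t)%:E)%E @[n --> \oo] -->
  (\int[mu]_(t in I01) (if v < t then r t else 0)%:E)%E.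
Proof.
move=> /andP[v0 v1] ir.
have mr : measurable_fun I01 r by apply/measurable_EFinP; exact: measurable_int ir.
(* At 0, v and 1 the value of [arcY v] is exactly 1/2, where the peaks tend to 1/e instead of 0 or
   1. *)
have null : {ae mu, forall t : R, t != 0 /\ t != v /\ t != 1}.
  exists [set 0; v; 1]; split.
  - by apply: measurableU => //; apply: measurableU.
  - rewrite null_set_setU//; rewrite ?null_set_setU//; try exact: measurableU; exact: lebesgue_measure_set1.
  - move=> t /= nt; apply: contrapT => /= h; apply: nt.
    by split; [|split]; apply/eqP => e; apply: h; rewrite e; [left; left|left; right|right].
have [] := @dominated_convergence _ _ _ mu I01 (@measurable_I01 R)
  (fun n t => ((1 - arcY v t ^+ n) ^+ (2 ^ n) * r t)%:E)
  (fun t => (if v < t then r t else 0)%:E) (fun t => `|r t|%:E) => //.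
- move=> n; apply/measurable_EFinP; apply: measurable_funM => //.
  apply: measurable_funX; apply: measurable_funB => //; apply: measurable_funX.
  exact: measurable_funTS (measurable_arcY v).
- apply/measurable_EFinP; apply: measurable_fun_if => //.
  + exact: measurable_fun_ltr.
  + exact: measurable_funS mr.
- apply: (@filterS _ _ (ae_filter_ringOfSetsType mu)) null => t [t0 [tv t1]].
  rewrite /= in_itv/= => /andP[t0' t1'].
  have {t0 t0'}t0 : 0 < t by rewrite lt0r t0.
  have {t1 t1'}t1 : t < 1 by rewrite lt_neqAle t1.
  apply: cvg_EFin; first exact: nearW.
  case: ltgtP tv => // tv _.
  + rewrite -[X in _ --> X]mul1r; apply: cvgM; last exact: cvg_cst.
    apply: peak_cvg1.
    by rewrite arcY_lt ?tv// andbT; case/andP: (arcY01 v t).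
  + rewrite -[X in _ --> X](mul0r (r t)); apply: cvgM; last exact: cvg_cst.
    apply: peak_cvg0.
    by rewrite arcY_gt ?t0//=; case/andP: (arcY01 v t).
- exact: integrable_norm.
- apply: aeW => t n _; rewrite /= lee_fin normrM ler_piMl//.
  have /andP[a0 a1] := arcY01 v t.
  have b0 : 0 <= arcY v t ^+ n by rewrite exprn_ge0.
  have b1 : arcY v t ^+ n <= 1 by rewrite exprn_ile1.
  by rewrite ger0_norm ?exprn_ge0 ?exprn_ile1//; lra.
Qed.

(** In the limit the peaks give integral 0 over ]v, 1]. As the total integral is 0, the primitive of
    r from 0 vanishes on (0, 1), and Lebesgue differentiation returns r = 0 almost everywhere. *)
Lemma ae_eq0_of_peaks (r : R -> R) :
  mu.-integrable I01 (EFin \o r) -> \int[mu]_(t in I01) r t = 0 ->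
  (forall v n, 0 < v < 1 ->
    (\int[mu]_(t in I01) ((1 - arcY v t ^+ n) ^+ (2 ^ n) * r t)%:E = 0)%E) ->
  {ae mu, forall t, t \in `[0, 1] -> r t = 0}.
Proof.
move=> ir r0 peaks.
have right0 v : 0 < v < 1 -> (\int[mu]_(t in I01) (if v < t then r t else 0)%:E = 0)%E.
  move=> v01; have := peak_integral_cvg v01 ir.
  under eq_cvg do rewrite (peaks _ _ v01).
  by move=> /(cvg_lim (@ereal_hausdorff R)) <-; apply/cvg_lim; [exact: ereal_hausdorff | exact: cvg_cst].
have left0 v : 0 < v < 1 -> \int[mu]_(t in `[0, v]) r t = 0.
  move=> v01; have /andP[v0 v1] := v01.
  have := @Rintegral_itvB _ r (BLeft 0) (BRight 1) v ir.
  rewrite !bnd_simp => /(_ (ltW v0) (ltW v1)); rewrite r0 sub0r => /eqP.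
  have -> : \int[mu]_(x in `]v, 1]) r x = 0; last by rewrite oppr_eq0 => /eqP.
  have -> : `]v, 1]%classic = I01 `&` `]v, 1]%classic :> set R.
    apply/seteqP; split => t /=; rewrite !in_itv/=; last by case.
    by move=> /andP[vt t1]; rewrite vt t1 (ltW (lt_trans v0 vt)).
  rewrite Rintegral_mkcondr /Rintegral -[RHS](congr1 fine (right0 v v01)); congr fine.
  apply: eq_integral => t; rewrite inE/= in_itv/= => /andP[t0 t1].
  rewrite patchE; case: ifPn; rewrite ?inE ?notin_setE/= in_itv/= t1 andbT; first by move=> ->.
  by move=> /negP/negbTE ->.
(* Extension by zero to the line, where the differentiation theorem applies; integrals over [0, v]
   with v in (0, 1) do not change. *)
pose rr := r \_ I01.
have irr : mu.-integrable setT (EFin \o rr).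
  by rewrite /rr -restrict_EFin; exact: (iffLR (@integrable_mkcond _ _ _ mu I01 (EFin \o r) (@measurable_I01 R)) ir).
have lrr := open_integrable_locally openT irr.
have := @FTC1 R rr (BLeft 0) _ lrr.
have irr' y : mu.-integrable [set` Interval (BLeft 0) (BRight y)] (EFin \o rr).
  by apply: integrableS irr.
move=> /(_ irr').
have null : {ae mu, forall t : R, t != 0 /\ t != 1}.
  exists [set 0; 1]; split.
  - by apply: measurableU.
  - rewrite null_set_setU//; exact: lebesgue_measure_set1.
  - move=> t /= nt; apply: contrapT => /= h; apply: nt.
    by split; apply/eqP => e; apply: h; rewrite e; [left|right].
apply: (@filterS2 _ _ (ae_filter_ringOfSetsType mu)) null => x [x0 x1] H.
rewrite in_itv/= => /andP[x0' x1'].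
have {x0 x0'}x0 : 0 < x by rewrite lt0r x0.
have {x1 x1'}x1 : x < 1 by rewrite lt_neqAle x1.
have [|_] := H; first by rewrite lte_fin.
rewrite /rr patchE mem_set/= ?in_itv/= ?(ltW x0) ?(ltW x1)// => <-.
rewrite derive1E (@near_eq_derive _ _ _ _ (cst 0)) ?derive_cst//.
have : x \in `]0, 1[ by rewrite in_itv/= x0.
move=> /near_in_itvoo; apply: filterS => y; rewrite in_itv/= => y01.
apply: etrans (left0 y y01); apply: eq_Rintegral => t; rewrite inE/= in_itv/= => /andP[t0 ty].
by rewrite patchE mem_set//= in_itv/= t0 (le_trans ty)// ltW//; case/andP: y01.
Qed.

End TrigonometricCompleteness.

(** * Uniqueness of Fourier coefficients *)

Section FourierUniqueness.
Variable R : realType.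
Local Notation C := R[i].
Local Notation mu := (@lebesgue_measure R).
Local Notation I01 := (`[0%R, 1%R]%classic : set R).
Implicit Types (f g h : C -> C) (c : C).

(* The trigonometric polynomials belong to this class, which is visibly an algebra. *)
Definition spectral_multiplier h := Linfty h /\
  forall g, L2 g -> (forall n, fourier g n = 0) -> forall n, fourier (fun z => h z * g z) n = 0.

Lemma spectral_multiplier_expz m : spectral_multiplier (fun z : C => z ^ m).
Proof.
split; first exact: Linfty_expz.
move=> g hg g0 n; rewrite -(g0 (n - m)); apply: eq_dotL2W => z z1.
rewrite !conj_expz// opprB addrC expfzDr ?norm1_neq0//; ring.
Qed.

Lemma spectral_multiplier_lin c f g : spectral_multiplier f -> spectral_multiplier g ->
  spectral_multiplier (fun z => c * f z + g z).
Proof.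
move=> [bf hf] [bg hg]; split; first exact: Linfty_lin.
move=> h hh h0 n; have := hf _ hh h0 n; have := hg _ hh h0 n.
rewrite /fourier => g0 f0.
rewrite (@eq_dotL2W _ _ (fun z => c * (f z * h z) + g z * h z) _ (fun z => z ^ n)).
  rewrite dotL2_linl ?f0 ?g0 ?mulr0 ?addr0//; [exact: Linfty_mulL2..|exact: L2_expz].
by move=> z _; ring.
Qed.

Lemma spectral_multiplierM f g : spectral_multiplier f -> spectral_multiplier g ->
  spectral_multiplier (fun z => f z * g z).
Proof.
move=> [bf hf] [bg hg]; split; first exact: LinftyM.
move=> h hh h0 n; rewrite -[RHS](hf _ (Linfty_mulL2 bg hh) (hg _ hh h0) n).
by apply: eq_dotL2W => z _; ring.
Qed.

Lemma eq_spectral_multiplier f g : (forall z, normc z = 1 -> f z = g z) ->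
  spectral_multiplier f -> spectral_multiplier g.
Proof.
move=> fg [bf hf]; split; first exact: eq_LinftyW bf.
move=> h hh h0 n; rewrite -[RHS](hf _ hh h0 n).
by apply: eq_dotL2W => z z1; rewrite fg.
Qed.

Lemma spectral_multiplier_cst c : spectral_multiplier (cst c).
Proof.
apply: (eq_spectral_multiplier _ (spectral_multiplier_lin (c - 1) (spectral_multiplier_expz 0) (spectral_multiplier_expz 0))) => z _.
by rewrite !expr0z mulr1 subrK.
Qed.

Lemma spectral_multiplierX f n : spectral_multiplier f -> spectral_multiplier (fun z => f z ^+ n).
Proof.
move=> hf; elim: n => [|n ih].
  exact: (eq_spectral_multiplier _ (spectral_multiplier_cst 1)).
by apply: (eq_spectral_multiplier _ (spectral_multiplierM hf ih)) => z _; rewrite exprS.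
Qed.

(** The polynomial [arcY v] in the variables z and 1/z: Euler's formula splits its cosine, and the
    phase shift v/2 moves into the coefficients as [circ (v / 2)]. *)
Definition arcZ (v : R) (z : C) : C :=
  (4 * circ (v / 2)) ^-1 / 2 * z ^ 1 + (circ (v / 2) / 8 * z ^ (-1) + cst (1 / 2 - (cos (pi * v) / 4)%:C) z).

Lemma arcZE v t : arcZ v (circ t) = (arcY v t)%:C.
Proof.
rewrite /arcZ expr1z exprN1.
have w0 : circ (v / 2) != 0 :> C by apply: norm1_neq0; exact: circ_norm.
have z0 : circ t != 0 :> C by apply: norm1_neq0; exact: circ_norm.
have -> : (4 * circ (v / 2))^-1 / 2 * circ t = circ (t - v / 2) / 8 :> C.
  by rewrite circD circN; field.
have -> : circ (v / 2) / 8 * (circ t)^-1 = circ (- (t - v / 2)) / 8 :> C.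
  by rewrite opprB circD circN; ring.
rewrite /arcY /circ mulrN cosN sinN.
move: (cos (2 * _ * _)) (sin _) => x y.
have -> : 8^-1 = (8^-1 : R)%:C :> C by rewrite fmorphV rmorph_nat.
have -> : (1 / 2 : C) = (1 / 2 : R)%:C by rewrite !rmorphM fmorphV rmorph_nat.
by congr Complex => /=; field.
Qed.

Lemma spectral_multiplier_arcZ v n :
  spectral_multiplier (fun z => (1 - arcZ v z ^+ n) ^+ (2 ^ n)).
Proof.
apply: spectral_multiplierX.
apply: (@eq_spectral_multiplier (fun z => -1 * arcZ v z ^+ n + cst 1 z)).
  by move=> z _; rewrite mulN1r addrC.
apply: spectral_multiplier_lin; last exact: spectral_multiplier_cst.
apply: spectral_multiplierX; apply: spectral_multiplier_lin.
  exact: spectral_multiplier_expz.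
apply: spectral_multiplier_lin; first exact: spectral_multiplier_expz.
exact: spectral_multiplier_cst.
Qed.

(** The peaks are trigonometric polynomials with real values on the circle, so the vanishing of
    their integrals against f splits into the same statement for Re f and for Im f. *)
Lemma fourier_eq0 f : L2 f -> (forall n, fourier f n = 0) -> eq_circle f (cst 0).
Proof.
move=> hf f0.
have i_f : integrable_circle f.
  have [mf nf] := L2_integrableM hf (L2_cst 1); split; first exact: hf.1.
  apply: eq_integrable nf => //.
  by move=> t _ /=; rewrite mulr1.
have int0 : integral_circle f = 0.
  by rewrite -(f0 0); apply: eq_integral_circleW => z _; rewrite expr0z conjC1 mulr1.
have intp v n : integral_circle (fun z => (1 - arcZ v z ^+ n) ^+ (2 ^ n) * f z) = 0.
  rewrite -((spectral_multiplier_arcZ v n).2 f hf f0 0).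
  by apply: eq_integral_circleW => z _; rewrite expr0z conjC1 mulr1.
have ip v n : integrable_circle (fun z => (1 - arcZ v z ^+ n) ^+ (2 ^ n) * f z).
  exact: L2_integrableM (Linfty_L2 (spectral_multiplier_arcZ v n).1) hf.
have pE v n t : (1 - arcZ v (circ t) ^+ n) ^+ (2 ^ n) = ((1 - arcY v t ^+ n) ^+ (2 ^ n))%:C.
  by rewrite arcZE !(rmorphXn, rmorphB, rmorph1).
have hr : {ae mu, forall t, t \in `[0, 1] -> complex.Re (f (circ t)) = 0}.
  apply: ae_eq0_of_peaks; first exact: integrable_circle_Re.
    by case: int0.
  move=> v n v01; rewrite -[LHS]fineK; last first.
    apply: integrable_fin_num => //; apply: eq_integrable (integrable_circle_Re (ip v n)) => //.
    by move=> t _ /=; rewrite pE ReZ.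
  congr EFin; apply: etrans (congr1 (@complex.Re R) (intp v n)); congr fine.
  by apply: eq_integral => t _; rewrite pE ReZ.
have hi : {ae mu, forall t, t \in `[0, 1] -> complex.Im (f (circ t)) = 0}.
  apply: ae_eq0_of_peaks; first exact: integrable_circle_Im.
    by case: int0.
  move=> v n v01; rewrite -[LHS]fineK; last first.
    apply: integrable_fin_num => //; apply: eq_integrable (integrable_circle_Im (ip v n)) => //.
    by move=> t _ /=; rewrite pE ImZ.
  congr EFin; apply: etrans (congr1 (@complex.Im R) (intp v n)); congr fine.
  by apply: eq_integral => t _; rewrite pE ImZ.
rewrite /eq_circle /ae_circle.
apply: (@filterS2 _ _ (ae_filter_ringOfSetsType mu)) hr hi => t r i tI.
by move: (r tI) (i tI); case: (f _) => a b /= -> ->.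
Qed.

Lemma fourier_inj f g : L2 f -> L2 g -> (forall n, fourier f n = fourier g n) -> eq_circle f g.
Proof.
move=> hf hg fg; have /fourier_eq0 : L2 (fun z => f z - g z) by exact: L2B.
have h n : fourier (fun z => f z - g z) n = 0.
  by rewrite /fourier dotL2Bl//; [rewrite -/(fourier f n) fg subrr | exact: L2_expz].
by move=> /(_ h); apply: ae_circleS => z _ /eqP; rewrite subr_eq0 => /eqP.
Qed.

End FourierUniqueness.

(** * Completeness of L2 and Fourier series *)

Section L2Complete.
Variable R : realType.
Local Notation C := R[i].
Local Notation mu := (@lebesgue_measure R).
Local Notation I01 := (`[0%R, 1%R]%classic : set R).
Implicit Types (f g h : C -> C) (c : C).

Lemma normL2_cst1 : normL2 (cst (1 : C)) = 1.
Proof.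
rewrite /normL2 /=.
under eq_Rintegral do rewrite expr0n addr0 expr1n sqrtr1 expr1n.
rewrite Rintegral_cst// mul1r.
have -> : fine (mu I01) = 1 by rewrite mu_I01.
by rewrite sqrtr1.
Qed.

Lemma L2_normc f : L2 f -> L2 (fun z => (normc (f z))%:C).
Proof.
move=> [mf hf]; split; first by split => /=; [exact: measurable_normc | exact: measurable_cst].
by under eq_integral do rewrite normc_real real_normK ?num_real//.
Qed.

Lemma normL1_le f : L2 f -> \int[mu]_(t in I01) normc (f (circ t)) <= normL2 f.
Proof.
move=> hf; have := cauchy_schwarz (L2_normc hf) (L2_cst 1); rewrite normL2_cst1 mulr1.
have -> : normL2 (fun z => (normc (f z))%:C) = normL2 f.
  by apply: eq_normL2W => z _; rewrite normc_real ger0_norm ?normc_ge0.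
apply: le_trans; apply: le_trans (Re_le_normc _); apply: le_trans (ler_norm _).
rewrite le_eqVlt; apply/orP; left; apply/eqP; apply: eq_Rintegral => t _.
by rewrite conjC1 mulr1.
Qed.

Lemma normL1M_le f g : L2 f -> L2 g ->
  \int[mu]_(t in I01) normc (f (circ t) * g (circ t)) <= normL2 f * normL2 g.
Proof.
move=> hf hg; have := cauchy_schwarz (L2_normc hf) (L2_normc hg).
have E h : L2 h -> normL2 (fun z => (normc (h z))%:C) = normL2 h.
  by move=> hh; apply: eq_normL2W => z _; rewrite normc_real ger0_norm ?normc_ge0.
rewrite !E//; apply: le_trans; apply: le_trans (Re_le_normc _); apply: le_trans (ler_norm _).
rewrite le_eqVlt; apply/orP; left; apply/eqP; apply: eq_Rintegral => t _.
by rewrite normcM /=; move: (normc _) (normc _) => x y; ring.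
Qed.

(** Absolute convergence of the telescoping series. The limit is written as an upper limit so that
    it has the form used in [esup_limit]. *)
Lemma cvg_of_summable_increments (u : nat -> R) :
  (\sum_(0 <= k <oo) `|u k.+1 - u k|%:E < +oo)%E ->
  u n @[n --> \oo] --> fine (limn_esup (fun n => (u n)%:E)).
Proof.
move=> su.
have cn : cvgn [normed series (fun k => u k.+1 - u k)].
  apply: nondecreasing_is_cvgn.
    move=> m n mn; rewrite /= /series /=.
    rewrite [leRHS](@big_cat_nat _ _ _ m) //= lerDl; exact: sumr_ge0.
  exists (fine (\sum_(0 <= k <oo) `|u k.+1 - u k|%:E)%E) => _ [n _ <-].
  rewrite -lee_fin fineK; last first.
    by rewrite ge0_fin_numE// nneseries_ge0.
  rewrite /series /= -sumEFin; exact: nneseries_lim_ge.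
have /cvg_ex[l sl] := normed_cvg cn.
have ul : u n @[n --> \oo] --> (l + u 0%N : R).
  have h : (series (fun k => u k.+1 - u k) n + u 0%N : R) @[n --> \oo] --> (l + u 0%N : R).
    by apply: cvgD => //; exact: cvg_cst.
  have e : u = (fun n => series (fun k => u k.+1 - u k) n + u 0%N).
    by apply/funext => n; rewrite /series /= telescope_sumr// subrK.
  by rewrite {1}e.
have : (u n)%:E @[n --> \oo] --> (l + u 0%N)%:E by apply: cvg_EFin => //; exact: nearW.
by move=> /cvg_limn_einf_sup[_ ->].
Qed.

(* Upper limits are measurable everywhere, so no null set of divergence has to be removed. *)
Definition esup_limit (G : nat -> C -> C) (z : C) : C :=
  fine (limn_esup (fun k => (complex.Re (G k z))%:E)) +i*
  fine (limn_esup (fun k => (complex.Im (G k z))%:E)).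

Lemma measurable_esup_limit G : (forall k, measurable_circle (G k)) ->
  measurable_circle (esup_limit G).
Proof.
move=> mG; split => /=.
- apply: (measurableT_comp (@fine_measurable R setT measurableT)).
  apply: measurable_fun_limn_esup => k; apply/measurable_EFinP; exact: (mG k).1.
- apply: (measurableT_comp (@fine_measurable R setT measurableT)).
  apply: measurable_fun_limn_esup => k; apply/measurable_EFinP; exact: (mG k).2.
Qed.

(** The L^1 norms of the increments are dominated by their L^2 norms and have sum at most 2, so the
    series of the moduli of the increments has finite integral and converges almost everywhere. *)
Lemma ae_cvg_esup_limit G : (forall k, L2 (G k)) ->
  (forall k, normL2 (fun z => G k.+1 z - G k z) <= 2^-1 ^+ k) ->
  ae_circle (fun z => normc (G k z - esup_limit G z) @[k --> \oo] --> 0).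
Proof.
move=> hG fast.
pose d k t := (normc (G k.+1 (circ t) - G k (circ t)))%:E : \bar R.
have md k : measurable_fun I01 (d k).
  by apply/measurable_EFinP; exact: measurable_normc (L2B (hG k.+1) (hG k)).1.
have d0 k t : (0 <= d k t)%E by rewrite lee_fin normc_ge0.
have id k : mu.-integrable I01 (d k).
  have [_ h] := L2_integrableM (L2B (hG k.+1) (hG k)) (L2_cst 1).
  by apply: eq_integrable h => // t _ /=; rewrite mulr1.
have sd : (\int[mu]_(t in I01) (\sum_(0 <= k <oo) d k t) < +oo)%E.
  rewrite integral_nneseries//.
  apply: (@le_lt_trans _ _ 2%:E); last by rewrite ltry.
  apply: lime_le; first by apply: is_cvg_nneseries => n _ _; exact: integral_ge0.
  apply: nearW => n.
  apply: (@le_trans _ _ (\sum_(0 <= k < n) (2^-1 ^+ k : R)%:E)%E).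
    apply: lee_sum => k _.
    rewrite -[leLHS]fineK; last exact: integrable_fin_num.
    by rewrite lee_fin; apply: le_trans (fast k); exact: normL1_le (L2B (hG k.+1) (hG k)).
  rewrite sumEFin lee_fin big_mkord.
  have := subrX1 (2^-1 : R) n.
  have : 0 <= (2^-1 : R) ^+ n by rewrite exprn_ge0// invr_ge0.
  set S := \sum_(i < n) _; lra.
have msd : measurable_fun I01 (fun t => \sum_(0 <= k <oo) d k t)%E.
  apply: (emeasurable_fun_cvg (fun n t => \sum_(0 <= k < n) d k t)%E).
    by move=> n; exact: emeasurable_sum.
  by move=> t _; apply: is_cvg_nneseries.
have isd : mu.-integrable I01 (fun t => \sum_(0 <= k <oo) d k t)%E.
  apply/integrableP; split => //.
  apply: le_lt_trans sd; apply: ge0_le_integral => //.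
  - exact: measurableT_comp.
  - by move=> t _; rewrite gee0_abs// nneseries_ge0.
have := integrable_ae (@measurable_I01 R) isd.
rewrite /ae_circle; apply: (@filterS _ _ (ae_filter_ringOfSetsType mu)) => t ht tI.
have {}ht : (\sum_(0 <= k <oo) d k t < +oo)%E by have := ht tI; rewrite ge0_fin_numE ?nneseries_ge0.
have part (p : C -> R) : (forall z w, `|p z - p w| <= normc (z - w)) ->
    p (G k (circ t)) @[k --> \oo] --> fine (limn_esup (fun k => (p (G k (circ t)))%:E)).
  move=> pl; apply: cvg_of_summable_increments; apply: le_lt_trans ht.
  by apply: lee_nneseries => k _; rewrite lee_fin//; exact: pl.
have hr : complex.Re (G k (circ t)) @[k --> \oo] --> complex.Re (esup_limit G (circ t)).
  by apply: (part (@complex.Re R)) => z w; rewrite -ReB Re_le_normc.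
have hi : complex.Im (G k (circ t)) @[k --> \oo] --> complex.Im (esup_limit G (circ t)).
  by apply: (part (@complex.Im R)) => z w; rewrite -ImB Im_le_normc.
move: (esup_limit G (circ t)) hr hi => l hr hi.
apply: (@squeeze_cvgr _ _ _ _ (cst 0) (fun k => `|complex.Re (G k (circ t)) - complex.Re l| + `|complex.Im (G k (circ t)) - complex.Im l|)).
- apply: nearW => k; apply/andP; split; first exact: normc_ge0.
  by rewrite -ReB -ImB; exact: normc_le_ReIm.
- exact: cvg_cst.
- rewrite -[X in _ --> X]addr0; apply: cvgD; apply/norm_cvg0P.
  + by rewrite -[X in _ --> X](subrr (complex.Re l)); apply: cvgB => //; exact: cvg_cst.
  + by rewrite -[X in _ --> X](subrr (complex.Im l)); apply: cvgB => //; exact: cvg_cst.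
Qed.


(** Fatou's lemma for the squared moduli. Membership of f in L^2 is a conclusion: an almost
    everywhere limit is at first only known to be measurable. *)
Lemma L2_fatou G f (b : R) : (forall k, L2 (G k)) -> measurable_circle f ->
  ae_circle (fun z => normc (G k z - f z) @[k --> \oo] --> 0) ->
  (\forall k \near \oo, normL2 (G k) <= b) ->
  L2 f /\ normL2 f <= b.
Proof.
move=> hG mf cv nb.
have nf0 t : I01 t -> (0 <= (normc (f (circ t)) ^+ 2)%:E)%E by move=> _; rewrite lee_fin sqr_ge0.
have mG k : measurable_fun I01 (fun t => (normc (G k (circ t)) ^+ 2)%:E).
  by apply/measurable_EFinP; exact: measurable_normc_sqr (hG k).1.
have mnf : measurable_fun I01 (fun t => (normc (f (circ t)) ^+ 2)%:E).
  by apply/measurable_EFinP; exact: measurable_normc_sqr mf.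
have liminf_ge0 (u : nat -> \bar R) : (forall n, 0 <= u n)%E -> (0 <= limn_einf u)%E.
  move=> u0; rewrite limn_einf_lim; apply: lime_ge; first exact: is_cvg_einfs.
  by apply: nearW => n; apply: le_ereal_inf_tmp => _ [m _ <-].
have step : (\int[mu]_(t in I01) (normc (f (circ t)) ^+ 2)%:E <= (b ^+ 2)%:E)%E.
  apply: (@le_trans _ _ (\int[mu]_(t in I01) limn_einf (fun k => (normc (G k (circ t)) ^+ 2)%:E))%E).
    apply: ae_ge0_le_integral => //.
    - by move=> t _; apply: liminf_ge0 => n; rewrite lee_fin sqr_ge0.
    - apply: (emeasurable_fun_cvg (fun n t => einfs (fun k => (normc (G k (circ t)) ^+ 2)%:E) n)).
        by move=> n; exact: measurable_fun_einfs.
      by move=> t _; rewrite limn_einf_lim; exact: is_cvg_einfs.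
    - move: cv; rewrite /ae_circle; apply: (@filterS _ _ (ae_filter_ringOfSetsType mu)) => t ht tI.
      suff : (normc (G k (circ t)) ^+ 2)%:E @[k --> \oo] --> (normc (f (circ t)) ^+ 2)%:E.
        by move=> /cvg_limn_einf_sup[-> _].
      apply: cvg_EFin; first exact: nearW.
      suff h : normc (G k (circ t)) @[k --> \oo] --> normc (f (circ t)).
        by under eq_fun do rewrite /= expr2; rewrite expr2; exact: cvgM.
      have := ht tI => c0.
      apply: (@squeeze_cvgr _ _ _ _ (fun k => normc (f (circ t)) - normc (G k (circ t) - f (circ t))) (fun k => normc (f (circ t)) + normc (G k (circ t) - f (circ t)))).
      + apply: nearW => k.
        have h1 := le_normcD (f (circ t)) (G k (circ t) - f (circ t)).
        have h2 := le_normcD (G k (circ t)) (- (G k (circ t) - f (circ t))).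
        rewrite normcN in h2; rewrite subrKC in h1.
        rewrite opprB addrC subrK in h2.
        by apply/andP; split; lra.
      + by rewrite -[X in _ --> X]subr0; apply: cvgB => //; exact: cvg_cst.
      + by rewrite -[X in _ --> X]addr0; apply: cvgD => //; exact: cvg_cst.
  apply: le_trans; first by apply: fatou => // n t _; rewrite lee_fin sqr_ge0.
  rewrite limn_einf_lim; apply: lime_le; first exact: is_cvg_einfs.
  move: nb; apply: filterS => n nb.
  apply: ereal_inf_le; eexists; first by exists n => //=.
  rewrite -[leLHS]fineK; last exact: integrable_fin_num (L2_integrable_sqr (hG n)).
  rewrite lee_fin -[leLHS]/(\int[mu]_(t in I01) (normc (G n (circ t)) ^+ 2)) -sqr_normL2.
  by rewrite ler_sqr ?nnegrE ?normL2_ge0//; apply: le_trans nb; exact: normL2_ge0.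
have hf : L2 f by split => //; apply: le_lt_trans step _; rewrite ltry.
split=> //.
have b0 : 0 <= b.
  by have [n nb1] := filter_ex nb; apply: le_trans nb1; exact: normL2_ge0.
rewrite -ler_sqr ?nnegrE ?normL2_ge0// sqr_normL2 -lee_fin.
by rewrite /Rintegral fineK//; exact: integrable_fin_num (L2_integrable_sqr hf).
Qed.

Lemma L2_complete F : (forall n, L2 (F n)) ->
  (forall e : R, 0 < e -> exists N, forall m n, (N <= m)%N -> (N <= n)%N ->
     normL2 (fun z => F m z - F n z) <= e) ->
  exists2 f, L2 f & normL2 (fun z => F n z - f z) @[n --> \oo] --> 0.
Proof.
move=> hF cauchyF.
have half0 k : 0 < (2^-1 : R) ^+ k by rewrite exprn_gt0// invr_gt0.
have [N hN] := choice (fun k => cauchyF _ (half0 k)).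
(* Summing the thresholds makes the indices nondecreasing while keeping [N k <= phi k]. *)
pose phi k := (\sum_(i < k.+1) N i)%N.
have phiN k : (N k <= phi k)%N by rewrite /phi big_ord_recr leq_addl.
have phiS k : (phi k <= phi k.+1)%N by rewrite {2}/phi big_ord_recr leq_addr.
have phi_le j k : (j <= k)%N -> (phi j <= phi k)%N.
  by elim: k => [|k ih]; rewrite leq_eqVlt => /orP[/eqP->//|]; rewrite ?ltnS// => /ih /leq_trans; apply.
pose G k := F (phi k).
have hG k : L2 (G k) by exact: hF.
have fast j n : (phi j <= n)%N -> normL2 (fun z => G j z - F n z) <= 2^-1 ^+ j.
  by move=> jn; apply: hN => //; exact: leq_trans jn.
have cvG : ae_circle (fun z => normc (G k z - esup_limit G z) @[k --> \oo] --> 0).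
  by apply: ae_cvg_esup_limit => // k; rewrite normL2_sym; exact: fast.
pose f := esup_limit G.
have mf : measurable_circle f by apply: measurable_esup_limit => k; exact: (hG k).1.
have mB (g h : C -> C) : measurable_circle g -> measurable_circle h -> measurable_circle (fun z => g z - h z).
  move=> mg mh; apply: (@eq_measurable_circle _ (fun z => -1 * h z + g z)).
    by move=> z _; rewrite mulN1r addrC.
  exact: measurable_circle_lin.
(* Fatou in the second index of [G j - G k], with j fixed, turns pointwise convergence into a rate
   in norm. *)
have key j : L2 (fun z => G j z - f z) /\ normL2 (fun z => G j z - f z) <= 2^-1 ^+ j.
  apply: (@L2_fatou (fun k z => G j z - G k z)).
  - by move=> k; exact: L2B.
  - exact: mB (hG j).1 mf.
  - apply: ae_circleS cvG => z _.
    rewrite (_ : (fun k => normc (G j z - G k z - (G j z - f z))) = (fun k => normc (G k z - f z)))//.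
    by apply/funext => k; rewrite normcB_sym opprB addrC addrA subrK.
  - by exists j => // k /= jk; apply: fast; exact: phi_le.
have hf : L2 f.
  by apply: eq_L2W (L2B (hG 0%N) (key 0%N).1) => z _; rewrite subKr.
exists f => //; apply/cvgr0Pnorm_le => e e0.
have : (2^-1 : R) ^+ k @[k --> \oo] --> 0 by apply: cvg_expr; rewrite ger0_norm ?invf_lt1 ?ltr1n.
move=> /cvgr0Pnorm_le /(_ (e / 2)) []; first by lra.
move=> k _ /(_ k (leqnn k)) /=; rewrite ger0_norm ?(ltW (half0 k))// => ke.
exists (phi k) => // n /= kn; rewrite ger0_norm ?normL2_ge0//.
apply: le_trans (normL2_triangle (hF n) (hG k) hf) _.
have h1 := fast k n kn; rewrite normL2_sym in h1.
have h2 := (key k).2; lra.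
Qed.

End L2Complete.

(** * Fourier series and the Riesz-Fischer theorem *)

Section FourierSeries.
Variable R : realType.
Local Notation C := R[i].
Local Notation mu := (@lebesgue_measure R).
Local Notation I01 := (`[0%R, 1%R]%classic : set R).
Implicit Types (f g h : C -> C) (e : nat -> int).

Lemma integral_cos_sin (a : R) : a != 0 ->
  \int[mu]_(t in I01) cos (a * t) = sin a / a /\
  \int[mu]_(t in I01) sin (a * t) = (1 - cos a) / a.
Proof.
move=> a0.
have cont (h : R -> R) : continuous h -> {within `[0, 1], continuous (fun t => h (a * t))}.
  move=> ch; apply: continuous_subspaceT => t.
  by apply: continuous_comp; [exact: mulrl_continuous | exact: ch].
have LR (F : R -> R) : (forall t, derivable F t 1) -> derivable_oo_LRcontinuous F 0 1.
  move=> dF; have cF t : F z @[z --> t] --> F t.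
    by apply: differentiable_continuous; exact/derivable1_diffP.
  by split; [move=> t _; exact: dF|exact: cvg_at_right_filter (cF 0)|exact: cvg_at_left_filter (cF 1)].
have da t : is_derive t (1 : R) (fun t => a * t) a.
  have := @is_deriveZ R R R id a t 1 1 (is_derive_id t 1).
  by rewrite /GRing.scale /= mulr1.
have ds t : is_derive t (1 : R) (fun t => a^-1 * sin (a * t)) (cos (a * t)).
  have := @is_deriveZ R R R _ a^-1 t 1 _ (is_derive1_comp (is_derive_sin (a * t)) (da t)).
  by rewrite /GRing.scale /= mulrCA mulVf ?mulr1.
have dc t : is_derive t (1 : R) (fun t => - (a^-1 * cos (a * t))) (sin (a * t)).
  have := @is_deriveN _ _ _ _ _ _ _ (@is_deriveZ R R R _ a^-1 t 1 _ (is_derive1_comp (is_derive_cos (a * t)) (da t))).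
  by rewrite /GRing.scale /= mulrCA mulVf ?mulr1// opprK.
split.
- rewrite /Rintegral (@continuous_FTC2 _ _ (fun t => a^-1 * sin (a * t)))//=.
  + by rewrite !mulr0 !mulr1 sin0 mulr0 subr0 mulrC.
  + exact: (cont (@cos R)) (@continuous_cos R).
  + by apply: LR => t; case: (ds t).
  + by move=> t _; rewrite derive1E; exact: derive_val.
- rewrite /Rintegral (@continuous_FTC2 _ _ (fun t => - (a^-1 * cos (a * t))))//=.
  + by rewrite !mulr0 !mulr1 cos0; field.
  + exact: (cont (@sin R)) (@continuous_sin R).
  + by apply: LR => t; case: (dc t).
  + by move=> t _; rewrite derive1E; exact: derive_val.
Qed.

Lemma integral_expz (q : int) : integral_circle (fun z : C => z ^ q) = (q == 0)%:R.
Proof.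
have [->|q0] := eqVneq q 0.
  rewrite /integral_circle; under eq_Rintegral do rewrite expr0z /=.
  rewrite Rintegral_cst// mul1r.
  under eq_Rintegral do rewrite expr0z /=.
  rewrite Rintegral_cst// mul0r; congr (_ +i* _).
  exact: (congr1 fine (mu_I01 R)).
have a0 : 2 * pi * q%:~R != 0 :> R.
  by rewrite mulf_neq0 ?intr_eq0// mulf_neq0// gt_eqF// pi_gt0.
have [c s] := integral_cos_sin a0.
have := @circ_int R q 1; rewrite mul1r circ1 exp1rz /circ => -[c1 s1].
have E t : circ t ^ q = cos (2 * pi * q%:~R * t) +i* sin (2 * pi * q%:~R * t) :> C.
  by rewrite -circ_int /circ; congr (cos _ +i* sin _); ring.
rewrite /integral_circle.
under eq_Rintegral do rewrite E /=.
rewrite c; under eq_Rintegral do rewrite E /=.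
by rewrite s c1 s1 subrr !mul0r.
Qed.

Lemma fourier_expz (m n : int) : fourier (fun z : C => z ^ m) n = (m == n)%:R.
Proof.
rewrite -subr_eq0 -integral_expz; apply: eq_integral_circleW => z z1.
by rewrite conj_expz// expfzDr// norm1_neq0.
Qed.

Lemma fourier_lin c f g n : L2 f -> L2 g ->
  fourier (fun z => c * f z + g z) n = c * fourier f n + fourier g n.
Proof. by move=> hf hg; rewrite /fourier dotL2_linl//; exact: L2_expz. Qed.

Lemma fourierB f g n : L2 f -> L2 g ->
  fourier (fun z => f z - g z) n = fourier f n - fourier g n.
Proof. by move=> hf hg; rewrite /fourier dotL2Bl//; exact: L2_expz. Qed.

Lemma eq_fourier f g n : L2 f -> L2 g -> eq_circle f g -> fourier f n = fourier g n.
Proof.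
by move=> hf hg fg; apply: eq_dotL2 => //; [exact: L2_expz | exact: L2_expz | exact: eq_circle_refl].
Qed.

Lemma eq_fourierW f g n : (forall z, normc z = 1 -> f z = g z) -> fourier f n = fourier g n.
Proof. by move=> fg; apply: eq_dotL2W => z z1; rewrite fg. Qed.

Lemma fourier_expzM m f n : fourier (fun z => z ^ m * f z) n = fourier f (n - m).
Proof.
apply: eq_dotL2W => z z1.
rewrite !conj_expz// opprB addrC expfzDr ?norm1_neq0//; ring.
Qed.

Lemma normL2_expz m : normL2 (fun z : C => z ^ m) = 1.
Proof.
rewrite -normL2_cst1; apply: eq_normL2W => z z1.
by rewrite normc_expz1//= expr1n expr0n addr0 sqrtr1.
Qed.

Lemma normc_fourier_le f n : L2 f -> normc (fourier f n) <= normL2 f.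
Proof.
by move=> hf; have := cauchy_schwarz hf (@L2_expz R n); rewrite normL2_expz mulr1.
Qed.

(** The frequencies follow an arbitrary sequence [e], so that one theory serves L^2 ([int_enum]),
    the Hardy space ([Posz]) and the multiples of k from which the symbol is built. *)
Definition trig_sum (e : nat -> int) (c : nat -> C) (N : nat) : C -> C :=
  fun z => \sum_(i < N) c i * z ^ e i.

Lemma Linfty_trig_sum e c N : Linfty (trig_sum e c N).
Proof.
apply: (@Linfty_sum _ (fun i z => c i * z ^ e i)) => i _.
exact: LinftyM (Linfty_cst (c i)) (@Linfty_expz R (e i)).
Qed.

Lemma L2_trig_sum e c N : L2 (trig_sum e c N).
Proof. exact: Linfty_L2 (Linfty_trig_sum e c N). Qed.
Hint Resolve L2_trig_sum : core.

Lemma dotL2_trig_sum e c N f : L2 f ->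
  dotL2 (trig_sum e c N) f = \sum_(i < N) c i * (fourier f (e i))^*.
Proof.
move=> hf; rewrite (@dotL2_suml _ (fun i z => c i * z ^ e i))//; last first.
  by move=> i _; apply: L2Z; exact: L2_expz.
apply: eq_bigr => i _; rewrite dotL2Zl//; last exact: L2_expz.
by rewrite (dotL2C hf (@L2_expz R (e i))).
Qed.

Lemma fourier_trig_sum e c N n : fourier (trig_sum e c N) n = \sum_(i < N) c i * (e i == n)%:R.
Proof.
rewrite /fourier dotL2_trig_sum; last exact: L2_expz.
apply: eq_bigr => i _; rewrite fourier_expz eq_sym.
by case: eqP; rewrite ?conjC1 ?conjC0.
Qed.

Lemma fourier_trig_sum_inj e c N i : injective e ->
  fourier (trig_sum e c N) (e i) = if (i < N)%N then c i else 0.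
Proof.
move=> ie; rewrite fourier_trig_sum; case: ltnP => iN.
  rewrite (bigD1 (Ordinal iN)) //= eqxx mulr1 big1 ?addr0// => j ji.
  by rewrite (inj_eq ie) (negbTE (_ : (j != i :> nat))) ?mulr0//; move: ji; rewrite -val_eqE.
apply: big1 => j _; rewrite (inj_eq ie) (_ : (j == i :> nat) = false) ?mulr0//.
by apply/negbTE; rewrite neq_ltn (leq_trans (ltn_ord j) iN).
Qed.

Lemma sqr_normL2_trig_sum e c N : injective e ->
  normL2 (trig_sum e c N) ^+ 2 = \sum_(i < N) normc (c i) ^+ 2.
Proof.
move=> ie; apply: (@complexI R); rewrite -dotL2_norm dotL2_trig_sum// rmorph_sum.
by apply: eq_bigr => i _; rewrite fourier_trig_sum_inj// ltn_ord mul_conj.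
Qed.

Lemma sqr_normL2_sub_trig_sum e f N : injective e -> L2 f ->
  normL2 (fun z => f z - trig_sum e (fourier f \o e) N z) ^+ 2 =
  normL2 f ^+ 2 - \sum_(i < N) normc (fourier f (e i)) ^+ 2.
Proof.
move=> ie hf; set S := trig_sum _ _ _.
have -> : normL2 (fun z => f z - S z) = normL2 (fun z => -1 * S z + f z).
  by apply: eq_normL2W => z _; rewrite mulN1r addrC.
have hS : L2 S by exact: L2_trig_sum.
rewrite normL2_sqr_lin// normcN normc1 expr1n mul1r /S sqr_normL2_trig_sum// dotL2_trig_sum//.
have -> : \sum_(i < N) (fourier f \o e) i * (fourier f (e i))^* = (\sum_(i < N) normc (fourier f (e i)) ^+ 2)%:C.
  by rewrite rmorph_sum; apply: eq_bigr => i _; exact: mul_conj.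
rewrite mulN1r /=; lra.
Qed.

Lemma bessel e f N : injective e -> L2 f ->
  \sum_(i < N) normc (fourier f (e i)) ^+ 2 <= normL2 f ^+ 2.
Proof.
move=> ie hf; have := sqr_ge0 (normL2 (fun z => f z - trig_sum e (fourier f \o e) N z)).
by rewrite sqr_normL2_sub_trig_sum// subr_ge0.
Qed.

Lemma eq0_of_le_cvg0 (x : C) (u : nat -> R) (K : R) (N0 : nat) :
  (forall N, (N0 <= N)%N -> normc x <= K * u N) -> u N @[N --> \oo] --> 0 -> x = 0.
Proof.
move=> xu u0; apply: eq0_normc; apply/eqP; rewrite eq_le normc_ge0 andbT.
have h : K * u N @[N --> \oo] --> (0 : R).
  by rewrite -[X in _ --> X](mulr0 K); apply: cvgM => //; exact: cvg_cst.
rewrite leNgt; apply/negP => x0.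
have := (iffLR (cvgr0Pnorm_lt _) h) _ x0 => -[M _ hM].
have := hM (maxn M N0) (leq_maxl _ _).
have := xu (maxn M N0) (leq_maxr _ _).
move=> h1 /=; rewrite ltNge => /negP; apply; apply: le_trans h1 (ler_norm _).
Qed.

(** The squared distance of two partial sums is a difference of partial sums of a bounded series
    with nonnegative terms, so they form a Cauchy sequence; each Fourier coefficient is continuous
    and is eventually constant along it. *)
Lemma riesz_fischer e (c : nat -> C) (b : R) : injective e ->
  (forall N, \sum_(i < N) normc (c i) ^+ 2 <= b) ->
  exists f, [/\ L2 f,
    normL2 (fun z => trig_sum e c N z - f z) @[N --> \oo] --> 0,
    forall i, fourier f (e i) = c i &
    forall n, (forall i, e i != n) -> fourier f n = 0].
Proof.
move=> ie cb.
pose s N := \sum_(i < N) normc (c i) ^+ 2.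
have diff M k : normL2 (fun z => trig_sum e c (M + k) z - trig_sum e c M z) ^+ 2 = s (M + k)%N - s M.
  rewrite (@eq_normL2W _ _ (trig_sum (fun i => e (M + i)%N) (fun i => c (M + i)%N) k)).
    rewrite sqr_normL2_trig_sum; last by move=> i j /ie/addnI.
    by rewrite /s big_split_ord /= [RHS]addrC addKr.
  by move=> z _; congr normc; rewrite /trig_sum big_split_ord /= [LHS]addrC addKr.
have cs : cvgn s.
  apply: nondecreasing_is_cvgn.
    move=> m n mn; rewrite -subr_ge0 -(subnKC mn) -diff; exact: sqr_ge0.
  by exists b => _ [N _ <-]; exact: cb.
have /cvg_ex[l sl] := cs.
have cau (d : R) : 0 < d -> exists N, forall m n, (N <= m)%N -> (N <= n)%N ->
     normL2 (fun z => trig_sum e c m z - trig_sum e c n z) <= d.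
  move=> d0; have d2 : 0 < d ^+ 2 / 2 by rewrite divr_gt0// exprn_gt0.
  have [N _ hN] := (iffLR (cvgrPdist_lt _ _) sl) _ d2; exists N.
  have H m n : (N <= m)%N -> (m <= n)%N -> normL2 (fun z => trig_sum e c n z - trig_sum e c m z) <= d.
    move=> Nm mn; rewrite -ler_sqr ?nnegrE ?normL2_ge0 ?(ltW d0)// -(subnKC mn) diff (subnKC mn).
    have /= := hN m Nm; have /= := hN n (leq_trans Nm mn).
    rewrite !ltr_norml => /andP[? ?] /andP[? ?]; lra.
  move=> m n Nm Nn; have [mn|/ltnW nm] := leqP m n; last exact: H.
  by rewrite normL2_sym; exact: H.
have [f hf fl] := L2_complete (fun N => L2_trig_sum e c N) cau.
have lim n x : (exists N0, forall N, (N0 <= N)%N -> fourier (trig_sum e c N) n = x) -> fourier f n = x.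
  move=> [N0 hx]; apply/eqP; rewrite -subr_eq0; apply/eqP.
  apply: (@eq0_of_le_cvg0 _ _ 1 N0 _ fl) => N N0N; rewrite mul1r -(hx N N0N) -fourierB//.
  by rewrite normL2_sym; apply: normc_fourier_le; exact: L2B.
exists f; split=> // [i|n en]; apply: lim.
- by exists i.+1 => N iN; rewrite fourier_trig_sum_inj// iN.
- by exists 0%N => N _; rewrite fourier_trig_sum big1// => i _; rewrite (negbTE (en i)) mulr0.
Qed.

(** Riesz-Fischer sums the Fourier series of f to some g with the same coefficients as f, and
    uniqueness identifies g with f. *)
Lemma trig_sum_cvg e f : injective e -> L2 f ->
  (forall n, (forall i, e i != n) -> fourier f n = 0) ->
  normL2 (fun z => f z - trig_sum e (fourier f \o e) N z) @[N --> \oo] --> 0.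
Proof.
move=> ie hf f0.
have [g [hg gl ge g0]] := @riesz_fischer e (fourier f \o e) _ ie (fun N => bessel N ie hf).
have fg : eq_circle f g.
  apply: fourier_inj => // n.
  have [en|] := pselect (forall i, e i != n); first by rewrite f0// g0.
  by move=> /existsNP[i /negP]; rewrite negbK => /eqP <-; rewrite ge.
have E : (fun N => normL2 (fun z => f z - trig_sum e (fourier f \o e) N z)) =
  (fun N => normL2 (fun z => trig_sum e (fun i => fourier f (e i)) N z - g z)).
  apply/funext => N; rewrite normL2_sym; apply: eq_normL2; [exact: L2B|exact: L2B|].
  by apply: ae_circleS fg => z _ ->.
by rewrite E.
Qed.

Definition int_enum (i : nat) : int := if odd i then Negz i./2 else Posz i./2.

Lemma int_enum_inj : injective int_enum.
Proof.
move=> i j h; rewrite -(odd_double_half i) -(odd_double_half j); move: h; rewrite /int_enum.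
by case: (odd i); case: (odd j) => // -[->].
Qed.

Lemma int_enum_surj n : exists i, int_enum i = n.
Proof.
case: n => n; [exists n.*2 | exists n.*2.+1]; rewrite /int_enum /=.
- by rewrite odd_double doubleK.
- by rewrite odd_double /= uphalf_double.
Qed.

Lemma trig_sum_cvg_L2 f : L2 f ->
  normL2 (fun z => f z - trig_sum int_enum (fourier f \o int_enum) N z) @[N --> \oo] --> 0.
Proof.
move=> hf; apply: trig_sum_cvg => //; first exact: int_enum_inj.
by move=> n en; have [i ei] := int_enum_surj n; have := en i; rewrite ei eqxx.
Qed.

Lemma trig_sum_cvg_H2 f : H2 f ->
  normL2 (fun z => f z - trig_sum Posz (fourier f \o Posz) N z) @[N --> \oo] --> 0.
Proof.
move=> [hf f0]; apply: trig_sum_cvg => //; first by move=> i j [].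
by case=> n en; [have := en n; rewrite eqxx | apply: f0].
Qed.

End FourierSeries.
#[export] Hint Resolve L2_trig_sum : core.

(** * Bounded functionals on subspaces of L2 *)

Section Functionals.
Variable R : realType.
Local Notation C := R[i].
Implicit Types (f g h : C -> C) (c : C) (E F : set (C -> C)) (L : (C -> C) -> C).

(** Closedness is not imposed, so the bounded functions of a model space form an instance. *)
Definition L2_subspace E := [/\ E `<=` @L2 R, E (cst 0) &
  forall c f g, E f -> E g -> E (fun z => c * f z + g z)].

Definition linear_on E L := forall c f g, E f -> E g ->
  L (fun z => c * f z + g z) = c * L f + L g.

Definition bounded_on E L := linear_on E L /\
  exists M : R, forall f, E f -> normc (L f) <= M * normL2 f.

Lemma L2_subspace_L2 : L2_subspace (@L2 R).
Proof. by split => //; [exact: L2_cst | move=> c f g; exact: L2_lin]. Qed.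

Lemma L2_subspaceB E f g : L2_subspace E -> E f -> E g -> E (fun z => f z - g z).
Proof.
move=> [_ _ hE] hf hg; rewrite (_ : (fun z => _) = (fun z => -1 * g z + f z)); first exact: hE.
by apply/funext => z; rewrite mulN1r addrC.
Qed.

Lemma L2_subspaceZ E c f : L2_subspace E -> E f -> E (fun z => c * f z).
Proof.
move=> [_ E0 hE] hf; rewrite (_ : (fun z => _) = (fun z => c * f z + cst 0 z)); first exact: hE.
by apply/funext => z; rewrite addr0.
Qed.

Lemma L2_subspace_sum E (c : nat -> C) (F : nat -> C -> C) n : L2_subspace E ->
  (forall i, E (F i)) -> E (fun z => \sum_(i < n) c i * F i z).
Proof.
move=> sE hF; have [_ E0 hE] := sE; elim: n => [|n ih].
  by rewrite (_ : (fun z => _) = cst 0)//; apply/funext => z; rewrite big_ord0.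
rewrite (_ : (fun z => _) = (fun z => c n * F n z + \sum_(i < n) c i * F i z)); first exact: hE.
by apply/funext => z; rewrite big_ord_recr addrC.
Qed.

Lemma linear_on0 E L : L2_subspace E -> linear_on E L -> L (cst 0) = 0.
Proof.
move=> [_ E0 _] lL; rewrite -[RHS](addNr (L (cst 0))) -[X in X + _]mulN1r -lL//.
by congr L; apply/funext => z /=; rewrite mulr0 addr0.
Qed.

Lemma linear_onB E L f g : L2_subspace E -> linear_on E L -> E f -> E g ->
  L (fun z => f z - g z) = L f - L g.
Proof.
move=> sE lL hf hg; rewrite [RHS]addrC -mulN1r -lL//; congr L.
by apply/funext => z; rewrite mulN1r addrC.
Qed.

Lemma linear_on_sum E L (c : nat -> C) (F : nat -> C -> C) n : L2_subspace E -> linear_on E L ->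
  (forall i, E (F i)) -> L (fun z => \sum_(i < n) c i * F i z) = \sum_(i < n) c i * L (F i).
Proof.
move=> sE lL hF; elim: n => [|n ih].
  rewrite big_ord0; apply: etrans (linear_on0 sE lL); congr L.
  by apply/funext => z; rewrite big_ord0.
rewrite big_ord_recr /= -ih addrC -lL//; last exact: (@L2_subspace_sum E c F).
by congr L; apply/funext => z; rewrite big_ord_recr addrC.
Qed.

(** The difference f - g has norm 0. This bridges functions and their almost everywhere classes:
    operators are linear only up to almost everywhere equality. *)
Lemma bounded_on_eq E L f g : L2_subspace E -> bounded_on E L -> E f -> E g ->
  eq_circle f g -> L f = L g.
Proof.
move=> sE [lL [M hM]] hf hg fg; apply/eqP; rewrite -subr_eq0 -(linear_onB sE lL hf hg).
have hfg := L2_subspaceB sE hf hg.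
apply/eqP/eq0_normc/eqP; rewrite eq_le normc_ge0 andbT; apply: le_trans (hM _ hfg) _.
have [sL2 _ _] := sE.
rewrite (@eq_normL2 _ _ (cst 0)); [|exact: sL2|exact: L2_cst|].
  have -> : normL2 (cst (0 : C)) = 0; last by rewrite mulr0.
  have := @normL2Z R 0 (cst 0) (L2_cst 0); rewrite normc0 mul0r => <-.
  by apply: eq_normL2W => z _; rewrite mul0r.
by apply: ae_circleS fg => z _ ->; rewrite subrr.
Qed.

Lemma bounded_on_lim0 E L f (F : nat -> C -> C) : L2_subspace E -> bounded_on E L -> E f ->
  (forall N, E (F N)) -> (forall N, L (F N) = 0) ->
  normL2 (fun z => f z - F N z) @[N --> \oo] --> 0 -> L f = 0.
Proof.
move=> sE [lL [M hM]] hf hF F0 fF.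
apply: (@eq0_of_le_cvg0 _ _ _ M 0%N _ fF) => N _.
rewrite -[L f]subr0 -(F0 N) -(linear_onB sE lL)//; apply: hM; exact: L2_subspaceB.
Qed.

Lemma bounded_on_dot E h : L2_subspace E -> L2 h -> bounded_on E (fun f => dotL2 f h).
Proof.
move=> [sE _ _] hh; split; first by move=> c f g /sE hf /sE hg; exact: dotL2_linl.
by exists (normL2 h) => f /sE hf; rewrite mulrC; exact: cauchy_schwarz.
Qed.

Lemma bounded_on_sub E L L' : bounded_on E L -> bounded_on E L' ->
  bounded_on E (fun f => L f - L' f).
Proof.
move=> [lL [M hM]] [lL' [M' hM']]; split.
  by move=> c f g hf hg; rewrite lL// lL'//; ring.
exists (M + M') => f hf; rewrite mulrDl; apply: le_trans (le_normcD _ _) _.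
by rewrite normcN lerD ?hM ?hM'.
Qed.

Lemma bounded_on_scale E L c : bounded_on E L -> bounded_on E (fun f => c * L f).
Proof.
move=> [lL [M hM]]; split; first by move=> d f g hf hg; rewrite lL//; ring.
exists (normc c * M) => f hf; rewrite normcM -mulrA ler_wpM2l ?normc_ge0//; exact: hM.
Qed.

Lemma bounded_on_comp E F T L : L2_subspace E -> L2_subspace F ->
  bounded_linear_op E F T -> bounded_on F L -> bounded_on E (fun f => L (T f)).
Proof.
move=> sE sF [TF Tl [M hM]] bL; have [lL [N hN]] := bL; have [_ _ clF] := sF; split.
  move=> c f g hf hg; rewrite -lL; [|exact: TF..].
  apply: (bounded_on_eq sF bL); [apply: TF|apply: clF; exact: TF|exact: Tl].
  by case: sE => _ _; apply.
exists (`|N| * M) => f hf; apply: le_trans (hN _ (TF _ hf)) _.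
apply: (@le_trans _ _ (`|N| * normL2 (T f))).
  by apply: ler_wpM2r; [exact: normL2_ge0 | exact: ler_norm].
by rewrite -mulrA; apply: ler_wpM2l => //; exact: hM.
Qed.

Lemma bounded_on_sum E (c : nat -> C) (L : nat -> (C -> C) -> C) n :
  (forall j, bounded_on E (L j)) -> bounded_on E (fun f => \sum_(j < n) c j * L j f).
Proof.
move=> bL; elim: n => [|n ih].
  split; first by move=> d f g _ _; rewrite !big_ord0 mulr0 addr0.
  by exists 0 => f _; rewrite big_ord0 normc0 mul0r.
have {ih bL} := bounded_on_sub ih (bounded_on_scale (- c n) (bL n)).
rewrite (_ : (fun f => _ - _) = (fun f => \sum_(j < n.+1) c j * L j f))//.
by apply/funext => f; rewrite big_ord_recr /= mulNr opprK.
Qed.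

Lemma bounded_onS E F L : E `<=` F -> bounded_on F L -> bounded_on E L.
Proof.
move=> EF [lL [M hM]]; split; first by move=> c f g /EF hf /EF hg; exact: lL.
by exists M => f /EF; exact: hM.
Qed.

Lemma bounded_linear_op_eq E F T f g : L2_subspace E -> L2_subspace F ->
  bounded_linear_op E F T -> E f -> E g -> eq_circle f g -> eq_circle (T f) (T g).
Proof.
move=> sE sF hT hf hg fg; have [sF2 _ _] := sF; have [TF _ _] := hT.
have hTf := sF2 _ (TF _ hf); have hTg := sF2 _ (TF _ hg).
apply: fourier_inj => // n.
exact: (bounded_on_eq sE (bounded_on_comp sE sF hT (bounded_on_dot sF (@L2_expz R n)))).
Qed.

(** The functionals may be linearly dependent, so a dual basis need not exist. In the induction,
    either [l n] vanishes on the common kernel of the previous ones and [u n] can be 0, or some w'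
    in that kernel has [l n w' = 1], and the earlier [u j] are modified by multiples of w'. The
    correctors stay in E, hence are bounded functions when E consists of such, and the coefficients
    are the values [l j f] themselves, so a small violation costs a small correction. *)
Lemma finite_codim_correction E (l : nat -> (C -> C) -> C) n : L2_subspace E ->
  (forall i, linear_on E (l i)) ->
  exists2 u : nat -> C -> C, forall j, E (u j) &
    forall f, E f -> forall i, (i < n)%N ->
      l i (fun z => f z - \sum_(j < n) l j f * u j z) = 0.
Proof.
move=> sE hl; have [_ E0 clE] := sE; elim: n => [|n [u uE hu]].
  by exists (fun=> cst 0).
have corr f : E f -> E (fun z => f z - \sum_(j < n) l j f * u j z).
  by move=> hf; apply: L2_subspaceB => //; exact: (@L2_subspace_sum E (l^~ f) u).
have [null|/existsNP[w /not_implyP[Ew /not_implyP[wn /eqP lw]]]] :=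
  pselect (forall w, E w -> (forall i, (i < n)%N -> l i w = 0) -> l n w = 0).
- exists (fun j => if (j < n)%N then u j else cst 0) => [j|f hf i]; first by case: ifP.
  have -> : (fun z => f z - \sum_(j < n.+1) l j f * (if (j < n)%N then u j else cst 0) z) =
            (fun z => f z - \sum_(j < n) l j f * u j z).
    apply/funext => z; rewrite big_ord_recr /= ltnn mulr0 addr0.
    by congr (_ - _); apply: eq_bigr => j _; rewrite ltn_ord.
  rewrite ltnS leq_eqVlt => /orP[/eqP->|]; last exact: hu.
  by apply: null; [exact: corr | move=> j; exact: hu].
- pose w' z := (l n w)^-1 * w z.
  have Ew' : E w' by exact: L2_subspaceZ.
  have lZ i : l i w' = (l n w)^-1 * l i w.
    have := hl i (l n w)^-1 w (cst 0) Ew E0; rewrite (linear_on0 sE (hl i)) addr0 => <-.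
    by congr (l i); apply/funext => z; rewrite addr0.
  have w'n i : (i < n)%N -> l i w' = 0 by move=> ni; rewrite lZ (wn i ni) mulr0.
  have lw' : l n w' = 1 by rewrite lZ mulVf.
  pose v j z := if (j < n)%N then u j z - l n (u j) * w' z else w' z.
  exists v => [j|f hf i ni].
    rewrite (_ : v j = if (j < n)%N then fun z => u j z - l n (u j) * w' z else w').
      by case: ifP => _ //; apply: L2_subspaceB => //; exact: L2_subspaceZ.
    by apply/funext => z; rewrite /v; case: ifP.
  pose g z := f z - \sum_(j < n) l j f * u j z.
  have Eg : E g by exact: corr.
  have lng : l n g = l n f - \sum_(j < n) l j f * l n (u j).
    rewrite (linear_onB sE (hl n))//; last exact: (@L2_subspace_sum E (l^~ f) u).
    by rewrite (@linear_on_sum E (l n) (l^~ f) u).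
  have -> : (fun z => f z - \sum_(j < n.+1) l j f * v j z) = (fun z => - l n g * w' z + g z).
    apply/funext => z; rewrite big_ord_recr /= /v ltnn lng.
    rewrite (eq_bigr (fun j : 'I_n => l j f * u j z - l j f * l n (u j) * w' z)); last first.
      by move=> j _; rewrite ltn_ord; ring.
    rewrite sumrB -mulr_suml /g; ring.
  rewrite hl//; move: ni; rewrite ltnS leq_eqVlt => /orP[/eqP->|ni].
    by rewrite lw' mulr1 addNr.
  by rewrite w'n// mulr0 add0r; exact: hu.
Qed.

End Functionals.

(** * The operator W_k *)

Section OperatorW.
Variable R : realType.
Local Notation C := R[i].
Local Notation mu := (@lebesgue_measure R).
Local Notation I01 := (`[0%R, 1%R]%classic : set R).
Implicit Types (f g h : C -> C).

Lemma bounded_on_expz_eq0 (L : (C -> C) -> C) f : bounded_on (@L2 R) L ->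
  (forall m : int, L (fun z => z ^ m) = 0) -> L2 f -> L f = 0.
Proof.
move=> bL L0 hf; have sL := L2_subspace_L2 R.
apply: (bounded_on_lim0 sL bL hf _ _ (trig_sum_cvg_L2 hf)) => N; first exact: L2_trig_sum.
rewrite (@linear_on_sum _ _ L (fourier f \o int_enum) (fun i z => z ^ int_enum i) N sL bL.1).
  by apply: big1 => i _; rewrite L0 mulr0.
by move=> i; exact: L2_expz.
Qed.

Lemma normL1_fourier_le f n : L2 f ->
  normc (fourier f n) <= 2 * \int[mu]_(t in I01) normc (f (circ t)).
Proof.
move=> hf; apply: le_trans (integral_circle_norm_le (L2_integrable_dot hf (@L2_expz R n))) _.
rewrite ler_pM2l// le_eqVlt; apply/orP; left; apply/eqP; apply: eq_Rintegral => t _.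
by rewrite normcM normc_conj normc_expz1 ?mulr1// circ_norm.
Qed.

Lemma L2_integrable_normc f : L2 f ->
  mu.-integrable I01 (EFin \o (fun t => normc (f (circ t)))).
Proof.
move=> hf; have [_ h] := L2_integrableM hf (L2_cst 1).
by apply: eq_integrable h => // t _ /=; rewrite mulr1.
Qed.

Variable k : nat.
Hypothesis k0 : (0 < k)%N.

Lemma L2_Wf f : L2 f -> L2 (Wf k f).
Proof.
move=> [mf hf]; split; first exact: measurable_Wf.
apply: le_lt_trans (Wf_integral k0 mf) _; apply: lte_mul_pinfty => //.
Qed.

(** Each of the k branches of the root contributes at most k times the integral of |f|, and the
    average divides their sum by k. *)
Lemma normL1_Wf_le f : L2 f ->
  \int[mu]_(t in I01) normc (Wf k f (circ t)) <= k%:R * \int[mu]_(t in I01) normc (f (circ t)).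
Proof.
move=> hf; have [mf _] := hf; have hW := L2_Wf hf.
have kR0 : 0 < k%:R :> R by rewrite ltr0n.
have mnf : measurable_fun I01 (fun t => normc (f (circ t))) := measurable_normc mf.
have mjr (j : 'I_k) : measurable_fun I01 (fun t : R => normc (f (circ (aff k j t)))).
  exact: (@measurable_aff R k k0 (fun z => normc (f z)) j mnf).
have J0 : (0 <= \int[mu]_(t in I01) (normc (f (circ t)))%:E)%E.
  by apply: integral_ge0 => t _; rewrite lee_fin normc_ge0.
have main : (\int[mu]_(t in I01) (normc (Wf k f (circ t)))%:E <=
    k%:R%:E * \int[mu]_(t in I01) (normc (f (circ t)))%:E)%E.
  apply: (@le_trans _ _ (\int[mu]_(t in I01)
     ((k%:R^-1)%:E * \sum_(j < k) (normc (f (circ (aff k j t))))%:E)))%E.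
    apply: ge0_le_integral => //.
    - by move=> t _; rewrite lee_fin normc_ge0.
    - by apply/measurable_EFinP; exact: measurable_normc hW.1.
    - by apply: emeasurable_funM => //; apply: emeasurable_sum => j; apply/measurable_EFinP; exact: mjr.
    - move=> t /=; rewrite in_itv/= => ht; rewrite sumEFin -EFinM lee_fin Wf_circ//.
      rewrite normcM kinv normc_real ger0_norm ?invr_ge0 ?ler0n//.
      rewrite ler_pM2l ?invr_gt0//.
      exact: (normc_sum (fun j => f (circ (aff k j t)))).
  rewrite ge0_integralZl//; last 2 first.
  - by apply: emeasurable_sum => j; apply/measurable_EFinP; exact: mjr.
  - by move=> t _; apply: sume_ge0 => j _; rewrite lee_fin normc_ge0.
  rewrite ge0_integral_sum//; last 2 first.
  - by move=> j; apply/measurable_EFinP; exact: mjr.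
  - by move=> j t _; rewrite lee_fin normc_ge0.
  have -> : (k%:R%:E * \int[mu]_(t in I01) (normc (f (circ t)))%:E =
      (k%:R^-1)%:E * (k%:R%:E * (k%:R%:E * \int[mu]_(t in I01) (normc (f (circ t)))%:E)))%E.
    by rewrite [RHS]muleA -EFinM mulVf ?gt_eqF// mul1e.
  apply: lee_wpmul2l; first by rewrite lee_fin invr_ge0 ler0n.
  apply: (@le_trans _ _ (\sum_(j < k) (k%:R%:E * \int[mu]_(t in I01) (normc (f (circ t)))%:E)))%E.
    apply: lee_sum => j _.
    apply: (@integral_affine R k k0 (fun t : R => (normc (f (circ t)))%:E) j) => //.
    + exact/measurable_EFinP.
    + by move=> t; rewrite lee_fin normc_ge0.
  set X := (k%:R%:E * _)%E.
  have X0 : (0 <= X)%E by rewrite mule_ge0// lee_fin ler0n.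
  have sumc n : (\sum_(j < n) X = n%:R%:E * X)%E.
    elim: n => [|n ih]; first by rewrite big_ord0 mul0e.
    by rewrite big_ord_recr/= ih -[n.+1%:R]natr1 EFinD ge0_muleDl ?lee_fin// mul1e.
  by rewrite sumc.
have fi1 := integrable_fin_num (@measurable_I01 R) (L2_integrable_normc hW).
have fi2 := integrable_fin_num (@measurable_I01 R) (L2_integrable_normc hf).
by rewrite -lee_fin EFinM /Rintegral !fineK.
Qed.

Lemma fourier_W_expz (m n : int) :
  fourier (if (k %| m)%Z then fun z : C => z ^ (m %/ k)%Z else cst 0) n - (m == k%:Z * n)%:R = 0.
Proof.
have kZ : k%:Z != 0 by rewrite eqz_nat -lt0n.
case: ifPn => [/dvdzP[q ->]|ndv].
  by rewrite mulzK// fourier_expz mulrC (inj_eq (mulfI kZ)) subrr.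
rewrite /fourier dotL20l sub0r; case: eqP => [e|_]; last by rewrite oppr0.
by move: ndv; rewrite e dvdz_mulr// dvdzz.
Qed.

Lemma fourier_Wf f n : L2 f -> fourier (Wf k f) n = fourier f (k%:Z * n).
Proof.
move=> hf; apply/eqP; rewrite -subr_eq0; apply/eqP.
apply: (@bounded_on_expz_eq0 (fun f => fourier (Wf k f) n - fourier f (k%:Z * n))) => //.
  apply: bounded_on_sub; last exact: bounded_on_dot (L2_subspace_L2 R) (@L2_expz R _).
  split.
    move=> c g h hg hh; rewrite -fourier_lin; [|exact: L2_Wf..].
    by apply: eq_fourierW => z _; exact: Wf_lin.
  exists (2 * k%:R) => g hg; apply: le_trans (normL1_fourier_le n (L2_Wf hg)) _.
  rewrite -mulrA ler_pM2l//; apply: le_trans (normL1_Wf_le hg) _.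
  by rewrite ler_pM2l ?ltr0n//; exact: normL1_le.
move=> m; rewrite fourier_expz.
rewrite (@eq_fourier R _ (if (k %| m)%Z then fun z => z ^ (m %/ k)%Z else cst 0)).
- exact: fourier_W_expz.
- exact: L2_Wf (@L2_expz R m).
- by case: ifP => _; [exact: L2_expz | exact: L2_cst].
- by apply: aeW => t; rewrite in_itv/= => ht; rewrite Wf_expz//; case: ifP.
Qed.

Lemma fourier_W W f n : is_W k W -> L2 f -> fourier (W f) n = fourier f (k%:Z * n).
Proof.
move=> [hW We] hf; apply/eqP; rewrite -subr_eq0; apply/eqP.
have sL := L2_subspace_L2 R.
apply: (@bounded_on_expz_eq0 (fun f => fourier (W f) n - fourier f (k%:Z * n))) => //.
  apply: bounded_on_sub; last exact: bounded_on_dot sL (@L2_expz R _).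
  exact: (@bounded_on_comp R (@L2 R) (@L2 R) W (fun f => fourier f n) sL sL hW (bounded_on_dot sL (@L2_expz R n))).
move=> m; rewrite fourier_expz.
rewrite (@eq_fourier R _ (if (k %| m)%Z then fun z => z ^ (m %/ k)%Z else cst 0)) ?We//.
- exact: fourier_W_expz.
- by case: hW => h _ _; apply: h; exact: L2_expz.
- by case: ifP => _; [exact: L2_expz | exact: L2_cst].
Qed.

(** Transfers the L^1 bound of the explicit average to any [W] that meets the specification, which
    controls L^2 norms only. *)
Lemma W_eq_Wf W f : is_W k W -> L2 f -> eq_circle (W f) (Wf k f).
Proof.
move=> hW hf; apply: fourier_inj; [by case: hW => -[h _ _] _; exact: h|exact: L2_Wf|].
by move=> n; rewrite fourier_W// fourier_Wf.
Qed.

Lemma normL1_W_le W f : is_W k W -> L2 f ->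
  \int[mu]_(t in I01) normc (W f (circ t)) <= k%:R * \int[mu]_(t in I01) normc (f (circ t)).
Proof.
move=> hW hf; apply: le_trans (normL1_Wf_le hf).
have hWf : L2 (W f) by case: hW => -[h _ _] _; exact: h.
rewrite le_eqVlt; apply/orP; left; apply/eqP; congr fine; apply: ae_eq_integral => //.
- by apply/measurable_EFinP; exact: measurable_normc hWf.1.
- by apply/measurable_EFinP; exact: measurable_normc (L2_Wf hf).1.
- have := W_eq_Wf hW hf; apply: (@filterS _ _ (ae_filter_ringOfSetsType mu)) => t h tI.
  by rewrite h.
Qed.

End OperatorW.

(** * Hardy and model spaces *)

Section HardySpace.
Variable R : realType.
Local Notation C := R[i].
Local Notation H2 := (@H2 R).
Implicit Types (f g h a x v : C -> C) (c : nat -> C).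

Lemma H2_L2 f : H2 f -> L2 f.
Proof. by case. Qed.

Lemma L2_subspace_H2 : L2_subspace H2.
Proof.
split; first by move=> f [].
  by split; [exact: L2_cst | move=> n _; exact: dotL20l].
move=> c f g [hf f0] [hg g0]; split; first exact: L2_lin.
by move=> n n0; rewrite fourier_lin// f0// g0// mulr0 addr0.
Qed.

Lemma eq_H2 f g : H2 f -> L2 g -> eq_circle f g -> H2 g.
Proof.
move=> [hf f0] hg fg; split => // n n0.
by rewrite -(eq_fourier n hf hg fg) f0.
Qed.

Lemma H2_expz (n : nat) : H2 (fun z => z ^ n).
Proof.
by split; [exact: L2_expz | move=> m m0; rewrite fourier_expz; case: eqP m0 => // <-].
Qed.

Lemma H2_expzM (n : nat) f : H2 f -> H2 (fun z => z ^ n * f z).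
Proof.
move=> [hf f0]; split; first exact: L2_expzM.
by move=> m m0; rewrite fourier_expzM f0// subr_lt0; apply: lt_le_trans m0 _.
Qed.

Lemma H2_trig_sum c N : H2 (trig_sum Posz c N).
Proof.
apply: (@L2_subspace_sum _ H2 c (fun i z => z ^ Posz i) N L2_subspace_H2) => i.
exact: H2_expz.
Qed.

Lemma H2_dot_eq0 h x : H2 h -> L2 x -> (forall n : nat, fourier x n = 0) -> dotL2 h x = 0.
Proof.
move=> hh hx x0.
apply: (bounded_on_lim0 (L := fun h => dotL2 h x) L2_subspace_H2 _ hh _ _ (trig_sum_cvg_H2 hh)).
- exact: bounded_on_dot L2_subspace_H2 hx.
- by move=> N; exact: H2_trig_sum.
- by move=> N; rewrite dotL2_trig_sum//; apply: big1 => i _; rewrite x0 conjC0 mulr0.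
Qed.

Lemma fourier_conj_expz a (m n : int) : L2 a ->
  fourier (fun z => (a z)^* * z ^ m) n = (fourier a (m - n))^*.
Proof.
move=> ha; rewrite -(dotL2C ha (@L2_expz R (m - n))); apply: eq_dotL2W => z z1.
by rewrite expfzDr ?norm1_neq0// conj_expz//; ring.
Qed.

(** The coefficient of a h at n < 0 is <h, conj(a) z^n>, and conj(a) z^n has no coefficients at
    frequencies >= 0. *)
Lemma Hinfty_mulH2 a h : Hinfty a -> H2 h -> H2 (fun z => a z * h z).
Proof.
move=> [[ha a0] ba] hh; split; first exact: Linfty_mulL2 ba (H2_L2 hh).
move=> n n0; rewrite /fourier.
have -> : dotL2 (fun z => a z * h z) (fun z => z ^ n) = dotL2 h (fun z => (a z)^* * z ^ n).
  by apply: eq_dotL2W => z _; rewrite conjcM conjCK; ring.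
apply: H2_dot_eq0 => //; first exact: Linfty_mulL2 (Linfty_conj ba) (@L2_expz R n).
move=> m; rewrite fourier_conj_expz// a0 ?conjC0// subr_lt0.
by apply: lt_le_trans n0 _.
Qed.

Lemma inner_Hinfty a : inner_function a -> Hinfty a.
Proof. by case. Qed.

Lemma inner_dotL2 a f g : inner_function a -> L2 f -> L2 g ->
  dotL2 (fun z => a z * f z) (fun z => a z * g z) = dotL2 f g.
Proof.
move=> [[[ha _] ba] a1] hf hg.
have haf := Linfty_mulL2 ba hf; have hag := Linfty_mulL2 ba hg.
apply: eq_integral_circle.
- exact: (L2_integrable_dot haf hag).1.
- exact: (L2_integrable_dot hf hg).1.
apply: ae_circleS a1 => z _ az; rewrite conjcM.
have := mul_conj (a z); rewrite az expr1n => e.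
have -> : a z * f z * ((a z)^* * (g z)^*) = (a z * (a z)^*) * (f z * (g z)^*) by ring.
by rewrite e mul1r.
Qed.

Definition bshift f : C -> C := fun z => z ^ (-1) * (f z - fourier f 0).

Lemma L2_bshift f : L2 f -> L2 (bshift f).
Proof. by move=> hf; apply: L2_expzM; apply: L2B => //; exact: L2_cst. Qed.

Lemma fourier_bshift f (n : nat) : L2 f -> fourier (bshift f) n = fourier f n.+1.
Proof.
move=> hf; rewrite /bshift fourier_expzM opprK fourierB//; last exact: L2_cst.
have -> : fourier (fun=> fourier f 0) (n%:Z + 1) = 0.
  have -> : fourier (fun=> fourier f 0) (n%:Z + 1) = fourier (fun z => fourier f 0 * z ^ 0) (n%:Z + 1).
    by apply: eq_fourierW => z _; rewrite expr0z mulr1.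
  rewrite /fourier dotL2Zl; [|exact: L2_expz..].
  by rewrite -/(fourier _ (n%:Z + 1)) fourier_expz -PoszD addn1 mulr0.
by rewrite subr0 -PoszD addn1.
Qed.

Lemma H2_bshift f : H2 f -> H2 (bshift f).
Proof.
move=> [hf f0]; split; first exact: L2_bshift.
move=> n n0; rewrite /bshift fourier_expzM opprK fourierB//; last exact: L2_cst.
have -> : fourier (fun=> fourier f 0) (n + 1) = fourier f 0 * (0 == n + 1)%:R.
  rewrite -fourier_expz -dotL2Zl; [|exact: L2_expz..].
  by apply: eq_fourierW => z _; rewrite expr0z mulr1.
have : n + 1 <= 0 by rewrite addrC lez1D.
rewrite le_eqVlt => /orP[/eqP->|n1]; first by rewrite eqxx mulr1 subrr.
by rewrite f0// eq_sym (lt_eqF n1) mulr0 subrr.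
Qed.

Lemma bshift_lin (c : C) f g z : L2 f -> L2 g ->
  bshift (fun z => c * f z + g z) z = c * bshift f z + bshift g z.
Proof. by move=> hf hg; rewrite /bshift fourier_lin//; ring. Qed.

Lemma normL2_bshift_le f : L2 f -> normL2 (bshift f) <= 2 * normL2 f.
Proof.
move=> hf; rewrite normL2_unimod; last by move=> z z1; exact: normc_expz1.
have hc : L2 (cst (- fourier f 0)) by exact: L2_cst.
apply: le_trans (normL2D hf hc) _; rewrite mulrDl !mul1r lerD2l.
have -> : normL2 (cst (- fourier f 0)) = normL2 (fun z : C => - fourier f 0 * z ^ 0).
  by apply: eq_normL2W => z _; rewrite expr0z mulr1.
by rewrite normL2Z ?normL2_expz ?mulr1 ?normcN; [exact: normc_fourier_le | exact: L2_expz].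
Qed.

Lemma iter_shiftH n f z : iter n (@shiftH R) f z = z ^+ n * f z.
Proof. by elim: n => [|n ih]; rewrite ?expr0 ?mul1r//= /shiftH ih exprS mulrA. Qed.

Lemma L2_iter_bshift n f : L2 f -> L2 (iter n bshift f).
Proof. by move=> hf; elim: n => //= n; exact: L2_bshift. Qed.

Lemma fourier_iter_bshift n f (m : nat) : L2 f ->
  fourier (iter n bshift f) m = fourier f (n + m)%N.
Proof.
move=> hf; elim: n m => [|n ih] m //=.
by rewrite fourier_bshift ?ih ?addnS//; exact: L2_iter_bshift.
Qed.

Lemma expz_iter_bshift n f z : L2 f -> normc z = 1 ->
  z ^ n%:Z * iter n bshift f z = f z - trig_sum Posz (fourier f \o Posz) n z.
Proof.
move=> hf z1; elim: n => [|n ih]; first by rewrite expr0z mul1r /trig_sum big_ord0 subr0.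
rewrite /= {1}/bshift mulrA -expfzDr ?norm1_neq0//.
have -> : (n.+1%:Z + -1)%R = n%:Z by rewrite -addn1 PoszD addrK.
have e0 : fourier (iter n bshift f) 0 = fourier f n.
  by have := fourier_iter_bshift n 0 hf; rewrite addn0.
by rewrite mulrBr ih e0 /trig_sum big_ord_recr /=; ring.
Qed.

(** The backward shift acts as the adjoint of the shift on the Hardy space: the constant that it
    removes from v is orthogonal to z x. *)
Lemma dotL2_iter_bshift n x v : H2 x -> L2 v ->
  dotL2 x (iter n bshift v) = dotL2 (fun z => z ^ n%:Z * x z) v.
Proof.
elim: n x => [|n ih] x hx hv.
  by apply: eq_dotL2W => z _; rewrite expr0z mul1r.
have hTv := L2_iter_bshift n hv; rewrite /=; set w := iter n bshift v in hTv *.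
have hzx : H2 (fun z => z ^ 1%N * x z) := H2_expzM 1 hx.
have -> : dotL2 x (bshift w) = dotL2 (fun z => z ^ 1%N * x z) w.
  have -> : dotL2 x (bshift w) = dotL2 (fun z => z ^ 1%N * x z) (fun z => w z - fourier w 0 * z ^ 0).
    by apply: eq_dotL2W => z z1; rewrite /bshift expr0z mulr1 conjcM conj_expz//; ring.
  have h0 : L2 (fun z : C => z ^ 0) := @L2_expz R 0.
  have hzL := H2_L2 hzx; rewrite dotL2Br//; last exact: L2Z.
  rewrite dotL2Zr//.
  by rewrite -/(fourier _ 0) fourier_expzM; have [_ ->//] := hx; rewrite mulr0 subr0.
rewrite /w ih//; apply: eq_dotL2W => z z1.
by rewrite mulrA -expfzDr ?norm1_neq0// -PoszD addn1.
Qed.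

(** Multiplication by z^N is isometric, so iterated backward shifts have the norm of a Fourier
    remainder. On the Hardy space they therefore tend to 0. *)
Lemma normL2_iter_bshift N x : L2 x ->
  normL2 (iter N bshift x) = normL2 (fun z => x z - trig_sum Posz (fourier x \o Posz) N z).
Proof.
move=> hx; rewrite -(@normL2_unimod R (fun z => z ^ N%:Z)); last by move=> z; exact: normc_expz1.
by apply: eq_normL2W => z z1; rewrite expz_iter_bshift.
Qed.

Lemma normL2_iter_bshift_le N x : L2 x -> normL2 (iter N bshift x) <= normL2 x.
Proof.
move=> hx; rewrite normL2_iter_bshift// -ler_sqr ?nnegrE ?normL2_ge0//.
rewrite sqr_normL2_sub_trig_sum//; last by move=> i j [].
by rewrite gerBl; apply: sumr_ge0 => i _; exact: sqr_ge0.
Qed.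

End HardySpace.

(** * Model spaces: bounded kernels, Riesz representation, backward shift *)

Section ModelSpace.
Variable R : realType.
Local Notation C := R[i].
Local Notation H2 := (@H2 R).
Implicit Types (f g h x y : C -> C) (c : nat -> C).
Variable a : C -> C.
Hypothesis ha : inner_function a.
Local Notation Ka := (model_space a).

Let ba : Linfty a. Proof. by case: ha => -[]. Qed.
Let La : L2 a. Proof. exact: Linfty_L2. Qed.
Let mulL2 h : L2 h -> L2 (fun z => a z * h z). Proof. exact: Linfty_mulL2. Qed.
Let mulH2 h : H2 h -> H2 (fun z => a z * h z). Proof. by apply: Hinfty_mulH2; case: ha. Qed.

Lemma model_L2 f : Ka f -> L2 f.
Proof. by move=> [[]]. Qed.
Hint Resolve model_L2 : core.

Lemma L2_subspace_model : L2_subspace Ka.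
Proof.
have [H20 H2z H2lin] := L2_subspace_H2 R.
split; first by move=> f; exact: model_L2.
  by split=> // h _; exact: dotL20l.
move=> c f g [hf f0] [hg g0]; split; first exact: H2lin.
move=> h hh; rewrite dotL2_linl ?f0 ?g0 ?mulr0 ?addr0//; [exact: H2_L2..|].
exact: mulL2 (H2_L2 hh).
Qed.

Lemma eq_model f g : Ka f -> L2 g -> eq_circle f g -> Ka g.
Proof.
move=> [hf f0] hg fg; split; first exact: eq_H2 hf hg fg.
move=> h hh; rewrite -[RHS](f0 h hh).
have hm := mulL2 (H2_L2 hh).
by apply: eq_dotL2 => //; [exact: H2_L2 | exact: eq_circle_sym | exact: eq_circle_refl].
Qed.

Lemma L2_subspace_model_bounded : L2_subspace (model_space_bounded a).
Proof.
have [K0 Kz Klin] := L2_subspace_model.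
have [H20 H2z H2lin] := L2_subspace_H2 R.
split; first by move=> f [/K0].
  by split => //; split => //; exact: Linfty_cst.
move=> c f g [hf [f2 fi]] [hg [g2 gi]]; split; first exact: Klin.
by split; [exact: H2lin | exact: Linfty_lin].
Qed.

Definition model_coef m : C -> C :=
  trig_sum Posz (fun j => (fourier a (m%:Z - j%:Z))^*) m.+1.

(* The orthogonal projection of [z ^ m] onto the model space, which is bounded since
   the projection of [conj a * z ^ m] onto the Hardy space is the polynomial [model_coef m]. *)
Definition model_kernel (m : nat) : C -> C := fun z => z ^ m - a z * model_coef m z.

Lemma H2_model_coef m : H2 (model_coef m).
Proof. exact: H2_trig_sum. Qed.

Lemma model_kernel_bounded m : model_space_bounded a (model_kernel m).
Proof.
have h2 : H2 (model_kernel m).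
  apply: L2_subspaceB (L2_subspace_H2 R) (H2_expz R m) _.
  exact: mulH2 (H2_model_coef m).
have hq := H2_L2 (H2_model_coef m).
split; last split => //.
- split => // h hh; have hh2 := H2_L2 hh.
  rewrite dotL2Bl ?inner_dotL2//; [|exact: L2_expz|exact: mulL2..].
  (* It remains to see that conj(a) z^m and [model_coef m] have the same coefficients at n >= 0.
     Beyond m both vanish, because [a] has no negative frequencies. *)
  have -> : dotL2 (fun z => z ^ m) (fun z => a z * h z) = dotL2 (fun z => (a z)^* * z ^ m) h.
    by apply: eq_dotL2W => z _; rewrite conjcM; ring.
  have hc : L2 (fun z => (a z)^* * z ^ m) by exact: Linfty_mulL2 (Linfty_conj ba) (@L2_expz R m).
  rewrite -dotL2Bl// (dotL2C hh2 (L2B hc hq)) H2_dot_eq0 ?conjC0//; first exact: L2B.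
  move=> n; rewrite fourierB// fourier_conj_expz//.
  have pinj : injective Posz by move=> i j [].
  rewrite /model_coef (fourier_trig_sum_inj _ _ n pinj); case: ltnP => nm; first by rewrite subrr.
  have [[_ a0] _] := inner_Hinfty ha.
  by rewrite a0 ?conjC0 ?subrr// subr_lt0 ltz_nat.
- apply: (@eq_LinftyW _ (fun z => -1 * (a z * model_coef m z) + z ^ m)).
    by move=> z _; rewrite mulN1r addrC.
  apply: Linfty_lin; last exact: Linfty_expz.
  by apply: LinftyM => //; exact: Linfty_trig_sum.
Qed.

Lemma model_kernel_in m : Ka (model_kernel m).
Proof. by case: (model_kernel_bounded m). Qed.

(** Pythagoras. Through it, errors of projected polynomials are bounded by errors of Fourier
    sums. *)
Lemma normL2_model_le x h : Ka x -> H2 h -> normL2 x <= normL2 (fun z => x z + a z * h z).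
Proof.
move=> hx hh; rewrite -ler_sqr ?nnegrE ?normL2_ge0//.
have hah := mulL2 (H2_L2 hh).
have -> : normL2 (fun z => x z + a z * h z) = normL2 (fun z => 1 * x z + a z * h z).
  by apply: eq_normL2W => z _; rewrite mul1r.
rewrite normL2_sqr_lin ?normc1 ?expr1n ?mul1r//; last exact: model_L2.
case: hx => _ ->//; rewrite /= mulr0 addr0 lerDl.
exact: sqr_ge0.
Qed.

(** The projection of the polynomial [trig_sum Posz c N] onto the model space. *)
Definition model_sum c N : C -> C := fun z => \sum_(i < N) c i * model_kernel i z.

Lemma model_sum_bounded c N : model_space_bounded a (model_sum c N).
Proof. exact: L2_subspace_sum L2_subspace_model_bounded model_kernel_bounded. Qed.

Lemma model_sum_in c N : Ka (model_sum c N).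
Proof. by case: (model_sum_bounded c N). Qed.

Lemma model_sumE c N : exists2 q, H2 q &
  forall z, trig_sum Posz c N z = model_sum c N z + a z * q z.
Proof.
exists (fun z => \sum_(i < N) c i * model_coef i z).
  exact: L2_subspace_sum (L2_subspace_H2 R) H2_model_coef.
move=> z; rewrite mulr_sumr -big_split /=; apply: eq_bigr => i _.
by rewrite /model_kernel; ring.
Qed.

Lemma model_sum_cvg f : Ka f ->
  normL2 (fun z => f z - model_sum (fourier f \o Posz) N z) @[N --> \oo] --> 0.
Proof.
move=> hf; have [h2 _] := hf.
apply: (@squeeze_cvgr _ _ _ _ (cst 0) (fun N => normL2 (fun z => f z - trig_sum Posz (fourier f \o Posz) N z))).
- apply: nearW => N; rewrite normL2_ge0 /=.
  have [q hq qE] := model_sumE (fourier f \o Posz) N.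
  have hx : Ka (fun z => f z - model_sum (fourier f \o Posz) N z).
    exact: L2_subspaceB L2_subspace_model hf (model_sum_in _ N).
  have hq' : H2 (fun z => -1 * q z) by exact: L2_subspaceZ (L2_subspace_H2 R) hq.
  apply: le_trans (normL2_model_le hx hq') _.
  rewrite le_eqVlt; apply/orP; left; apply/eqP; apply: eq_normL2W => z _.
  by congr normc; rewrite qE; ring.
- exact: cvg_cst.
- exact: trig_sum_cvg_H2.
Qed.

Lemma bounded_on_model_eq0 (L : (C -> C) -> C) f : bounded_on Ka L ->
  (forall m, L (model_kernel m) = 0) -> Ka f -> L f = 0.
Proof.
move=> bL L0 hf.
apply: (bounded_on_lim0 L2_subspace_model bL hf _ _ (model_sum_cvg hf)) => N; first exact: model_sum_in.
rewrite (@linear_on_sum _ _ L (fourier f \o Posz) model_kernel N L2_subspace_model bL.1 model_kernel_in).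
by apply: big1 => i _; rewrite L0 mulr0.
Qed.

(** The coefficients of psi are forced by L(P z^m) = <z^m, psi>, where P is the projection. They are
    square summable: evaluating L on the projection of their own partial sum, of squared norm S,
    gives S <= |M| sqrt(S). *)
Lemma model_riesz (L : (C -> C) -> C) : bounded_on Ka L ->
  exists2 psi, H2 psi & forall f, Ka f -> L f = dotL2 f psi.
Proof.
move=> bL; have [lL [M hM]] := bL.
pose c m := (L (model_kernel m))^*.
have Lsum d N : L (model_sum d N) = \sum_(i < N) d i * (c i)^*.
  rewrite (@linear_on_sum _ _ L d model_kernel N L2_subspace_model lL model_kernel_in).
  by apply: eq_bigr => i _; rewrite /c conjCK.
have pinj : injective Posz by move=> i j [].
have cb N : \sum_(i < N) normc (c i) ^+ 2 <= M ^+ 2.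
  set S := \sum_(i < N) _.
  have S0 : 0 <= S by apply: sumr_ge0 => i _; exact: sqr_ge0.
  have SL : S = normc (L (model_sum c N)).
    rewrite Lsum -[LHS](ger0_norm S0) -normc_real rmorph_sum; congr normc.
    by apply: eq_bigr => i _; rewrite mul_conj.
  have [q hq qE] := model_sumE c N.
  have le : S <= `|M| * normL2 (trig_sum Posz c N).
    rewrite SL; apply: le_trans (hM _ (model_sum_in c N)) _.
    apply: (@le_trans _ _ (`|M| * normL2 (model_sum c N))).
      by apply: ler_wpM2r; [exact: normL2_ge0 | exact: ler_norm].
    apply: ler_wpM2l => //.
    rewrite (_ : trig_sum _ _ _ = (fun z => model_sum c N z + a z * q z)).
      exact: normL2_model_le (model_sum_in c N) hq.
    by apply/funext => z; exact: qE.
  have Sx : S = normL2 (trig_sum Posz c N) ^+ 2 by rewrite sqr_normL2_trig_sum.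
  have x0 := normL2_ge0 (trig_sum Posz c N).
  move: (normL2 _) x0 Sx le => x x0 -> le; rewrite -[M ^+ 2]real_normK ?num_real//.
  move: `|M| (normr_ge0 M) le => m m0 le.
  have [xm|mx] := leP x m; [nra|].
  have : 0 < x by lra.
  nra.
have [psi [hpsi cvpsi psie psi0]] := riesz_fischer pinj cb.
exists psi; first by split => // n n0; apply: psi0 => i; case: n n0.
move=> f hf; apply/eqP; rewrite -subr_eq0; apply/eqP.
have hfL := model_L2 hf.
apply: (@eq0_of_le_cvg0 _ _ _ (`|M| + normL2 psi) 0%N _ (trig_sum_cvg_H2 hf.1)) => N _.
set p := trig_sum _ _ _; pose s := model_sum (fourier f \o Posz) N.
have E : L s = dotL2 p psi.
  rewrite Lsum dotL2_trig_sum//; apply: eq_bigr => i _.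
  by rewrite psie.
have hs : Ka s by exact: model_sum_in.
have hp : L2 p by exact: L2_trig_sum.
have -> : L f - dotL2 f psi = L (fun z => f z - s z) - dotL2 (fun z => f z - p z) psi.
  rewrite (linear_onB L2_subspace_model lL hf hs) dotL2Bl// E; ring.
apply: le_trans (le_normcD _ _) _; rewrite normcN mulrDl; apply: lerD; last first.
  by rewrite mulrC; apply: cauchy_schwarz => //; exact: L2B.
have hfs : Ka (fun z => f z - s z) := L2_subspaceB L2_subspace_model hf hs.
apply: le_trans (hM _ hfs) _.
apply: (@le_trans _ _ (`|M| * normL2 (fun z => f z - s z))).
  by apply: ler_wpM2r; [exact: normL2_ge0 | exact: ler_norm].
apply: ler_wpM2l => //.
have [q hq qE] := model_sumE (fourier f \o Posz) N.
have hq' : H2 (fun z => -1 * q z) by exact: L2_subspaceZ (L2_subspace_H2 R) hq.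
apply: le_trans (normL2_model_le hfs hq') _.
rewrite le_eqVlt; apply/orP; left; apply/eqP; apply: eq_normL2W => z _.
by congr normc; rewrite /p qE /s; ring.
Qed.

(** <T f, a h> = <f - f^(0), z a h>. Here f is orthogonal to a (z h), and the constant is orthogonal
    to z (a h). *)
Lemma model_bshift f : Ka f -> Ka (bshift f).
Proof.
move=> [hf f0]; split; first exact: H2_bshift.
move=> h hh; have hfL := H2_L2 hf.
pose h' z := z ^ 1%N * h z.
have hh' : H2 h' by exact: (H2_expzM 1).
have hah := mulH2 hh'.
have -> : dotL2 (bshift f) (fun z => a z * h z) =
  dotL2 (fun z => f z - fourier f 0 * z ^ 0) (fun z => a z * h' z).
  apply: eq_dotL2W => z z1; rewrite /bshift /h' expr0z mulr1 !conjcM conj_expz//; ring.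
rewrite dotL2Bl//; [|by apply: L2Z; exact: L2_expz|exact: H2_L2].
rewrite f0// dotL2Zl; [|exact: L2_expz|exact: H2_L2].
rewrite (dotL2C (H2_L2 hah) (@L2_expz R 0)) -/(fourier _ 0).
have -> : fourier (fun z => a z * h' z) 0 = fourier (fun z => z ^ 1%N * (a z * h z)) 0.
  by apply: eq_fourierW => z _; rewrite /h'; ring.
rewrite fourier_expzM; have [_ ->//] := mulH2 hh.
by rewrite conjC0 mulr0 subrr.
Qed.

Lemma model_iter_bshift n f : Ka f -> Ka (iter n (@bshift R) f).
Proof. by move=> hf; elim: n => //= n; exact: model_bshift. Qed.

Lemma bounded_iter_bshift n : bounded_linear_op Ka Ka (iter n (@bshift R)).
Proof.
split; first by move=> f; exact: model_iter_bshift.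
- move=> c f g hf hg; rewrite (_ : iter n _ _ = (fun z => c * iter n (@bshift R) f z + iter n (@bshift R) g z)).
    exact: eq_circle_refl.
  elim: n => //= n ->; apply/funext => z.
  by apply: bshift_lin; apply: model_L2; exact: model_iter_bshift.
- exists (2 ^+ n) => f hf; elim: n => [|n ih] /=; first by rewrite mul1r.
  apply: le_trans (normL2_bshift_le (model_L2 (model_iter_bshift n hf))) _.
  by rewrite exprS -mulrA ler_pM2l.
Qed.

End ModelSpace.

(** * Symbols give the intertwining identity *)

Section Necessity.
Variable R : realType.
Local Notation C := R[i].
Implicit Types (f g h : C -> C).
Variables (k : nat) (k0 : (0 < k)%N) (W : (C -> C) -> (C -> C)) (hW : is_W k W).
Variables (a b : C -> C) (ha : inner_function a) (hb : inner_function b).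
Variable U : (C -> C) -> (C -> C).
Hypothesis hU : bounded_linear_op (model_space a) (model_space b) U.
Local Notation Ka := (model_space a).
Local Notation Kb := (model_space b).
Local Notation shiftk := (iter k (@shiftH R)).

Lemma W_expzM h : L2 h -> eq_circle (W (fun z => z ^ k%:Z * h z)) (fun z => z * W h z).
Proof.
have [[WL _ _] _] := hW => hh.
apply: fourier_inj; first by apply: WL; exact: L2_expzM.
  by apply: eq_L2W (L2_expzM 1 (WL _ hh)) => z _; rewrite expr1z.
move=> n; rewrite (fourier_W k0 _ hW)//; last exact: L2_expzM.
rewrite fourier_expzM (@eq_fourierW _ (fun z => z * W h z) (fun z => z ^ 1 * W h z)); last first.
  by move=> z _; rewrite expr1z.
by rewrite fourier_expzM (fourier_W k0 _ hW)// mulrBr mulr1.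
Qed.

(* [z ^ k * f] can fail to be orthogonal to [a * H2] only through [a * z ^ j], [j < k]. *)
Definition shift_obstruction (j : nat) f : C :=
  dotL2 f (fun z => a z * z ^ (j%:Z - k%:Z)).

Lemma L2_obstruction j : L2 (fun z => a z * z ^ (j%:Z - k%:Z)).
Proof. by apply: Linfty_mulL2; [case: ha => -[] | exact: L2_expz]. Qed.

Lemma L2_shiftk f : L2 f -> L2 (shiftk f).
Proof. by move=> hf; apply: eq_L2W (L2_expzM k hf) => z _; rewrite iter_shiftH. Qed.

(** Write h as z^k T^k h plus a polynomial of degree less than k. Against S^k f, the first part
    gives <f, a T^k h> = 0, and the polynomial gives a combination of the obstructions. *)
Lemma shift_obstructionP f : Ka f ->
  (forall j, (j < k)%N -> shift_obstruction j f = 0) <-> Ka (shiftk f).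
Proof.
move=> hf; have hfL := model_L2 hf; have ba : Linfty a by case: ha => -[].
split=> [ob|hs j jk]; last first.
  have hz : H2 (fun z => z ^ j%:Z) := H2_expz R j.
  have [_ /(_ _ hz) <-] := hs; apply: eq_dotL2W => z z1.
  rewrite iter_shiftH !conjcM !conj_expz// opprB expfzDr ?norm1_neq0//.
  by rewrite -[z ^+ k]/(z ^ k%:Z); ring.
split.
  have hs : H2 (fun z => z ^ k%:Z * f z) := H2_expzM k hf.1.
  by apply: (eq_H2 hs); [exact: L2_shiftk | apply: eq_circleW => z _; rewrite iter_shiftH].
move=> h hh; have hhL := H2_L2 hh.
have hT : H2 (iter k (@bshift R) h) by elim: (k) => //= n; exact: H2_bshift.
have hTa := Linfty_mulL2 ba (H2_L2 hT).
pose p z := \sum_(j < k) fourier h j * (a z * z ^ (j%:Z - k%:Z)).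
have hp : L2 p.
  apply: (@L2_subspace_sum _ _ (fun j => fourier h j) (fun j z => a z * z ^ (j%:Z - k%:Z))).
    exact: L2_subspace_L2.
  exact: L2_obstruction.
have -> : dotL2 (shiftk f) (fun z => a z * h z) =
    dotL2 f (fun z => 1 * (a z * iter k (@bshift R) h z) + p z).
  apply: eq_dotL2W => z z1; rewrite iter_shiftH mul1r.
  have z0 := norm1_neq0 z1.
  have -> : p z = a z * z ^ (- k%:Z) * trig_sum Posz (fourier h \o Posz) k z.
    rewrite /p /trig_sum mulr_sumr; apply: eq_bigr => j _.
    by rewrite expfzDr//=; ring.
  have e := expz_iter_bshift k hhL z1.
  have -> : h z = z ^ k%:Z * iter k (@bshift R) h z + trig_sum Posz (fourier h \o Posz) k z.
    by rewrite e subrK.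
  rewrite -[z ^+ k]/(z ^ k%:Z).
  have ck : z ^ k%:Z * (z ^ k%:Z)^* = 1 by rewrite conj_expz// -expfzDr// subrr expr0z.
  have ck' : (z ^ (- k%:Z))^* = z ^ k%:Z by rewrite conj_expz// opprK.
  rewrite !(conjcM, conjcD) ck'; ring: ck.
rewrite dotL2_linr//; have [_ ->//] := hf; rewrite mulr0 add0r.
rewrite (dotL2C hp hfL) (@dotL2_suml _ (fun j z => fourier h j * (a z * z ^ (j%:Z - k%:Z))))//.
  rewrite big1 ?conjC0// => j _; rewrite dotL2Zl//; last exact: L2_obstruction.
  rewrite (dotL2C hfL (L2_obstruction j)).
  by have := ob j (ltn_ord j); rewrite /shift_obstruction => ->; rewrite conjC0 mulr0.
by move=> j _; apply: L2Z; exact: L2_obstruction.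
Qed.

Definition shift_domain : set (C -> C) := [set f | Ka f /\ Ka (shiftk f)].

Lemma L2_subspace_shift_domain : L2_subspace shift_domain.
Proof.
have [KL K0 Klin] := L2_subspace_model ha.
split; first by move=> f [/KL].
  split=> //; rewrite (_ : shiftk (cst 0) = cst 0)//.
  by apply/funext => z; rewrite iter_shiftH mulr0.
move=> c f g [hf sf] [hg sg]; split; first exact: Klin.
rewrite (_ : shiftk _ = fun z => c * shiftk f z + shiftk g z); first exact: Klin.
by apply/funext => z; rewrite !iter_shiftH; ring.
Qed.

Lemma bounded_shiftk : bounded_linear_op shift_domain Ka shiftk.
Proof.
split; first by move=> f [].
- by move=> c f g _ _; apply: eq_circleW => z _; rewrite !iter_shiftH; ring.
- exists 1 => f _; rewrite mul1r le_eqVlt; apply/orP; left; apply/eqP.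
  by apply: eq_normL2W => z z1; rewrite iter_shiftH normcM normc_expr z1 expr1n mul1r.
Qed.

(** The bounded sums [s N] are corrected inside the bounded functions. Since the obstructions vanish
    at f, their values at [s N] are those at [s N - f] and are dominated by its norm, so the
    correction tends to 0. *)
Lemma shift_domain_dense f : shift_domain f ->
  exists2 F : nat -> C -> C, (forall N, shift_domain (F N) /\ model_space_bounded a (F N)) &
    normL2 (fun z => f z - F N z) @[N --> \oo] --> 0.
Proof.
move=> hf; have [hfK sf] := hf; have hfL := model_L2 hfK.
have sB := L2_subspace_model_bounded ha; have sK := L2_subspace_model ha.
have BL g : model_space_bounded a g -> L2 g by move=> [/model_L2].
have lin i : linear_on (model_space_bounded a) (shift_obstruction i).
  by case: (bounded_on_dot sB (L2_obstruction i)).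
have [u uB hu] := finite_codim_correction k sB lin.
pose s N := model_sum a (fourier f \o Posz) N.
have hs N : model_space_bounded a (s N) by exact: model_sum_bounded.
pose F N z := s N z - \sum_(j < k) shift_obstruction j (s N) * u j z.
have FB N : model_space_bounded a (F N).
  exact: L2_subspaceB sB (hs N) (@L2_subspace_sum _ _ (shift_obstruction^~ (s N)) u k sB uB).
exists F.
  move=> N; split => //; have [FK _] := FB N; split=> //.
  by apply/shift_obstructionP => // i ik; exact: hu.
pose K := 1 + \sum_(j < k) normL2 (fun z => a z * z ^ (j%:Z - k%:Z)) * normL2 (u j).
have cv := model_sum_cvg ha hfK.
apply: (@squeeze_cvgr _ _ _ _ (cst 0) (fun N => K * normL2 (fun z => f z - s N z))).
- apply: nearW => N; rewrite normL2_ge0 /= mulrDl mul1r.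
  have hfs : L2 (fun z => f z - s N z) := L2B hfL (BL _ (hs N)).
  have part n : (n <= k)%N -> normL2 (fun z => \sum_(j < n) shift_obstruction j (s N) * u j z) <=
     (\sum_(j < n) normL2 (fun z => a z * z ^ (j%:Z - k%:Z)) * normL2 (u j)) * normL2 (fun z => f z - s N z).
    elim: n => [_|n ih nk].
      rewrite big_ord0 mul0r (@eq_normL2W _ _ (fun z => 0 * f z)); last first.
        by move=> z _; rewrite big_ord0 mul0r.
      by rewrite normL2Z// normc0 mul0r.
    have hus := @L2_subspace_sum _ _ (shift_obstruction^~ (s N)) u n (L2_subspace_L2 R) (fun j => BL _ (uB j)).
    have hun : L2 (fun z => shift_obstruction n (s N) * u n z) by apply: L2Z; exact: BL.
    rewrite big_ord_recr /= mulrDl.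
    rewrite (@eq_normL2W _ _ (fun z => \sum_(j < n) shift_obstruction j (s N) * u j z + shift_obstruction n (s N) * u n z)); last first.
      by move=> z _; rewrite big_ord_recr.
    apply: le_trans (normL2D hus hun) _; apply: lerD; first by apply: ih; exact: ltnW.
    rewrite normL2Z; last exact: BL.
    rewrite mulrAC; apply: ler_wpM2r; first exact: normL2_ge0.
    have -> : normc (shift_obstruction n (s N)) = normc (dotL2 (fun z => f z - s N z) (fun z => a z * z ^ (n%:Z - k%:Z))).
      rewrite dotL2Bl//; [|exact: BL|exact: L2_obstruction].
      have -> : dotL2 f (fun z => a z * z ^ (n%:Z - k%:Z)) = 0 by apply: (iffRL (shift_obstructionP hfK) sf).
      by rewrite sub0r normcN.
    by rewrite mulrC; apply: cauchy_schwarz => //; exact: L2_obstruction.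
  have hus := @L2_subspace_sum _ _ (shift_obstruction^~ (s N)) u k (L2_subspace_L2 R) (fun j => BL _ (uB j)).
  rewrite (@eq_normL2W _ _ (fun z => (f z - s N z) + \sum_(j < k) shift_obstruction j (s N) * u j z)); last first.
    by move=> z _; rewrite /F; congr normc; ring.
  by apply: le_trans (normL2D hfs hus) _; rewrite lerD2l; exact: part.
- exact: cvg_cst.
- by rewrite -[X in _ --> X](mulr0 K); apply: cvgM => //; exact: cvg_cst.
Qed.

(** As g and S g both lie in K_b, the projection disappears from both inner products; then W_k (z^k
    phi h) = z W_k (phi h), and the two factors of modulus one cancel. *)
Lemma slant_class_intertwining f g : slant_class W a b U ->
  Ka f -> Kb g -> Ka (shiftk f) -> Kb (shiftH g) ->
  dotL2 (U (shiftk f)) (shiftH g) = dotL2 (U f) g.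
Proof.
move=> [_ [phi hphi hproj]] hf hg sf sg.
have [UK _ _] := hU; have [[WL _ _] _] := hW.
have sKa := L2_subspace_model ha; have sKb := L2_subspace_model hb.
have sD := L2_subspace_shift_domain.
have bounded_case h : shift_domain h -> model_space_bounded a h ->
    dotL2 (U (shiftk h)) (shiftH g) - dotL2 (U h) g = 0.
  move=> [hK hsK] hB; have [_ [_ hinf]] := hB.
  have hsB : model_space_bounded a (shiftk h).
    split=> //; split; first by case: hsK.
    by apply: (eq_LinftyW _ (LinftyM (Linfty_expz R k) hinf)) => z _; rewrite iter_shiftH.
  have Lphih : L2 (fun z => phi z * h z).
    by apply: eq_L2W (Linfty_mulL2 hinf hphi) => z _; rewrite mulrC.
  have Lphis : L2 (fun z => phi z * shiftk h z).
    by apply: eq_L2W (L2_expzM k Lphih) => z _; rewrite iter_shiftH mulrCA.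
  have [_ /(_ _ hg)] := hproj _ hB.
  have [_ /(_ _ sg)] := hproj _ hsB.
  have gL := model_L2 hg; have sgL := model_L2 sg.
  rewrite !dotL2Bl//; try (exact: WL); try (exact: model_L2 (UK _ _)).
  move=> /eqP; rewrite subr_eq0 => /eqP <- /eqP; rewrite subr_eq0 => /eqP <-.
  have WLh := WL _ Lphih.
  have zWL : L2 (fun z => z * W (fun z => phi z * h z) z).
    by apply: eq_L2W (L2_expzM 1 WLh) => z _; rewrite expr1z.
  rewrite (@eq_dotL2 _ _ (fun z => z * W (fun z => phi z * h z) z) _ (shiftH g))//; last 3 first.
  - exact: WL.
  - rewrite (_ : (fun z => phi z * shiftk h z) = (fun z => z ^ k%:Z * (phi z * h z))).
      exact: W_expzM Lphih.
    by apply/funext => z; rewrite iter_shiftH mulrCA.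
  - exact: eq_circle_refl.
  apply/eqP; rewrite subr_eq0; apply/eqP; apply: eq_dotL2W => z z1.
  have zz : z * z^* = 1 by rewrite mul_conj z1 expr1n.
  by rewrite /shiftH conjcM; ring: zz.
pose L h := dotL2 (U (shiftk h)) (shiftH g) - dotL2 (U h) g.
have bL : bounded_on shift_domain L.
  apply: bounded_on_sub.
    have bs := bounded_on_comp sKa sKb hU (bounded_on_dot sKb (model_L2 sg)).
    exact: (bounded_on_comp sD sKa bounded_shiftk bs).
  apply: (@bounded_onS R shift_domain Ka); first by move=> h [].
  exact: bounded_on_comp sKa sKb hU (bounded_on_dot sKb (model_L2 hg)).
have hfD : shift_domain f by [].
have [F FD Fcv] := shift_domain_dense hfD.
have : L f = 0.
  apply: (bounded_on_lim0 sD bL hfD _ _ Fcv) => N; first by case: (FD N).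
  by apply: bounded_case; case: (FD N).
by move=> /eqP; rewrite subr_eq0 => /eqP.
Qed.

End Necessity.

(** * The intertwining identity gives a symbol *)

Section Sufficiency.
Variable R : realType.
Local Notation C := R[i].
Local Notation mu := (@lebesgue_measure R).
Local Notation I01 := (`[0%R, 1%R]%classic : set R).
Implicit Types (f g h u v x : C -> C).
Local Notation T := (@bshift R).

Variables (k : nat) (k0 : (0 < k)%N) (W : (C -> C) -> (C -> C)) (hW : is_W k W).
Variables (a b : C -> C) (ha : inner_function a) (hb : inner_function b).
Variable U : (C -> C) -> (C -> C).
Hypothesis hU : bounded_linear_op (model_space a) (model_space b) U.
Local Notation Ka := (model_space a).
Local Notation Kb := (model_space b).
Local Notation shiftk := (iter k (@shiftH R)).

Hypothesis hS : forall f g, Ka f -> Kb g -> Ka (shiftk f) -> Kb (shiftH g) ->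
  dotL2 (U (shiftk f)) (shiftH g) = dotL2 (U f) g.

Let UL f : Ka f -> L2 (U f).
Proof. by case: hU => h _ _ /h /model_L2. Qed.

Definition defect u v : C := dotL2 (U u) v - dotL2 (U (iter k T u)) (T v).

(** Under these conditions u = S^k T^k u and v = S T v on the circle, so the hypothesis applies with
    f = T^k u and g = T v. *)
Lemma defect_eq0 u v : Ka u -> Kb v -> (forall j, (j < k)%N -> fourier u j = 0) ->
  fourier v 0 = 0 -> defect u v = 0.
Proof.
move=> hu hv u0 v0; have huL := model_L2 hu; have hvL := model_L2 hv.
have hTu := model_iter_bshift ha k hu; have hTv := model_bshift hb hv.
have eu : eq_circle u (shiftk (iter k T u)).
  apply: eq_circleW => z z1; rewrite iter_shiftH -[z ^+ k]/(z ^ k%:Z) expz_iter_bshift//.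
  by rewrite /trig_sum big1 ?subr0// => i _; rewrite /= u0// mul0r.
have ev : eq_circle v (shiftH (T v)).
  apply: eq_circleW => z z1; rewrite /shiftH /bshift v0 subr0 mulrA exprN1 mulfV ?mul1r//.
  exact: norm1_neq0.
have Ls : L2 (shiftk (iter k T u)) by apply: L2_shiftk; exact: model_L2 hTu.
have LTv : L2 (shiftH (T v)) by apply: eq_L2W (L2_expzM 1 (model_L2 hTv)) => z _; rewrite expr1z.
have hs : Ka (shiftk (iter k T u)) := eq_model ha hu Ls eu.
have hsT : Kb (shiftH (T v)) := eq_model hb hv LTv ev.
rewrite /defect -(hS hTu hTv hs hsT).
(* [u] and its reshifted form agree on the circle but may differ as functions on the plane, hence
   the appeal to compatibility of [U] with almost everywhere equality. *)
have eU := bounded_linear_op_eq (L2_subspace_model ha) (L2_subspace_model hb) hU hu hs eu.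
by rewrite (eq_dotL2 (UL hu) (UL hs) hvL LTv eU ev) subrr.
Qed.

Lemma bounded_defect v : L2 v -> bounded_on Ka (defect^~ v).
Proof.
move=> hv; have sKa := L2_subspace_model ha; have sKb := L2_subspace_model hb.
apply: bounded_on_sub; first exact: bounded_on_comp sKa sKb hU (bounded_on_dot sKb hv).
have bs := bounded_on_comp sKa sKb hU (bounded_on_dot sKb (L2_bshift hv)).
exact: (bounded_on_comp sKa (L2_subspace_model ha) (bounded_iter_bshift ha k) bs).
Qed.

Lemma defect_linr u (c : C) v w : Ka u -> L2 v -> L2 w ->
  defect u (fun z => c * v z + w z) = c^* * defect u v + defect u w.
Proof.
move=> hu hv hw; have hTu := model_iter_bshift ha k hu.
rewrite /defect dotL2_linr//; last exact: UL.
have -> : T (fun z => c * v z + w z) = (fun z => c * T v z + T w z).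
  by apply/funext => z; exact: bshift_lin.
rewrite dotL2_linr; [ring|exact: L2_bshift|exact: L2_bshift|exact: UL].
Qed.

(* [defect] vanishes on the subspaces cut out by [k] and one Fourier coefficients, so it is
   a form of rank at most [k + 1]; here [chi j] is [U w_j - S U T^k w_j], and [psi] comes from
   the Riesz representation. *)
Lemma defect_decomposition : exists (chi : nat -> C -> C) (psi : C -> C),
  [/\ forall j, H2 (chi j), H2 psi &
    forall u v, Ka u -> Kb v ->
      defect u v = \sum_(j < k) fourier u j * dotL2 (chi j) v + (fourier v 0)^* * dotL2 u psi].
Proof.
have sKa := L2_subspace_model ha; have sKb := L2_subspace_model hb.
have lina (i : nat) : bounded_on Ka (fun f => fourier f i) := bounded_on_dot sKa (@L2_expz R i).
have linb (i : nat) : bounded_on Kb (fun f => fourier f i) := bounded_on_dot sKb (@L2_expz R i).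
have [w wK hw] := finite_codim_correction k sKa (fun i => (lina i).1).
have [y yK hy] := finite_codim_correction 1 sKb (fun i => (linb i).1).
have yL := model_L2 (yK 0%N).
(* This is B(u', y_0) for the corrected vector u' = u - sum_j u^(j) w_j. *)
pose L u := defect u (y 0%N) - \sum_(j < k) defect (w j) (y 0%N) * fourier u j.
have bL : bounded_on Ka L.
  apply: bounded_on_sub; first exact: bounded_defect.
  exact: (@bounded_on_sum R Ka (fun j => defect (w j) (y 0%N)) (fun j f => fourier f j)).
have [psi hpsi Lpsi] := model_riesz ha bL.
have chiH j : H2 (fun z => U (w j) z - z ^ 1%N * U (iter k T (w j)) z).
  have [UK _ _] := hU.
  apply: L2_subspaceB (L2_subspace_H2 R) (UK _ (wK j)).1 _.
  by apply: H2_expzM; case: (UK _ (model_iter_bshift ha k (wK j))).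
exists (fun j z => U (w j) z - z ^ 1%N * U (iter k T (w j)) z), psi; split=> // u v hu hv.
have hvL := model_L2 hv.
have chiE j : dotL2 (fun z => U (w j) z - z ^ 1%N * U (iter k T (w j)) z) v = defect (w j) v.
  have [UK _ _] := hU; have hTw := UK _ (model_iter_bshift ha k (wK j)).
  rewrite dotL2Bl//; [|exact: UL|exact: L2_expzM (model_L2 hTw)].
  by rewrite -(dotL2_iter_bshift 1 hTw.1 hvL).
under eq_bigr => j _ do rewrite chiE.
rewrite -Lpsi//.
pose u' z := u z - \sum_(j < k) fourier u j * w j z.
have hs : Ka (fun z => \sum_(j < k) fourier u j * w j z).
  exact: (@L2_subspace_sum _ _ (fun j => fourier u j) w k sKa wK).
have hu' : Ka u' := L2_subspaceB sKa hu hs.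
have u'0 j : (j < k)%N -> fourier u' j = 0 by move=> jk; exact: hw.
pose v' z := - fourier v 0 * y 0%N z + v z.
have hv' : Kb v' by case: sKb => _ _; apply.
have v'0 : fourier v' 0 = 0.
  rewrite -[RHS](hy _ hv 0%N)//; congr (fourier _ 0); apply/funext => z.
  by rewrite big_ord1 /v' mulNr addrC.
have key w0 : L2 w0 -> defect u' w0 = defect u w0 - \sum_(j < k) fourier u j * defect (w j) w0.
  move=> hw0; have [lw0 _] := bounded_defect hw0.
  rewrite (linear_onB sKa lw0)//.
  by rewrite (@linear_on_sum _ _ _ (fun j => fourier u j) w k sKa lw0 wK).
(* The formula is the expansion of B(u', v - v^(0) y_0) = 0. *)
have := defect_eq0 hu' hv' u'0 v'0.
rewrite defect_linr// rmorphN !key// /L.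
under [\sum_(j < k) defect _ _ * _]eq_bigr => j _ do rewrite mulrC.
move=> /eqP; rewrite mulNr addrC subr_eq0 => /eqP <-; ring.
Qed.

(* [phi] is [\sum_(j < k) z ^ - j * chi j (z ^ k)], built from its Fourier coefficients
   to avoid composing with [z ^ k]. *)
Lemma symbol_exists (chi : nat -> C -> C) : (forall j, H2 (chi j)) ->
  exists2 phi, L2 phi & forall n i, (i < k)%N ->
    eq_circle (W (fun z => phi z * z ^ (n * k + i)%N)) (fun z => z ^ n%:Z * chi i z).
Proof.
move=> hchi; have pinj : injective Posz by move=> i j [].
have kZ : k%:Z != 0 by rewrite eqz_nat -lt0n.
have einj : injective (fun n : nat => k%:Z * n%:Z) by move=> i j /(mulfI kZ) [].
(* [Phi] stands for chi_j(z^k): the coefficients of chi_j are moved to the multiples of k, and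
   Bessel's inequality makes them square summable. *)
have ex j : exists Phi, L2 Phi /\ (forall q : int, fourier Phi (k%:Z * q) = fourier (chi j) q) /\
    (forall n, ~~ (k %| n)%Z -> fourier Phi n = 0).
  have [hL h0] := hchi j.
  have [Phi [hPhi _ Phie Phi0]] := @riesz_fischer R _ (fourier (chi j) \o Posz) _ einj (fun N => bessel N pinj hL).
  exists Phi; split=> //; split=> [[q|q]|n nk].
  - exact: Phie.
  - rewrite h0// Phi0// => i; apply/negP => /eqP /(mulfI kZ).
    by [].
  - by apply: Phi0 => i; apply: contra nk => /eqP <-; rewrite dvdz_mulr// dvdzz.
have [Phi hPhi] := choice ex.
pose phi z := \sum_(j < k) z ^ (- j%:Z) * Phi j z.
have PL j : L2 (fun z => z ^ (- j%:Z) * Phi j z) by apply: L2_expzM; case: (hPhi j).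
have hphi : L2 phi by apply: (@L2_sum R (fun j z => z ^ (- j%:Z) * Phi j z)).
exists phi => // n i ik.
have hz : L2 (fun z => phi z * z ^ (n * k + i)%N).
  by apply: eq_L2W (L2_expzM (n * k + i)%N hphi) => z _; rewrite mulrC.
have [[WL _ _] _] := hW.
apply: fourier_inj; [exact: WL|exact: L2_expzM (H2_L2 (hchi i))|] => m.
rewrite (fourier_W k0 m hW hz) fourier_expzM.
rewrite (@eq_fourierW _ (fun z => phi z * z ^ (n * k + i)%N) (fun z => z ^ (n * k + i)%N * phi z)); last first.
  by move=> z _; rewrite mulrC.
rewrite fourier_expzM /fourier (@dotL2_suml _ (fun j z => z ^ (- j%:Z) * Phi j z))//; last exact: L2_expz.
have E (j : 'I_k) : dotL2 (fun z => z ^ (- j%:Z) * Phi j z) (fun z => z ^ (k%:Z * m - (n * k + i)%N%:Z)) =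
    fourier (Phi j) (k%:Z * (m - n%:Z) + (j%:Z - i%:Z)).
  by rewrite -/(fourier _ _) fourier_expzM; congr fourier; rewrite PoszD PoszM; ring.
(* For j different from i, both below k, the frequency k (m - n) + (j - i) is not a multiple of k,
   so only [Phi i] contributes. *)
rewrite (bigD1 (Ordinal ik)) //= big1 ?addr0.
  by rewrite (E (Ordinal ik)) /= subrr addr0; case: (hPhi i) => _ [-> _].
move=> j ji; rewrite E; case: (hPhi j) => _ [_ ->//].
apply/negP => /dvdzP[q e].
have {}e : j%:Z - i%:Z = (q - (m - n%:Z)) * k%:Z by rewrite mulrBl -e; ring.
have : (j%:Z == i%:Z %[mod k%:Z])%Z by rewrite eqz_mod_dvd e dvdz_mull ?dvdzz.
rewrite !modz_small ?ltz_nat ?ltn_ord//= eqz_nat => /eqP ij.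
by move: ji; rewrite -val_eqE /= ij eqxx.
Qed.

Lemma telescope_defect u v N : Ka u -> Kb v ->
  dotL2 (U u) v - dotL2 (U (iter (N * k) T u)) (iter N T v) =
  \sum_(n < N) defect (iter (n * k) T u) (iter n T v).
Proof.
move=> hu hv; elim: N => [|N ih]; first by rewrite big_ord0 mul0n subrr.
rewrite big_ord_recr /= -ih /defect -iterD -mulSn -iterS; ring.
Qed.

(* [phi * x] is only controlled by [normL2 x] in L^1, hence the use of the L^1 bound on [W]. *)
Lemma normc_dotL2_W_le phi x v (M : R) : L2 phi -> Linfty x -> Linfty v ->
  ae_circle (fun z => normc (v z) <= M) ->
  normc (dotL2 (W (fun z => phi z * x z)) v) <= 2 * `|M| * k%:R * normL2 phi * normL2 x.
Proof.
move=> hphi bx bv hM; have [[WL _ _] _] := hW.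
have hx := Linfty_L2 bx; have hv := Linfty_L2 bv.
have hpx : L2 (fun z => phi z * x z).
  by apply: eq_L2W (Linfty_mulL2 bx hphi) => z _; rewrite mulrC.
have hWp := WL _ hpx.
have iWv := L2_integrable_dot hWp hv.
apply: le_trans (integral_circle_norm_le iWv) _.
rewrite -!mulrA ler_pM2l// !mulrA.
have nW := L2_integrable_normc hWp.
have nMW := integrableZl (@measurable_I01 R) `|M| nW.
apply: (@le_trans _ _ (`|M| * \int[mu]_(t in I01) normc (W (fun z => phi z * x z) (circ t)))).
  rewrite -RintegralZl// /Rintegral; apply: fine_le.
  - exact: (integrable_fin_num (@measurable_I01 R) iWv.2).
  - exact: (integrable_fin_num (@measurable_I01 R) nMW).
  apply: ae_ge0_le_integral => //.
  - by move=> t _; rewrite lee_fin normc_ge0.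
  - exact: measurable_int iWv.2.
  - by move=> t _; rewrite lee_fin mulr_ge0 ?normc_ge0.
  - exact: measurable_int nMW.
  - apply: (@filterS _ _ (ae_filter_ringOfSetsType mu)) hM => t ht tI.
    rewrite lee_fin normcM normc_conj mulrC ler_wpM2r ?normc_ge0//.
    exact: le_trans (ht tI) (ler_norm _).
rewrite -!mulrA; apply: ler_wpM2l => //.
apply: le_trans (normL1_W_le k0 hW hpx) _; apply: ler_wpM2l => //.
exact: normL1M_le.
Qed.

Lemma intertwining_slant_class : slant_class W a b U.
Proof.
split=> //.
have [chi [psi [chiH psiH dec]]] := defect_decomposition.
have [phi1 hphi1 Wphi1] := symbol_exists chiH.
have hpsi := H2_L2 psiH.
have [UK _ [M hM]] := hU; have [[WL _ _] _] := hW.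
have sKb := L2_subspace_model hb; have sL := L2_subspace_L2 R.
pose phi z := phi1 z + (psi z)^*.
have hphi : L2 phi by apply: L2D => //; exact: L2_conj.
exists phi => // u hu; have [huK [_ bu]] := hu; have huL := Linfty_L2 bu.
split; first exact: UK.
have hphi1u x : Linfty x -> L2 (fun z => phi1 z * x z).
  by move=> bx; apply: eq_L2W (Linfty_mulL2 bx hphi1) => z _; rewrite mulrC.
have hpsiu : L2 (fun z => (psi z)^* * u z).
  by apply: eq_L2W (Linfty_mulL2 bu (L2_conj hpsi)) => z _; rewrite mulrC.
have hphiu : L2 (fun z => phi z * u z).
  by apply: eq_L2W (L2D (hphi1u _ bu) hpsiu) => z _; rewrite /phi; ring.
have hWu := WL _ hphiu; have hUu := UL huK.
have hD : L2 (fun z => W (fun z => phi z * u z) z - U u z) by exact: L2B.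
(* Testing on the kernels suffices by density, and they are bounded, as the L^1 estimate for W
   demands of the test function. *)
suff main m : dotL2 (fun z => W (fun z => phi z * u z) z - U u z) (model_kernel b m) = 0.
  move=> v hv; rewrite (dotL2C (model_L2 hv) hD).
  rewrite (@bounded_on_model_eq0 _ _ hb (fun f => dotL2 f _) v (bounded_on_dot sKb hD) _ hv) ?conjC0//.
  by move=> m; rewrite (dotL2C hD (model_L2 (model_kernel_in hb m))) main conjC0.
set v := model_kernel b m.
have [hv [_ bv]] : model_space_bounded b v := model_kernel_bounded hb m.
have hvL := model_L2 hv.
pose A x := dotL2 (W x) v.
have bA : bounded_on (@L2 R) A by exact: (bounded_on_comp sL sL hW.1 (bounded_on_dot sL hvL)).
have lA := bA.1.
pose p N := trig_sum Posz (fourier u \o Posz) N.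
pose q N := trig_sum Posz (fourier v \o Posz) N.
have bp N : Linfty (p N) by exact: Linfty_trig_sum.
(* Every frequency below N k is uniquely n k + j with j < k, and <chi_j, T^n v> = <z^n chi_j, v> =
   <W (phi1 z^(n k + j)), v>. *)
have sum1 N : \sum_(n < N) \sum_(j < k) fourier u (n * k + j)%N * dotL2 (chi j) (iter n T v) =
    A (fun z => phi1 z * p (N * k)%N z).
  pose F i z := phi1 z * z ^ Posz i.
  have FL i : L2 (F i) by apply: hphi1u; exact: Linfty_expz.
  have -> : (fun z => phi1 z * p (N * k)%N z) = (fun z => \sum_(i < N * k) fourier u i * F i z).
    apply/funext => z; rewrite /p /trig_sum mulr_sumr; apply: eq_bigr => i _.
    by rewrite /F /=; ring.
  rewrite (@linear_on_sum _ _ A (fun i => fourier u i) F (N * k) sL lA FL).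
  elim: N => [|N ih]; first by rewrite !big_ord0.
  rewrite big_ord_recr /= ih mulSn addnC big_split_ord /=; congr (_ + _).
  apply: eq_bigr => j _; congr (_ * _).
  rewrite (dotL2_iter_bshift N (chiH j) hvL).
  apply: eq_dotL2 => //; [exact: L2_expzM (H2_L2 (chiH j))|exact: WL (FL _)| |exact: eq_circle_refl].
  exact: eq_circle_sym (Wphi1 N j (ltn_ord j)).
(* The coefficient of W (conj(psi) u) at n is that of conj(psi) u at k n, namely <u, z^(k n) psi> =
   <T^(k n) u, psi>. *)
have sum2 N : \sum_(n < N) (fourier v n)^* * dotL2 (iter (n * k) T u) psi =
    dotL2 (W (fun z => (psi z)^* * u z)) (q N).
  have hWpsi := WL _ hpsiu.
  rewrite (dotL2C (L2_trig_sum _ _ N) hWpsi) dotL2_trig_sum// rmorph_sum; apply: eq_bigr => n _.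
  rewrite /= conjcM conjCK; congr (_ * _).
  rewrite (fourier_W k0 _ hW hpsiu) (dotL2C hpsi (L2_iter_bshift _ huL)) (dotL2_iter_bshift _ psiH huL).
  rewrite -(dotL2C (L2_expzM _ hpsi) huL); apply: eq_dotL2W => z z1.
  by rewrite conjcM mulnC PoszM; ring.
have tele N : dotL2 (U u) v - dotL2 (U (iter (N * k) T u)) (iter N T v) =
    A (fun z => phi1 z * p (N * k)%N z) + dotL2 (W (fun z => (psi z)^* * u z)) (q N).
  rewrite telescope_defect// -sum1 -sum2 -big_split /=; apply: eq_bigr => n _.
  rewrite (dec _ _ (model_iter_bshift ha (n * k) huK) (model_iter_bshift hb n hv)).
  congr (_ + _); last by rewrite fourier_iter_bshift// addn0.
  by apply: eq_bigr => j _; rewrite fourier_iter_bshift.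
have Asplit : A (fun z => phi z * u z) = A (fun z => phi1 z * u z) + A (fun z => (psi z)^* * u z).
  rewrite -[X in _ = X + _]mul1r -lA//; last exact: hphi1u.
  by congr A; apply/funext => z; rewrite /phi; ring.
have [Mv hMv] := bv.2.
pose K1 := 2 * `|Mv| * k%:R * normL2 phi1; pose K2 := normL2 (W (fun z => (psi z)^* * u z)).
(* N terms of the telescoping sum consume N k coefficients of u but only N of v. *)
pose r N := normL2 (fun z => u z - p (N * k)%N z) + normL2 (fun z => v z - q N z).
have rcv : r N @[N --> \oo] --> 0.
  rewrite -[X in _ --> X]addr0; apply: cvgD; last exact: trig_sum_cvg_H2 hv.1.
  apply: (@cvg_comp _ _ _ (fun N => (N * k)%N) _ _ \oo _ _ (trig_sum_cvg_H2 huK.1)).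
  apply/cvgnyPge => A0; exists A0 => // n /= /leq_trans; apply.
  by rewrite leq_pmulr.
apply: (@eq0_of_le_cvg0 _ _ _ (`|K1| + K2 + `|M| * normL2 u) 0%N _ rcv) => N _.
rewrite dotL2Bl//.
(* Subtracting the telescoped identity leaves three errors: the first is bounded by the L^1 estimate
   for W, the other two by Cauchy-Schwarz, the last with the norm of T^N v equal to that of v -
   q_N. *)
have -> : dotL2 (W (fun z => phi z * u z)) v - dotL2 (U u) v =
   A (fun z => phi1 z * (u z - p (N * k)%N z)) +
   (dotL2 (W (fun z => (psi z)^* * u z)) (fun z => v z - q N z) -
    dotL2 (U (iter (N * k) T u)) (iter N T v)).
  have -> : A (fun z => phi1 z * (u z - p (N * k)%N z)) = A (fun z => phi1 z * u z) - A (fun z => phi1 z * p (N * k)%N z).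
    rewrite -(linear_onB sL lA (hphi1u _ bu) (hphi1u _ (bp _))); congr A; apply/funext => z; ring.
  rewrite dotL2Br//; [|exact: L2_trig_sum|exact: WL].
  have := tele N; rewrite -[dotL2 (W _) v]/(A _) Asplit => /eqP.
  rewrite subr_eq => /eqP ->; rewrite -[dotL2 (W _) v]/(A _); ring.
have bup : Linfty (fun z => u z - p (N * k)%N z).
  apply: (@eq_LinftyW _ (fun z => -1 * p (N * k)%N z + u z)).
    by move=> z _; rewrite mulN1r addrC.
  exact: Linfty_lin.
have n1 := normc_dotL2_W_le hphi1 bup bv hMv.
have n2 := cauchy_schwarz (WL _ hpsiu) (L2B hvL (L2_trig_sum Posz (fourier v \o Posz) N)).
have hTu := model_iter_bshift ha (N * k) huK.
have hTv := model_iter_bshift hb N hv.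
have n3 := cauchy_schwarz (UL hTu) (model_L2 hTv).
have n4 := hM _ hTu.
have n5 := normL2_iter_bshift_le (N * k) huL.
have n6 := normL2_iter_bshift N hvL.
apply: le_trans (le_normcD _ _) _.
apply: (@le_trans _ _ (K1 * normL2 (fun z => u z - p (N * k)%N z) +
   (K2 * normL2 (fun z => v z - q N z) + `|M| * normL2 u * normL2 (fun z => v z - q N z)))).
  apply: lerD; first exact: n1.
  apply: le_trans (le_normcD _ _) _; rewrite normcN; apply: lerD; first exact: n2.
  apply: le_trans n3 _; rewrite n6; apply: ler_wpM2r; first exact: normL2_ge0.
  apply: le_trans n4 _; apply: (@le_trans _ _ (`|M| * normL2 (iter (N * k) T u))).
    by apply: ler_wpM2r; [exact: normL2_ge0 | exact: ler_norm].
  exact: ler_wpM2l.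
rewrite /r.
have x0 := normL2_ge0 (fun z => u z - p (N * k)%N z).
have y0 := normL2_ge0 (fun z => v z - q N z).
have K20 : 0 <= K2 := normL2_ge0 _.
have s0 := mulr_ge0 (normr_ge0 M) (normL2_ge0 u).
have K1x := ler_wpM2r x0 (ler_norm K1).
have K1y := mulr_ge0 (normr_ge0 K1) y0.
have K2x := mulr_ge0 K20 x0; have sx := mulr_ge0 s0 x0.
lra.
Qed.

End Sufficiency.

Theorem theorem2p1 (R : realType) (k : nat) (hk : (0 < k)%N)
  (W : (R[i] -> R[i]) -> (R[i] -> R[i])) (hW : is_W k W)
  (alpha beta : R[i] -> R[i])
  (halpha : inner_function alpha) (hbeta : inner_function beta)
  (nalpha : nonconstant alpha) (nbeta : nonconstant beta)
  (U : (R[i] -> R[i]) -> (R[i] -> R[i]))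
  (hU : bounded_linear_op (model_space alpha) (model_space beta) U) :
  slant_class W alpha beta U <->
  (forall f g : R[i] -> R[i], model_space alpha f -> model_space beta g ->
    model_space alpha (iter k (@shiftH R) f) -> model_space beta (shiftH g) ->
    dotL2 (U (iter k (@shiftH R) f)) (shiftH g) = dotL2 (U f) g).
Proof.
split=> [hS f g hf hg sf sg|hS].
  exact: (slant_class_intertwining hk hW halpha hbeta hU hS hf hg sf sg).
exact: (intertwining_slant_class hk hW halpha hbeta hU hS).
Qed.
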